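(* Let $M$ be a real hypersurface of a complex hyperbolic two-plane Grassmannian $SU_{2,m}/S(U_2\cdot U_m)$, with $n=4m-1$. Then: (a) The generalized normalized $\delta$-Casorati curvature $\delta_c(r,n-1)$ satisfies $$\rho \leq \frac{\delta_c(r,n-1)}{n(n-1)} - \frac{n+9}{2n}$$ for any $r\in\mathbb{R}$ with $0<r<n(n-1)$. (b) The generalized normalized $\delta$-Casorati curvature $\widehat{\delta}_c(r,n-1)$ satisfies $$\rho \leq \frac{\widehat{\delta}_c(r,n-1)}{n(n-1)} - \frac{n+9}{2n}$$ for any $r\in\mathbb{R}$ with $r>n(n-1)$. Moreover, the equalities hold in the relations of (a) and (b) if and only if $M$ is an invariantly quasi-umbilical submanifold with flat normal connection in $SU_{2,m}/S(U_2\cdot U_m)$ such that, with some orthonormal tangent frame $\{e_1,\dots,e_n\}$ of $TM$ and orthonormal normal frame $\{e_{n+1}=e\}$ of $TM^\perp$, the shape operator $A_e$ takes the following form $$A_e=\begin{pmatrix} a & 0 & \cdots & 0 & 0\\ 0 & a & \cdots & 0 & 0\\ \vdots & \vdots & \ddots & \vdots & \vdots\\ 0 & 0 & \cdots & a & 0\\ 0 & 0 & \cdots & 0 & \frac{n(n-1)}{r}a\end{pmatrix},$$ where $a$ denotes the common value of the first $n-1$ diagonal entries.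
   Context: Ambient space. $SU_{2,m}/S(U_2\cdot U_m)$ is the complex hyperbolic two-plane Grassmannian, a connected simply connected irreducible Riemannian symmetric space of noncompact type and rank two, of real dimension $4m$, with metric $g$, a Kähler structure $J$ and a quaternionic Kähler structure $E$ (a rank 3 subbundle of the endomorphism bundle of the tangent bundle) with $J\notin E$. Locally $E$ has a basis $\{J_1,J_2,J_3\}$ with $J_\alpha^2=-\mathrm{id}$, $J_\alpha J_{\alpha+1}=-J_{\alpha+1}J_\alpha=J_{\alpha+2}$ (indices mod 3), $g(J_\alpha X,J_\alpha Y)=g(X,Y)$, and $J_\alpha J=JJ_\alpha$. The Riemannian curvature tensor of $g$ is locally given by $$\overline{R}(X,Y)Z = -\frac12\Big[g(Y,Z)X-g(X,Z)Y+g(JY,Z)JX-g(JX,Z)JY-2g(JX,Y)JZ$$ $$+\sum_{\alpha=1}^3\{g(J_\alpha Y,Z)J_\alpha X-g(J_\alpha X,Z)J_\alpha Y-2g(J_\alpha X,Y)J_\alpha Z\}+\sum_{\alpha=1}^3\{g(J_\alpha JY,Z)J_\alpha JX-g(J_\alpha JX,Z)J_\alpha JY\}\Big].$$ Hypersurface. A real hypersurface $M$ is a submanifold of real codimension one, with the induced metric; $n=\dim M$. $R$ is the curvature tensor of $M$, $h$ its second fundamental form, $e$ a local unit normal vector field, $A_e$ the shape operator with respect to $e$, and, for a local orthonormal tangent frame $\{e_1,\dots,e_n\}$, $h_{ij}=g(h(e_i,e_j),e)$. Curvatures. With $K(e_i\wedge e_j)=g(R(e_i,e_j)e_j,e_i)$,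 the scalar curvature of $M$ is $\tau=\sum_{1\le i<j\le n}K(e_i\wedge e_j)$ and the normalized scalar curvature is $\rho=\frac{2\tau}{n(n-1)}$. The Casorati curvature is $C=\frac1n\|h\|^2=\frac1n\sum_{i,j=1}^n h_{ij}^2$. For a hyperplane $L\subset T_pM$ with orthonormal basis $\{e_1,\dots,e_{n-1}\}$, $C(L)=\frac1{n-1}\sum_{i,j=1}^{n-1}h_{ij}^2$. The generalized normalized $\delta$-Casorati curvatures are $$[\delta_c(r,n-1)](p)=rC(p)+\frac{(n-1)(n+r)(n^2-n-r)}{rn}\inf\{C(L)\mid L\text{ a hyperplane of }T_pM\},\quad 0<r<n^2-n,$$ $$[\widehat\delta_c(r,n-1)](p)=rC(p)-\frac{(n-1)(n+r)(r-n^2+n)}{rn}\sup\{C(L)\mid L\text{ a hyperplane of }T_pM\},\quad r>n^2-n.$$ Invariantly quasi-umbilical. A submanifold of dimension $n$ is invariantly quasi-umbilical if there exists a local orthonormal normal frame $\{e_\alpha\}$ such that the shape operators $A_{e_\alpha}$ have an eigenvalue of multiplicity $n-1$ for all $\alpha$ and the distinguished eigendirection of $A_{e_\alpha}$ is the same for each $\alpha$. The normal connection is flat if its curvature vanishes. *)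

(* Defs.v *)
From HB Require Import structures.
From mathcomp Require Import all_boot all_order all_algebra.
From mathcomp Require Import complex.
From mathcomp Require Import all_classical all_reals all_analysis.
Import numFieldNormedType.Exports.

Set Implicit Arguments.
Unset Strict Implicit.
Unset Printing Implicit Defensive.
Import Order.TTheory GRing.Theory Num.Theory.
Local Open Scope classical_set_scope.
Local Open Scope ring_scope.

Section PartialDerivatives.
Variables (R : realType) (n : nat) (W : normedModType R).
Implicit Types f : 'rV[R]_n -> W.

Definition pder (i : 'I_n) f : 'rV[R]_n -> W := 'D_(delta_mx 0 i : 'rV[R]_n) f.

(* C^infinity: every iterated partial derivative is Frechet differentiable. *)
Definition smooth_on (U : set 'rV[R]_n) f : Prop :=
  forall (s : seq 'I_n) u, U u -> differentiable (foldr pder f s) u.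

End PartialDerivatives.

(* Levi-Civita connection and curvature of a Riemannian metric given by its
   Gram matrix g u = (g_ij(u)) in the coordinate frame.  Tangent vectors are
   row vectors of coordinates. *)
Section RiemannianMetric.
Variables (R : realType) (n : nat) (g : 'rV[R]_n -> 'M[R]_n).

Definition inner (S : 'M[R]_n) (X Y : 'rV[R]_n) : R := (X *m S *m Y^T) 0 0.

Definition dmetric (i j k : 'I_n) : 'rV[R]_n -> R^o := pder i (fun u => g u j k : R^o).

(* Gamma^k_ij *)
Definition christoffel (k i j : 'I_n) (u : 'rV[R]_n) : R^o :=
  2^-1 * \sum_l invmx (g u) k l *
           (dmetric i j l u + dmetric j i l u - dmetric l i j u).

(* R(d_i, d_j) d_k = \sum_l (riemann l i j k) d_l, for
   R(X,Y) = nabla_X nabla_Y - nabla_Y nabla_X - nabla_[X,Y]. *)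
Definition riemann (l i j k : 'I_n) (u : 'rV[R]_n) : R :=
  pder i (christoffel l j k) u - pder j (christoffel l i k) u
  + \sum_s (christoffel s j k u * christoffel l i s u
            - christoffel s i k u * christoffel l j s u).

Definition curvature (u X Y Z : 'rV[R]_n) : 'rV[R]_n :=
  \row_l \sum_i \sum_j \sum_k X 0 i * Y 0 j * Z 0 k * riemann l i j k u.

(* K(X /\ Y), for X and Y orthonormal *)
Definition sectional (u X Y : 'rV[R]_n) : R :=
  inner (g u) (curvature u X Y Y) X.

(* The rows of F are orthonormal at u. *)
Definition orthonormal k (u : 'rV[R]_n) (F : 'M[R]_(k, n)) : Prop :=
  F *m g u *m F^T = 1%:M.

Definition scalar_curvature (u : 'rV[R]_n) (E : 'M[R]_n) : R :=
  \sum_(i < n) \sum_(j < n | (i < j)%N) sectional u (row i E) (row j E).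

Definition normalized_scalar_curvature (u : 'rV[R]_n) (E : 'M[R]_n) : R :=
  2 * scalar_curvature u E / (n%:R * (n%:R - 1)).

End RiemannianMetric.

(* Extrinsic geometry of an immersion f of an open subset of R^n into an open
   subset of R^N carrying the Riemannian metric G.  Vectors tangent to the
   source are rows of coordinates in 'rV_n, vectors tangent to the ambient
   space are rows of coordinates in 'rV_N. *)
Section Immersion.
Variables (R : realType) (n N : nat) (G : 'rV[R]_N -> 'M[R]_N).
Variable f : 'rV[R]_n -> 'rV[R]_N.

Definition jac (u : 'rV[R]_n) : 'M[R]_(n, N) := \matrix_i pder i f u.

Definition induced_metric (u : 'rV[R]_n) : 'M[R]_n :=
  jac u *m G (f u) *m (jac u)^T.

Definition normal_at (u : 'rV[R]_n) (v : 'rV[R]_N) : Prop :=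
  forall i, inner (G (f u)) v (pder i f u) = 0.

Definition unit_normal (u : 'rV[R]_n) (e : 'rV[R]_N) : Prop :=
  normal_at u e /\ inner (G (f u)) e e = 1.

Definition normal_part (u : 'rV[R]_n) (v : 'rV[R]_N) : 'rV[R]_N :=
  v - v *m G (f u) *m (jac u)^T *m invmx (induced_metric u) *m jac u.

(* Ambient covariant derivative, in the direction of d_i f, of a vector field
   V along f. *)
Definition ambient_cov (i : 'I_n) (V : 'rV[R]_n -> 'rV[R]_N) (u : 'rV[R]_n) :
    'rV[R]_N :=
  pder i V u +
  \row_k \sum_a \sum_b pder i f u 0 a * V u 0 b * christoffel G k a b (f u).

Definition second_ff (u X Y : 'rV[R]_n) : 'rV[R]_N :=
  \sum_i \sum_j (X 0 i * Y 0 j) *: normal_part u (ambient_cov i (pder j f) u).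

(* X |-> X *m shape_operator u e is the operator A_e determined by
   g(A_e X, Y) = G(h(X, Y), e). *)
Definition shape_operator (u : 'rV[R]_n) (e : 'rV[R]_N) : 'M[R]_n :=
  (\matrix_(i, j) inner (G (f u)) (second_ff u (delta_mx 0 i) (delta_mx 0 j)) e)
    *m invmx (induced_metric u).

Definition normal_cov (i : 'I_n) (xi : 'rV[R]_n -> 'rV[R]_N) (u : 'rV[R]_n) :
    'rV[R]_N :=
  normal_part u (ambient_cov i xi u).

(* The coordinate fields commute, so R^perp(d_i, d_j) is the commutator of
   the covariant derivatives. *)
Definition flat_normal_connection (U : set 'rV[R]_n) : Prop :=
  forall (W : set 'rV[R]_n) (xi : 'rV[R]_n -> 'rV[R]_N),
    open W -> W `<=` U -> smooth_on W xi -> (forall u, W u -> normal_at u (xi u)) ->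
    forall u, W u -> forall i j,
      normal_cov i (normal_cov j xi) u = normal_cov j (normal_cov i xi) u.

Definition normal_frame (W : set 'rV[R]_n)
    (xi : 'I_(N - n) -> 'rV[R]_n -> 'rV[R]_N) : Prop :=
  (forall al, smooth_on W (xi al)) /\
  (forall u, W u -> forall al, normal_at u (xi al u)) /\
  (forall u, W u -> forall al be,
     inner (G (f u)) (xi al u) (xi be u) = (al == be)%:R).

(* A has the eigenvalue lam on the hyperplane orthogonal to w, and w is the
   distinguished eigendirection.  As usual for quasi-umbilicity, the eigenvalue
   mu along w may coincide with lam. *)
Definition distinguished_direction (u : 'rV[R]_n) (A : 'M[R]_n) (w : 'rV[R]_n) :
    Prop :=
  exists lam mu : R,
    (kermx (induced_metric u *m w^T) <= eigenspace A lam)%MS /\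
    (w <= eigenspace A mu)%MS.

Definition invariantly_quasi_umbilical (U : set 'rV[R]_n) : Prop :=
  forall u0, U u0 ->
  exists (W : set 'rV[R]_n) (xi : 'I_(N - n) -> 'rV[R]_n -> 'rV[R]_N),
    open W /\ W u0 /\ W `<=` U /\ normal_frame W xi /\
    forall u, W u -> exists w : 'rV[R]_n, w != 0 /\
      forall al, distinguished_direction u (shape_operator u (xi al u)) w.

(* Casorati curvature, with respect to the unit normal e, of the subspace with
   orthonormal basis the rows of F; F : 'M_n gives the Casorati curvature C. *)
Definition casorati k (u : 'rV[R]_n) (e : 'rV[R]_N) (F : 'M[R]_(k, n)) : R :=
  k%:R^-1 * \sum_i \sum_j
    (inner (G (f u)) (second_ff u (row i F) (row j F)) e) ^+ 2.

Definition hyperplane_casorati (u : 'rV[R]_n) (e : 'rV[R]_N) : set R :=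
  [set c | exists (L : 'M[R]_n) (F : 'M[R]_(n.-1, n)),
     \rank L = n.-1 /\ (F == L)%MS /\ orthonormal induced_metric u F /\
     c = casorati u e F].

Definition delta_casorati (r : R) (u : 'rV[R]_n) (E : 'M[R]_n) (e : 'rV[R]_N) : R :=
  let d : R := n%:R in
  r * casorati u e E
  + (d - 1) * (d + r) * (d ^+ 2 - d - r) / (r * d) * inf (hyperplane_casorati u e).

Definition delta_casorati_hat (r : R) (u : 'rV[R]_n) (E : 'M[R]_n) (e : 'rV[R]_N) : R :=
  let d : R := n%:R in
  r * casorati u e E
  - (d - 1) * (d + r) * (r - d ^+ 2 + d) / (r * d) * sup (hyperplane_casorati u e).

(* diag (a, ..., a, n (n - 1) / r * a) *)
Definition special_diag (r a : R) : 'M[R]_n :=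
  diag_mx (\row_(i < n)
    if i.+1 == n :> nat then n%:R * (n%:R - 1) / r * a else a).

(* The matrix of A_e in the frame E of T_pM is the diagonal matrix above. *)
Definition special_shape (r : R) (u : 'rV[R]_n) : Prop :=
  exists (E : 'M[R]_n) (e : 'rV[R]_N) (a : R),
    orthonormal induced_metric u E /\ unit_normal u e /\
    E *m shape_operator u e *m invmx E = special_diag r a.

End Immersion.

(* Local parametrizations (inverses of charts) of a topological space. *)
Record local_param (R : realType) (n : nat) (T : topologicalType) := LocalParam {
  lp_dom : set 'rV[R]_n;
  lp_map :> 'rV[R]_n -> T }.

(* x is a homeomorphism from an open set onto an open set. *)
Definition homeo_param (R : realType) n (T : topologicalType)
    (x : local_param R n T) : Prop :=
  open (lp_dom x) /\ set_inj (lp_dom x) x /\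
  (forall u, lp_dom x u -> {for u, continuous x}) /\
  (forall V : set 'rV[R]_n, open V -> V `<=` lp_dom x -> open (x @` V)).

Definition smooth_transition (R : realType) n (T : topologicalType)
    (x y : local_param R n T) : Prop :=
  exists psi : 'rV[R]_n -> 'rV[R]_n,
    let U := lp_dom x `&` [set u | (y @` lp_dom y) (x u)] in
    smooth_on U psi /\ forall u, U u -> lp_dom y (psi u) /\ y (psi u) = x u.

(* Immersed n-dimensional smooth submanifolds of an open subset D of R^N. *)
Record submanifold (R : realType) (n N : nat) (D : set 'rV[R]_N) := Submanifold {
  sm_space :> topologicalType;
  sm_hausdorff : hausdorff_space sm_space;
  sm_second_countable : @second_countable sm_space;
  sm_atlas : set (local_param R n sm_space);
  sm_cover : forall p : sm_space,
    exists x u, sm_atlas x /\ lp_dom x u /\ x u = p;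
  sm_homeo : forall x, sm_atlas x -> homeo_param x;
  sm_transition : forall x y, sm_atlas x -> sm_atlas y -> smooth_transition x y;
  sm_imm : sm_space -> 'rV[R]_N;
  sm_imm_dom : forall p, D (sm_imm p);
  sm_imm_smooth : forall x, sm_atlas x -> smooth_on (lp_dom x) (sm_imm \o x);
  sm_imm_immersion : forall x u, sm_atlas x -> lp_dom x u ->
    row_free (jac (sm_imm \o x) u) }.

Arguments sm_atlas {R n N D} s.
Arguments sm_imm {R n N D} s p.

(* The complex hyperbolic two-plane Grassmannian SU_{2,m}/S(U_2 U_m) in its
   Harish-Chandra realization, the bounded symmetric domain of 2 x m complex
   matrices Z with I - Z Z^* > 0: the coset of (a b; c d) in SU_{2,m} is
   Z = b d^-1, i.e. SU_{2,m} acts by Z |-> (a Z + b) (c Z + d)^-1 and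
   S(U_2 U_m) is the isotropy group of 0.  A point has 4 m real coordinates:
   the 2 m entries of Re Z followed by those of Im Z. *)
Section Grassmannian.
Variables (R : realType) (m : nat).

Definition gr_dim : nat := (2 * m + 2 * m)%N.

Definition cmatrix (z : 'rV[R]_gr_dim) : 'M[R[i]]_(2, m) :=
  \matrix_(i, j) Complex ((vec_mx (lsubmx z) : 'M[R]_(2, m)) i j)
                         ((vec_mx (rsubmx z) : 'M[R]_(2, m)) i j).

Definition ctrmx p q (A : 'M[R[i]]_(p, q)) : 'M[R[i]]_(q, p) :=
  map_mx (@conjc R) A^T.

Definition pos_def p (A : 'M[R[i]]_p) : Prop :=
  forall v : 'rV[R[i]]_p, v != 0 -> 0 < (v *m A *m ctrmx v) 0 0.

Definition gr_domain : set 'rV[R]_gr_dim :=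
  [set z | pos_def (1%:M - cmatrix z *m ctrmx (cmatrix z))].

(* The SU_{2,m}-invariant metric
     g_Z(X, Y) = Re tr ((I - Z Z^* )^-1 X (I - Z^* Z)^-1 Y^* ).
   The scale is the one for which the curvature tensor is
     -1/2 [g(Y,Z)X - g(X,Z)Y + g(JY,Z)JX - g(JX,Z)JY - 2g(JX,Y)JZ + ...],
   i.e. the minimum of the sectional curvature is -4; here J is multiplication
   by 'i, and at Z = 0 the quaternionic structure is X |-> p X, p in su(2). *)
Definition gr_metric (z : 'rV[R]_gr_dim) : 'M[R]_gr_dim :=
  let Z := cmatrix z in
  \matrix_(a, b) complex.Re (\tr (
     invmx (1%:M - Z *m ctrmx Z) *m cmatrix (delta_mx 0 a) *m
     invmx (1%:M - ctrmx Z *m Z) *m ctrmx (cmatrix (delta_mx 0 b)))).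

End Grassmannian.

Definition hyp_dim (m : nat) : nat := (4 * m).-1.

Definition real_hypersurface (R : realType) (m : nat) :=
  submanifold (hyp_dim m) (@gr_domain R m).

Section Hypersurface.
Variables (R : realType) (m : nat) (M : real_hypersurface R m).
Let n := hyp_dim m.
Let N := gr_dim m.

(* E is an orthonormal basis of T_pM and e a unit normal at the point p of M
   with coordinates u in some parametrization of the atlas, f being the
   immersion read in this parametrization. *)
Definition frame_at (f : 'rV[R]_n -> 'rV[R]_N) (u : 'rV[R]_n)
    (E : 'M[R]_n) (e : 'rV[R]_N) : Prop :=
  (exists x, sm_atlas M x /\ lp_dom x u /\ f = sm_imm M \o x) /\
  orthonormal (induced_metric (@gr_metric R m) f) u E /\
  unit_normal (@gr_metric R m) f u e.

Definition rho (f : 'rV[R]_n -> 'rV[R]_N) (u : 'rV[R]_n) (E : 'M[R]_n) : R :=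
  normalized_scalar_curvature (induced_metric (@gr_metric R m) f) u E.

Definition hs_invariantly_quasi_umbilical : Prop :=
  forall x, sm_atlas M x ->
    invariantly_quasi_umbilical (@gr_metric R m) (sm_imm M \o x) (lp_dom x).

Definition hs_flat_normal_connection : Prop :=
  forall x, sm_atlas M x ->
    flat_normal_connection (@gr_metric R m) (sm_imm M \o x) (lp_dom x).

Definition hs_special_shape (r : R) : Prop :=
  forall x u, sm_atlas M x -> lp_dom x u ->
    special_shape (@gr_metric R m) (sm_imm M \o x) r u.

End Hypersurface.

(* Main.v *)
Require Import Defs.
From mathcomp Require Import all_boot all_order all_algebra.
From mathcomp Require Import complex.
From mathcomp Require Import all_classical all_reals all_analysis.
From mathcomp Require Import zify ring lra.
Import numFieldNormedType.Exports.

Set Implicit Arguments.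
Unset Strict Implicit.
Unset Printing Implicit Defensive.
Import Order.TTheory GRing.Theory Num.Theory.
Local Open Scope classical_set_scope.
Local Open Scope ring_scope.

(** By the Gauss equation [2 tau] is the double sum of ambient sectional
    curvatures over a tangent frame plus [(tr h)^2 - |h|^2].  The ambient space
    is Einstein with constant [-(2m + 4) = -(n + 9) / 2], so
    [n (n - 1) rho = (tr h)^2 - |h|^2 - (n - 1) (n + 9) / 2], and the theorem is
    an inequality between [(tr h)^2], [|h|^2] and the extremal [C(L)]: for every
    hyperplane [L] the difference [(n + r) C + c(r) C(L) - (tr h)^2] is an
    explicit sum of squares, vanishing only if [h] is diagonal with entries
    [a, ..., a, n (n - 1) / r * a].  The extremal [L] exists by compactness, so
    equality in the bound is equality in this identity for that [L].

    The Einstein constant comes from the bounded symmetric domain: with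
    [P = (1 - Z Z^* )^-1], [Q = (1 - Z^* Z)^-1] and [M = Z^* P] the connection is
    [Gamma(X, Y) = X M Y + Y M X] and, writing [X' = Q X^* P], the curvature is
    [R(X, Y) W = Y X' W + W X' Y - X Y' W - W Y' X].  The trace of
    [X |-> R(X, Y) Y] is that of its complex-linear part, the antilinear part
    [X |-> 2 Y X' Y] being traceless.

    In codimension one the flatness of the normal connection and the existence
    of a smooth unit normal frame are automatic. *)

(** Let [t] be the trace of [h] on [L] and [b] its value on the unit conormal of [L]. Once the mixed
    entries and the traceless part of [h] on [L] are split off, a quadratic form in [t] and [b]
    remains, and [c(r)] is the coefficient for which it is the perfect square
    [(n t - r b)^2 / (r n)]. With [t = (n - 1) a] it vanishes at [b = n (n - 1) a / r], which is
    where the last diagonal entry comes from. Since [c(r)] changes sign at [r = n (n - 1)], the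
    infimum and the supremum both minimize [c(r) C(L)], so that one argument serves (a) and (b).

    The Gauss equation is obtained without extending tangent fields to the ambient space. The
    Jacobian is read as [n] vector fields along the immersion and differentiated twice with the
    pulled-back connection; with vectors as rows everything becomes an identity between matrices.

    Calculus with the metric takes place on the open set where [1 - Z Z^*] and [1 - Z^* Z] are
    invertible and the metric is nondegenerate; positivity is used at points of the hypersurface. *)

Local Notation Re := complex.Re.
Local Notation Im := complex.Im.

(** A little-o expansion depends only on the germ, and uniqueness of the differential then
    identifies that of [g] with that of [f]. *)
Lemma near_eq_differentiable (R : numFieldType) (V W : normedModType R)
    (f g : V -> W) (x : V) :
  (\forall y \near x, f y = g y) -> differentiable f x -> differentiable g x.
Proof.
move=> fg df; have fgx : f x = g x := nbhs_singleton fg.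
have gE : g \o shift x = cst (g x) + 'd f x +o_ 0 id.
  have /diff_locallyP[_ /eqaddoP fE] := df.
  apply/eqaddoP => eps eps0; have := fE _ eps0.
  have : \forall h \near 0, f (h + x) = g (h + x).
    by move: fg; rewrite (near_shift 0)/= subr0.
  by apply: filterS2 => h; rewrite !fctE /= => -> ; rewrite fgx.
have dE := diff_unique (diff_continuous df) gE.
by apply/diff_locallyP; rewrite dE; split => //; exact: diff_continuous.
Qed.

(** * Smooth maps *)

Section Smooth.
Variables (R : realType) (n : nat).
Implicit Types (U : set 'rV[R]_n).

Section Vector.
Variable W : normedModType R.
Implicit Types f g : 'rV[R]_n -> W.

Lemma pder_eq U f g i u : open U -> (forall v, U v -> f v = g v) -> U u ->
  pder i f u = pder i g u.
Proof.
move=> oU fg Uu; apply: near_eq_derive.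
by apply: filterS (open_nbhs_nbhs (conj oU Uu)) => v /fg.
Qed.

Lemma differentiable_eq U f g u : open U -> (forall v, U v -> f v = g v) ->
  U u -> differentiable f u -> differentiable g u.
Proof.
move=> oU fg Uu; apply: near_eq_differentiable.
by apply: filterS (open_nbhs_nbhs (conj oU Uu)) => v /fg.
Qed.

(** An order-by-order form of [smooth_on], made for induction: [Ck k] says that all partial
    derivatives of order at most [k] are differentiable, so [Ck 0] already grants one derivative. *)
Fixpoint Ck k U f : Prop :=
  (forall u, U u -> differentiable f u) /\
  (if k is k'.+1 then forall i, Ck k' U (pder i f) else True).

Lemma smooth_onP U f : smooth_on U f <-> forall k, Ck k U f.
Proof.
split=> [sf k|Cf s].
  elim: k f sf => [|k IH] f sf /=; first by split=> // u; exact: (sf [::]).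
  split=> [u|i]; first exact: (sf [::]).
  by apply: IH => s u Uu; rewrite -foldr_rcons; apply: sf.
have {Cf} : Ck (size s) U f by [].
(* [foldr] differentiates first along the last letter of the word, so words are peeled from the
   right. *)
elim/last_ind: s f => [|s i IH] f /=; first by case.
by rewrite size_rcons foldr_rcons => -[_ /(_ i)]; exact: IH.
Qed.

Lemma Ck_eq k U f g : open U -> (forall v, U v -> f v = g v) -> Ck k U f -> Ck k U g.
Proof.
move=> oU; elim: k f g => [|k IH] f g fg /= [df Cf].
  by split=> // u Uu; apply: differentiable_eq fg _ (df _ Uu).
split=> [u Uu|i]; first by apply: differentiable_eq fg _ (df _ Uu).
by apply: IH (Cf i) => v Uv; apply: pder_eq fg _.
Qed.

Lemma Ck_diff k U f : Ck k U f -> forall u, U u -> differentiable f u.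
Proof. by case: k => [|k] []. Qed.

Lemma CkW k U f : Ck k.+1 U f -> Ck k U f.
Proof.
elim: k f => [|k IH] f /= [df Cf]; first by split.
by split=> // i; apply: IH; exact: Cf.
Qed.

Lemma Ck_cst k U (c : W) : Ck k U (cst c).
Proof.
elim: k c => [|k IH] c /=; split => // i.
rewrite (_ : pder i (cst c) = cst 0) //; apply/funext => u.
by rewrite /pder derive_cst.
Qed.

Lemma Ck_add k U f g : open U -> Ck k U f -> Ck k U g -> Ck k U (f + g).
Proof.
move=> oU; elim: k f g => [|k IH] f g /= [df Cf] [dg Cg].
  by split; first by move=> u Uu; apply: differentiableD; [exact: df|exact: dg].
split; first by move=> u Uu; apply: differentiableD; [exact: df|exact: dg].
move=> i; apply: (@Ck_eq _ _ (pder i f + pder i g)) => //; last exact: IH.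
move=> u Uu; rewrite /pder deriveD//; apply: diff_derivable; [exact: df|exact: dg].
Qed.

Lemma smooth_eq U f g : open U -> (forall v, U v -> f v = g v) ->
  smooth_on U f -> smooth_on U g.
Proof. by move=> oU fg /smooth_onP sf; apply/smooth_onP => k; apply: Ck_eq fg _. Qed.

Lemma smooth_pder U f i : smooth_on U f -> smooth_on U (pder i f).
Proof. by move=> sf s u Uu; rewrite -foldr_rcons; apply: sf. Qed.

Lemma smooth_diff U f u : smooth_on U f -> U u -> differentiable f u.
Proof. by move=> sf; exact: (sf [::]). Qed.

Lemma smooth_subset U V f : V `<=` U -> smooth_on U f -> smooth_on V f.
Proof. by move=> VU sf s u /VU; exact: sf. Qed.

Lemma smooth_cst U (c : W) : smooth_on U (fun=> c).
Proof. by apply/smooth_onP => k; exact: Ck_cst. Qed.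

Lemma smooth_add U f g : open U -> smooth_on U f -> smooth_on U g ->
  smooth_on U (fun u => f u + g u).
Proof.
by move=> oU /smooth_onP sf /smooth_onP sg; apply/smooth_onP => k; exact: Ck_add.
Qed.

End Vector.

Implicit Types f g : 'rV[R]_n -> R^o.

(** The product rule keeps one factor undifferentiated; [CkW] lowers its order so that the induction
    hypothesis applies. *)
Lemma Ck_mul k U f g : open U -> Ck k U f -> Ck k U g ->
  Ck k U (fun u => f u * g u : R^o).
Proof.
move=> oU; elim: k f g => [|k IH] f g Cf Cg; move: (Cf) (Cg) => /= [df Cf'] [dg Cg'].
  by split=> // u Uu; apply: (@differentiableM _ _ f g); [exact: df|exact: dg].
split; first by move=> u Uu; apply: (@differentiableM _ _ f g); [exact: df|exact: dg].
move=> i; apply: (@Ck_eq _ _ _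
  ((fun u => f u * pder i g u : R^o) + (fun u => g u * pder i f u : R^o))) => //.
  move=> u Uu; rewrite /pder.
  by rewrite (@deriveM _ _ f g)//; apply: diff_derivable; [exact: df|exact: dg].
apply: Ck_add => //; apply: IH => //; by [exact: CkW|exact: Cf'|exact: Cg'].
Qed.

Lemma pderV f i u : differentiable f u -> f u != 0 ->
  pder i (fun v => (f v)^-1 : R^o) u = - ((f u)^-1 * (f u)^-1 * pder i f u).
Proof.
move=> df f0; rewrite /pder (@deriveV _ _ f)//; last exact: diff_derivable.
by rewrite -mulNr -expr2 exprVn.
Qed.

(** The derivative of [1 / f] is a product of copies of [1 / f] and a derivative of [f], so the
    induction hypothesis one order below suffices. The square root is treated in the same way. *)
Lemma Ck_inv k U f : open U -> (forall u, U u -> f u != 0) -> Ck k U f ->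
  Ck k U (fun u => (f u)^-1 : R^o).
Proof.
move=> oU f0; elim: k => [|k IH] Cf; move: (Cf) => /= [df Cf'].
  by split=> // u Uu; apply: (@differentiableV _ _ f); [exact: df|exact: f0].
split; first by move=> u Uu; apply: (@differentiableV _ _ f); [exact: df|exact: f0].
move=> i; apply: (@Ck_eq _ _ _ (fun u => (cst (-1) : _ -> R^o) u *
     ((f u)^-1 * (f u)^-1 * pder i f u) : R^o)) => //.
  by move=> u Uu; rewrite (pderV i (df _ Uu) (f0 _ Uu)) /cst mulN1r.
have Ci := IH (CkW Cf).
apply: (@Ck_mul _ _ (cst (-1)) (fun u => (f u)^-1 * (f u)^-1 * pder i f u)) => //.
  exact: Ck_cst.
by apply: (@Ck_mul _ _ (fun u => (f u)^-1 * (f u)^-1)); [|exact: Ck_mul|exact: Cf'].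
Qed.

Lemma differentiable_sqrt (V : normedModType R) (f : V -> R^o) u :
  differentiable f u -> 0 < f u ->
  differentiable (fun v => Num.sqrt (f v) : R^o) u.
Proof.
move=> df f0; apply: (@differentiable_comp _ _ _ _ f (@Num.sqrt R : R^o -> R^o)) => //.
by apply/derivable1_diffP; by case: (is_derive1_sqrt f0).
Qed.

Lemma pder_sqrt f i u : differentiable f u -> 0 < f u ->
  pder i (fun v => Num.sqrt (f v) : R^o) u = 2^-1 * (Num.sqrt (f u))^-1 * pder i f u.
Proof.
move=> df f0; have ds : differentiable (@Num.sqrt R : R^o -> R^o) (f u).
  by apply/derivable1_diffP; by case: (is_derive1_sqrt f0).
rewrite /pder deriveE; last exact: differentiable_sqrt.
rewrite (@diff_comp _ _ _ _ f (@Num.sqrt R : R^o -> R^o)) //= deriveE //.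
(* The argument of the differential is written as a multiple of [1], at which the differential is
   the one-variable derivative. *)
rewrite -[X in 'd _ _ X = _]mulr1 -[X in 'd _ _ X = _]/( _ *: (1 : R^o)) linearZ /=.
by rewrite -(deriveE _ ds) derive_sqrt// invfM [LHS]mulrC.
Qed.

Lemma Ck_sqrt k U f : open U -> (forall u, U u -> 0 < f u) -> Ck k U f ->
  Ck k U (fun u => Num.sqrt (f u) : R^o).
Proof.
move=> oU f0; elim: k => [|k IH] Cf; move: (Cf) => /= [df Cf'].
  by split=> // u Uu; apply: differentiable_sqrt; [exact: df|exact: f0].
split; first by move=> u Uu; apply: differentiable_sqrt; [exact: df|exact: f0].
move=> i; apply: (@Ck_eq _ _ _ (fun u => (cst (2^-1) : _ -> R^o) u *
     (Num.sqrt (f u))^-1 * pder i f u : R^o)) => //.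
  by move=> u Uu; rewrite (pder_sqrt i (df _ Uu) (f0 _ Uu)).
apply: (@Ck_mul _ _ (fun u => (cst (2^-1) : _ -> R^o) u * (Num.sqrt (f u))^-1)) => //.
apply: Ck_mul => //; first exact: Ck_cst.
apply: (@Ck_inv _ _ (fun u => Num.sqrt (f u))) => //; last exact: IH (CkW Cf).
by move=> u Uu; rewrite gt_eqF// sqrtr_gt0 f0.
Qed.

Lemma smooth_mul U f g : open U -> smooth_on U f -> smooth_on U g ->
  smooth_on U (fun u => f u * g u : R^o).
Proof.
by move=> oU /smooth_onP sf /smooth_onP sg; apply/smooth_onP => k; exact: Ck_mul.
Qed.

Lemma smooth_opp U f : open U -> smooth_on U f -> smooth_on U (fun u => - f u : R^o).
Proof.
move=> oU sf; apply: (@smooth_eq _ _ (fun u => -1 * f u : R^o)) => //.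
  by move=> u _; rewrite mulN1r.
by apply: (@smooth_mul _ (fun=> -1)) => //; exact: smooth_cst.
Qed.

Lemma smooth_sub U f g : open U -> smooth_on U f -> smooth_on U g ->
  smooth_on U (fun u => f u - g u : R^o).
Proof. by move=> oU sf sg; apply: smooth_add => //; exact: smooth_opp. Qed.

Lemma smooth_inv U f : open U -> (forall u, U u -> f u != 0) -> smooth_on U f ->
  smooth_on U (fun u => (f u)^-1 : R^o).
Proof. by move=> oU f0 /smooth_onP sf; apply/smooth_onP => k; exact: Ck_inv. Qed.

Lemma smooth_sqrt U f : open U -> (forall u, U u -> 0 < f u) -> smooth_on U f ->
  smooth_on U (fun u => Num.sqrt (f u) : R^o).
Proof. by move=> oU f0 /smooth_onP sf; apply/smooth_onP => k; exact: Ck_sqrt. Qed.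

Lemma smooth_sum U (I : Type) (r : seq I) (P : pred I) (F : I -> 'rV[R]_n -> R^o) :
  open U -> (forall i, P i -> smooth_on U (F i)) ->
  smooth_on U (fun u => \sum_(i <- r | P i) F i u : R^o).
Proof.
move=> oU sF; elim: r => [|i r IH].
  by apply: (smooth_eq oU _ (@smooth_cst R^o U 0)) => // u _; rewrite big_nil.
have [Pi|Pi] := boolP (P i); last first.
  by apply: (smooth_eq oU _ IH) => // u _; rewrite big_cons (negPf Pi).
apply: (@smooth_eq _ _ (fun u => F i u + \sum_(i <- r | P i) F i u : R^o)) => //.
  by move=> u _; rewrite big_cons Pi.
by apply: smooth_add => //; exact: sF.
Qed.

Lemma smooth_prod U (I : Type) (r : seq I) (F : I -> 'rV[R]_n -> R^o) :
  open U -> (forall i, smooth_on U (F i)) ->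
  smooth_on U (fun u => \prod_(i <- r) F i u : R^o).
Proof.
move=> oU sF; elim: r => [|i r IH].
  by apply: (smooth_eq oU _ (@smooth_cst R^o U 1)) => // u _; rewrite big_nil.
apply: (@smooth_eq _ _ (fun u => F i u * \prod_(i <- r) F i u : R^o)) => //.
  by move=> u _; rewrite big_cons.
by apply: smooth_mul => //; exact: sF.
Qed.

Lemma pder_coord (i j : 'I_n) u : pder i (fun v => v 0 j : R^o) u = (i == j)%:R.
Proof.
have /matrixP/(_ 0 j) := @derive_mx R ('rV[R]_n) 1 n id u (delta_mx 0 i)
  (@derivable_id _ _ u (delta_mx 0 i)).
rewrite derive_id.
by rewrite !mxE eqxx /= /pder eq_sym => ->.
Qed.

Lemma smooth_coord U (j : 'I_n) : smooth_on U (fun u => u 0 j : R^o).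
Proof.
apply/smooth_onP => -[|k] /=; split => //.
- by move=> u _; exact: differentiable_coord.
- by move=> u _; exact: differentiable_coord.
move=> i; rewrite (_ : pder _ _ = fun=> ((i == j)%:R : R^o)); first exact: Ck_cst.
by apply/funext => u; rewrite pder_coord.
Qed.

End Smooth.

Section Coordinates.
Variables (R : realType) (V : normedModType R) (p q : nat).
Implicit Type f : V -> 'M[R]_(p, q).

Lemma derive_entry f u v i j : differentiable f u ->
  ('D_v f u) i j = 'D_v (fun x => f x i j : R^o) u.
Proof. by move=> df; rewrite derive_mx ?mxE//; exact: diff_derivable. Qed.

Lemma differentiable_entry f u i j : differentiable f u ->
  differentiable (fun x => f x i j : R^o) u.
Proof.
move=> df; apply: (@differentiable_comp _ _ _ _ f (fun M : 'M[R]_(p, q) => M i j : R^o)) => //.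
exact: differentiable_coord.
Qed.

Lemma differentiable_mx f u :
  (forall i j, differentiable (fun x => f x i j : R^o) u) -> differentiable f u.
Proof.
move=> df; rewrite (_ : f =
    \sum_(k < p) \sum_(l < q) (fun x => f x k l *: (delta_mx k l : 'M[R]_(p, q)))).
  apply: differentiable_sum => k; apply: differentiable_sum => l.
  exact: (@differentiableZl _ _ _ (fun x => f x k l)).
apply/funext => x; rewrite fct_sumE [LHS]matrix_sum_delta.
by apply: eq_bigr => k _; rewrite fct_sumE.
Qed.

End Coordinates.

Section SmoothVector.
Variables (R : realType) (n p q : nat).
Implicit Types (U : set 'rV[R]_n) (f : 'rV[R]_n -> 'M[R]_(p, q)).

Lemma smooth_mxP U f : open U ->
  smooth_on U f <-> forall i j, smooth_on U (fun u => f u i j : R^o).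
Proof.
move=> oU; split=> [/smooth_onP Cf i j|Cf].
  apply/smooth_onP => k; move: (Cf k) => {Cf}; elim: k f => [|k IH] f /=.
    by move=> [df _]; split => // u Uu; apply: differentiable_entry; exact: df.
  move=> [df Cf]; split=> [u Uu|l]; first by apply: differentiable_entry; exact: df.
  apply: (Ck_eq oU _ (IH _ (Cf l))) => u Uu.
  by rewrite /pder derive_entry//; exact: df.
have {}Cf k i j : Ck k U (fun u => f u i j : R^o) by move: (Cf i j) => /smooth_onP.
apply/smooth_onP => k; elim: k f Cf => [|k IH] f Cf /=.
  by split=> // u Uu; apply: differentiable_mx => i j; exact: Ck_diff (Cf 0%N i j) _ Uu.
have df u : U u -> differentiable f u.
  by move=> Uu; apply: differentiable_mx => i j; exact: Ck_diff (Cf 0%N i j) _ Uu.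
split=> // l; apply: IH => k' i j; have [_ /(_ l)] := Cf k'.+1 i j.
by apply: Ck_eq => // u Uu; rewrite /pder derive_entry//; exact: df.
Qed.

End SmoothVector.

Lemma derive_sum_pder (R : realType) (W : normedModType R) N (g : 'rV[R]_N -> W) z v :
  differentiable g z -> 'D_v g z = \sum_c v 0 c *: pder c g z.
Proof.
move=> dg; rewrite deriveE// {1}(row_sum_delta v) linear_sum /=.
by apply: eq_bigr => c _; rewrite linearZ/= /pder deriveE.
Qed.

Lemma pder_comp (R : realType) (W : normedModType R) n N (f : 'rV[R]_n -> 'rV[R]_N)
    (g : 'rV[R]_N -> W) i u :
  differentiable f u -> differentiable g (f u) ->
  pder i (fun v => g (f v)) u = \sum_c pder i f u 0 c *: pder c g (f u).
Proof.
move=> df dg; rewrite -derive_sum_pder// /pder.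
rewrite deriveE; last exact: differentiable_comp.
by rewrite (diff_comp df dg) /= deriveE// [in RHS]deriveE.
Qed.

(** * Symmetry of second derivatives *)

Section Schwarz.
Variables (R : realType) (V : normedModType R).
Implicit Types (f : V -> R^o).

Lemma is_derive_line f (v w : V) (t : R) : differentiable f (t *: w + v) ->
  is_derive (t : R^o) 1 (fun s : R^o => f (s *: w + v)) ('D_w f (t *: w + v)).
Proof.
move=> df; have E : (fun h : R^o =>
      h^-1 *: (((fun s : R^o => f (s *: w + v)) \o shift t) (h *: 1) - f (t *: w + v))) =
    (fun h => h^-1 *: ((f \o shift (t *: w + v)) (h *: w) - f (t *: w + v))).
  by apply/funext => h /=; rewrite [h%:A]mulr1 scalerDl addrA.
by apply: DeriveDef; rewrite /derivable /derive E//; exact: diff_derivable.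
Qed.

Lemma derive_mvt f (v w : V) (h : R) : 0 < h ->
  (forall t, 0 <= t <= h -> differentiable f (t *: w + v)) ->
  exists2 t, 0 < t < h & f (h *: w + v) - f v = 'D_w f (t *: w + v) * h.
Proof.
move=> h0 df.
have [||t th] := @MVT R (fun s => f (s *: w + v)) (fun s => 'D_w f (s *: w + v)) 0 h h0.
- move=> t; rewrite in_itv /= => /andP[t0 th].
  by apply: is_derive_line; apply: df; rewrite !ltW.
- apply: derivable_within_continuous => t; rewrite in_itv /= => th.
  have [//] := is_derive_line (df t th).
rewrite scale0r add0r subr0 => ->; exists t => //.
Qed.

Lemma derive_shiftr f (a v w : V) : 'D_w (fun x => f (x + a)) v = 'D_w f (v + a).
Proof.
have E : (fun h : R => h^-1 *: (((fun x => f (x + a)) \o shift v) (h *: w) - f (v + a))) =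
    (fun h => h^-1 *: ((f \o shift (v + a)) (h *: w) - f (v + a))).
  by apply/funext => h /=; rewrite addrA.
by rewrite /derive E.
Qed.

Lemma differentiable_shiftr f (a v : V) : differentiable f (v + a) ->
  differentiable (fun x => f (x + a) : R^o) v.
Proof.
move=> df; apply: (@differentiable_comp _ _ _ _ (fun x => x + a) f) => //.
Qed.

(** Two mean value theorems: one along [w1] for [x |-> f (x + h w2) - f x], then one along [w2] for
    ['D_w1 f]. *)
Lemma second_difference f (u w1 w2 : V) (h : R) : 0 < h ->
  (forall s t, 0 <= s <= h -> 0 <= t <= h ->
     differentiable f (t *: w2 + (s *: w1 + u)) /\
     differentiable ('D_w1 f : V -> R^o) (t *: w2 + (s *: w1 + u))) ->
  exists s t, [/\ 0 < s < h, 0 < t < h &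
    f (h *: w2 + (h *: w1 + u)) - f (h *: w1 + u) - f (h *: w2 + u) + f u =
    'D_w2 ('D_w1 f) (t *: w2 + (s *: w1 + u)) * h ^+ 2].
Proof.
move=> h0 df; have hh : 0 <= h <= h by rewrite ltW/=.
have oo : (0 : R) <= 0 <= h by rewrite lexx ltW.
pose g x : R^o := f (x + h *: w2) - f x.
have dfh s : 0 <= s <= h -> differentiable f (s *: w1 + u + h *: w2).
  by move=> sh; rewrite addrC; case: (df s h sh hh).
have df0 s : 0 <= s <= h -> differentiable f (s *: w1 + u).
  by move=> sh; have [] := df s 0 sh oo; rewrite scale0r add0r.
have dg s : 0 <= s <= h -> differentiable g (s *: w1 + u).
  move=> sh; apply: (@differentiableB _ _ _ (fun x => f (x + h *: w2)) f).
    by apply: differentiable_shiftr; exact: dfh.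
  exact: df0.
have [s sh gE] := derive_mvt h0 dg.
have sh' : 0 <= s <= h by case/andP: sh => *; rewrite !ltW.
have [t th fE] := derive_mvt (f := 'D_w1 f) h0 (fun t th => (df s t sh' th).2).
exists s, t; split => //.
rewrite expr2 mulrA -fE.
have -> : 'D_w1 f (h *: w2 + (s *: w1 + u)) - 'D_w1 f (s *: w1 + u) =
    'D_w1 g (s *: w1 + u).
  rewrite /g (@deriveB _ _ _ (fun x => f (x + h *: w2)) f).
  - by rewrite derive_shiftr [h *: w2 + _]addrC.
  - by apply: diff_derivable; apply: differentiable_shiftr; exact: dfh.
  - by apply: diff_derivable; exact: df0.
rewrite -gE /g; rewrite [h *: w2 + (h *: w1 + u)]addrC [h *: w2 + u]addrC.
by rewrite opprB addrA addrAC -!addrA; congr (_ + (_ + _)); rewrite addrC.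
Qed.

Lemma half_close (a a' b b' e : R) : a' = b' -> `|a - a'| < e / 2 ->
  `|b - b'| < e / 2 -> a <= b + e /\ b <= a + e.
Proof.
move=> <-; rewrite !ltr_norml => /andP[? ?] /andP[? ?]; split; lra.
Qed.

(** The second difference over a small parallelogram is unchanged when [w1] and [w2] are exchanged.
    It is [h^2] times a value of either mixed derivative near [u], so by continuity the two
    derivatives at [u] are within any [e] of each other. *)
Lemma derive_schwarz f (U : set V) (u w1 w2 : V) : open U -> U u ->
  (forall v, U v -> differentiable f v) ->
  (forall v, U v -> differentiable ('D_w1 f : V -> R^o) v) ->
  (forall v, U v -> differentiable ('D_w2 f : V -> R^o) v) ->
  {for u, continuous ('D_w2 ('D_w1 f) : V -> R^o)} ->
  {for u, continuous ('D_w1 ('D_w2 f) : V -> R^o)} ->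
  'D_w1 ('D_w2 f) u = 'D_w2 ('D_w1 f) u.
Proof.
move=> oU Uu df df1 df2 c1 c2.
suff AB e : 0 < e -> 'D_w2 ('D_w1 f) u <= 'D_w1 ('D_w2 f) u + e /\
    'D_w1 ('D_w2 f) u <= 'D_w2 ('D_w1 f) u + e.
  by apply: le_anti; apply/andP; split; apply/ler_addgt0Pr => e /AB[le1 le2];
     [exact: le2|exact: le1].
move=> e0; have e20 : 0 < e / 2 by rewrite divr_gt0.
move: c1 => /cvgrPdist_lt/(_ _ e20)/nbhs_ballP[r1 /= r10 c1].
move: c2 => /cvgrPdist_lt/(_ _ e20)/nbhs_ballP[r2 /= r20 c2].
have /nbhs_ballP[r3 /= r30 c3] : nbhs u U by exact: open_nbhs_nbhs.
pose r := Num.min r1 (Num.min r2 r3).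
have r0 : 0 < r by rewrite !lt_min r10 r20 r30.
(* The parallelogram with sides [h w1] and [h w2] fits in the ball of radius [r]; the [+ 1] keeps
   the denominator positive when both vectors vanish. *)
pose h := r / (`|w1| + `|w2| + 1) / 2.
have d0 : 0 < `|w1| + `|w2| + 1 by rewrite ltr_wpDl// addr_ge0.
have h0 : 0 < h by rewrite !divr_gt0.
have hr : h * (`|w1| + `|w2|) < r.
  apply: (@lt_le_trans _ _ (h * (`|w1| + `|w2| + 1))); first by rewrite ltr_pM2l// ltrDl.
  by rewrite /h mulrAC divfK ?gt_eqF// ler_pdivrMr//; lra.
have inb s t : 0 <= s <= h -> 0 <= t <= h -> ball u r (t *: w2 + (s *: w1 + u)).
  move=> /andP[s0 sh] /andP[t0 th]; rewrite -ball_normE /ball_/= distrC addrA addrK.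
  rewrite (le_lt_trans (ler_normD _ _))// !normrZ !ger0_norm//.
  by apply: le_lt_trans hr; rewrite mulrDr addrC lerD// ler_wpM2r.
have inb' s t : 0 <= s <= h -> 0 <= t <= h -> ball u r (s *: w1 + (t *: w2 + u)).
  by rewrite addrCA; exact: inb.
have inb1 x : ball u r x -> ball u r1 x by apply: le_ball; rewrite ge_min lexx.
have inb2 x : ball u r x -> ball u r2 x by apply: le_ball; rewrite !ge_min lexx orbT.
have inb3 x : ball u r x -> U x.
  by move=> xr; apply: c3; apply: le_ball xr; rewrite !ge_min lexx !orbT.
have [|s [t [/andP[s0 sh] /andP[t0 th] E1]]] := @second_difference f u w1 w2 h h0.
  by move=> s t sh th; split; [apply: df|apply: df1]; apply: inb3; exact: inb.
have [|s' [t' [/andP[s'0 s'h] /andP[t'0 t'h] E2]]] := @second_difference f u w2 w1 h h0.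
  by move=> ? ? ? ?; split; [apply: df|apply: df2]; apply: inb3; exact: inb'.
have E : 'D_w2 ('D_w1 f) (t *: w2 + (s *: w1 + u)) =
    'D_w1 ('D_w2 f) (t' *: w1 + (s' *: w2 + u)).
  apply: (mulIf (x := h ^+ 2)); first by rewrite expf_neq0// gt_eqF.
  apply: (etrans (esym E1) (etrans _ E2)).
  by rewrite [_ + (h *: w1 + u)]addrCA [f _ - f (h *: w1 + u) - _]addrAC.
have /c1 H1 : ball u r1 (t *: w2 + (s *: w1 + u)) by apply/inb1/inb; rewrite !ltW.
have /c2 H2 : ball u r2 (t' *: w1 + (s' *: w2 + u)) by apply/inb2/inb'; rewrite !ltW.
exact: half_close E H1 H2.
Qed.

End Schwarz.

Lemma pder_comm_real (R : realType) n (U : set 'rV[R]_n) (f : 'rV[R]_n -> R^o) i j u :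
  open U -> smooth_on U f -> U u -> pder i (pder j f) u = pder j (pder i f) u.
Proof.
move=> oU sf Uu.
have sp s v : U v -> differentiable (pder s f) v := smooth_diff (smooth_pder s sf) (u := v).
have spp s t := smooth_diff (smooth_pder s (smooth_pder t sf)) Uu.
apply: (derive_schwarz (w1 := delta_mx 0 i) (w2 := delta_mx 0 j) oU Uu (f := f)).
- by move=> v; exact: smooth_diff sf.
- exact: (sp i).
- exact: (sp j).
- exact: differentiable_continuous (spp _ _).
- exact: differentiable_continuous (spp _ _).
Qed.

Lemma pder_comm (R : realType) n p q (U : set 'rV[R]_n) (f : 'rV[R]_n -> 'M[R]_(p, q)) i j u :
  open U -> smooth_on U f -> U u -> pder i (pder j f) u = pder j (pder i f) u.
Proof.
move=> oU sf Uu; apply/matrixP => k l.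
have sfi i' : smooth_on U (pder i' f) by exact: smooth_pder.
have skl : smooth_on U (fun v => f v k l : R^o) by move: sf => /(smooth_mxP _ oU).
have step i' j' : pder i' (pder j' f) u k l = pder i' (pder j' (fun v => f v k l : R^o)) u.
  transitivity (pder i' (fun v => pder j' f v k l : R^o) u).
    by apply: derive_entry; exact: smooth_diff (sfi _) Uu.
  apply: (pder_eq i' oU _ Uu) => v Uv.
  by rewrite /pder derive_entry//; exact: smooth_diff sf Uv.
exact: (etrans (step i j) (etrans (pder_comm_real i j oU skl Uu) (esym (step j i)))).
Qed.

(** * Matrix-valued functions *)

Section MatrixCalculus.
Variables (R : realType) (V : normedModType R).

Lemma differentiable_mulmx p q r (A : V -> 'M[R]_(p, q)) (B : V -> 'M[R]_(q, r)) u :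
  differentiable A u -> differentiable B u ->
  differentiable (fun x => A x *m B x) u.
Proof.
move=> dA dB; apply: differentiable_mx => i j.
rewrite (_ : (fun x => _) =
    \sum_k ((fun x => A x i k : R^o) * (fun x => B x k j : R^o) : V -> R^o)).
  by apply: differentiable_sum => k; apply: differentiableM; exact: differentiable_entry.
by apply/funext => x; rewrite fct_sumE mxE.
Qed.

Lemma derive_mulmx p q r (A : V -> 'M[R]_(p, q)) (B : V -> 'M[R]_(q, r)) u v :
  differentiable A u -> differentiable B u ->
  'D_v (fun x => A x *m B x) u = 'D_v A u *m B u + A u *m 'D_v B u.
Proof.
move=> dA dB; apply/matrixP => i j.
rewrite derive_entry; last exact: differentiable_mulmx.
have dAk k := diff_derivable (v := v) (differentiable_entry i k dA).
have dBk k := diff_derivable (v := v) (differentiable_entry k j dB).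
rewrite (_ : (fun x => _) =
    \sum_k ((fun x => A x i k : R^o) * (fun x => B x k j : R^o) : V -> R^o)).
  rewrite derive_sum => [|k]; last exact: derivableM.
  rewrite !mxE -big_split /=; apply: eq_bigr => k _.
  by rewrite deriveM// !derive_entry// [LHS]addrC; congr (_ + _); rewrite [LHS]mulrC.
by apply/funext => x; rewrite fct_sumE mxE.
Qed.

Lemma differentiable_trmx p q (A : V -> 'M[R]_(p, q)) u :
  differentiable A u -> differentiable (fun x => (A x)^T) u.
Proof.
move=> dA; apply: differentiable_mx => i j.
by under eq_fun do rewrite mxE; exact: differentiable_entry.
Qed.

Lemma derive_trmx p q (A : V -> 'M[R]_(p, q)) u v :
  differentiable A u -> 'D_v (fun x => (A x)^T) u = ('D_v A u)^T.
Proof.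
move=> dA; apply/matrixP => i j.
rewrite derive_entry; last exact: differentiable_trmx.
by under eq_fun do rewrite mxE; rewrite mxE derive_entry.
Qed.

End MatrixCalculus.

Section MatrixSmooth.
Variables (R : realType) (n : nat) (U : set 'rV[R]_n).
Hypothesis oU : open U.

Lemma smooth_mulmx p q r (A : 'rV[R]_n -> 'M[R]_(p, q)) (B : 'rV[R]_n -> 'M[R]_(q, r)) :
  smooth_on U A -> smooth_on U B -> smooth_on U (fun x => A x *m B x).
Proof.
move=> /(smooth_mxP _ oU) sA /(smooth_mxP _ oU) sB; apply/smooth_mxP => // i j.
under eq_fun do rewrite mxE.
by apply: smooth_sum => // k _; exact: smooth_mul.
Qed.

Lemma smooth_trmx p q (A : 'rV[R]_n -> 'M[R]_(p, q)) :
  smooth_on U A -> smooth_on U (fun x => (A x)^T).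
Proof.
move=> /(smooth_mxP _ oU) sA; apply/smooth_mxP => // i j.
under eq_fun do rewrite mxE.
exact: sA.
Qed.

Lemma smooth_det p (A : 'rV[R]_n -> 'M[R]_p) :
  smooth_on U A -> smooth_on U (fun x => \det (A x) : R^o).
Proof.
move=> /(smooth_mxP _ oU) sA; apply: smooth_sum => // s _.
apply: smooth_mul => //; first exact: smooth_cst.
exact: smooth_prod.
Qed.

Lemma smooth_invmx p (A : 'rV[R]_n -> 'M[R]_p) :
  (forall u, U u -> A u \in unitmx) ->
  smooth_on U A -> smooth_on U (fun x => invmx (A x)).
Proof.
move=> uA sA; have /(smooth_mxP _ oU) sAe := sA; apply/smooth_mxP => // i j.
apply: (smooth_eq (f := fun x => (\det (A x))^-1 * cofactor (A x) j i : R^o)) => //.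
  by move=> u Uu; rewrite /invmx uA// !mxE.
apply: smooth_mul => //.
  by apply: smooth_inv => //; [move=> u /uA; rewrite unitmxE unitfE|exact: smooth_det].
apply: smooth_mul => //; first exact: smooth_cst.
apply: smooth_det; apply/smooth_mxP => // k l.
under eq_fun do rewrite !mxE.
exact: sAe.
Qed.

Lemma smooth_inner N (S : 'rV[R]_n -> 'M[R]_N) (X Y : 'rV[R]_n -> 'rV[R]_N) :
  smooth_on U S -> smooth_on U X -> smooth_on U Y ->
  smooth_on U (fun x => inner (S x) (X x) (Y x) : R^o).
Proof.
move=> sS sX sY; have : smooth_on U (fun x => X x *m S x *m (Y x)^T).
  by apply: smooth_mulmx; [exact: smooth_mulmx|exact: smooth_trmx].
by move=> /(smooth_mxP _ oU); exact.
Qed.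

(** Chain rule and induction on the order: a derivative of the composite is a sum of derivatives of
    [f], smooth to all orders, times [pder c h] composed with [f], where the order of [h] has
    dropped by one. *)
Lemma smooth_comp N p q (D : set 'rV[R]_N) (f : 'rV[R]_n -> 'rV[R]_N)
    (g : 'rV[R]_N -> 'M[R]_(p, q)) :
  open D -> (forall u, U u -> D (f u)) -> smooth_on U f -> smooth_on D g ->
  smooth_on U (fun u => g (f u)).
Proof.
move=> oD fD sf /(smooth_mxP _ oD) sg; apply/smooth_mxP => // a b.
suff scomp (h : 'rV[R]_N -> R^o) : smooth_on D h -> smooth_on U (fun u => h (f u) : R^o).
  exact: (scomp (fun z => g z a b)).
move=> /smooth_onP Ch0; have comp_diff h' : Ck 0 D h' -> forall u, U u -> differentiable (fun u => h' (f u) : R^o) u.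
  move=> [dh _] u Uu; apply: (@differentiable_comp _ _ _ _ f h').
    exact: smooth_diff sf Uu.
  exact: dh (fD _ Uu).
apply/smooth_onP => k; move: (Ch0 k) => {Ch0}; elim: k h => [|k IH] h; first by move=> /comp_diff.
move=> Ch; split; first by apply: comp_diff; split=> //; exact: Ck_diff Ch.
move=> i; apply: (@Ck_eq _ _ _ _ _
  (fun u => \sum_c pder i f u 0 c * pder c h (f u) : R^o)) => //.
  move=> u Uu; apply/esym.
  exact: (pder_comp (g := h) i (smooth_diff sf Uu) (Ck_diff Ch (fD _ Uu))).
have := smooth_pder i sf => /(smooth_mxP _ oU) sfi.
suff : forall s : seq 'I_N, Ck k U (fun u => \sum_(c <- s) pder i f u 0 c * pder c h (f u) : R^o).
  exact.
elim=> [|c s IHs].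
  by apply: (Ck_eq oU _ (@Ck_cst R n R^o k U 0)) => u _; rewrite big_nil.
apply: (Ck_eq oU _ (Ck_add oU (Ck_mul oU (f := fun u => pder i f u 0 c)
  (g := fun u => pder c h (f u)) _ _) IHs)) => [u _||]; first by rewrite big_cons.
- by have /smooth_onP := sfi 0 c.
- by apply: IH; case: Ch => _; exact.
Qed.

End MatrixSmooth.

Section Inner.
Variables (R : realType) (n : nat) (S : 'M[R]_n).
Implicit Types X Y : 'rV[R]_n.

Lemma innerC X Y : S^T = S -> inner S X Y = inner S Y X.
Proof.
by move=> sS; rewrite /inner -[RHS]trace_mx11 -mxtrace_tr !trmx_mul trmxK sS mulmxA trace_mx11.
Qed.

Lemma innerZl a X Y : inner S (a *: X) Y = a * inner S X Y.
Proof. by rewrite /inner -!scalemxAl mxE. Qed.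

Lemma innerZr a X Y : inner S X (a *: Y) = a * inner S X Y.
Proof. by rewrite /inner linearZ/= -scalemxAr mxE. Qed.

Lemma innerDl X Y Z : inner S (X + Y) Z = inner S X Z + inner S Y Z.
Proof. by rewrite /inner !mulmxDl mxE. Qed.

Lemma inner_mulmx p q (A : 'M[R]_(p, n)) (B : 'M[R]_(q, n)) i j :
  (A *m S *m B^T) i j = inner S (row i A) (row j B).
Proof.
rewrite /inner tr_row -row_mul [LHS]mxE [RHS]mxE.
by apply: eq_bigr => k _; rewrite !mxE.
Qed.

End Inner.

Section ScaleCalculus.
Variables (R : realType) (V : normedModType R).

Lemma derive_scalemx p q (a : V -> R^o) (A : V -> 'M[R]_(p, q)) u v :
  differentiable a u -> differentiable A u ->
  'D_v (fun x => a x *: A x) u = 'D_v a u *: A u + a u *: 'D_v A u.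
Proof.
move=> da dA.
have aM x : a x *: A x = (a x)%:M *m A x by rewrite mul_scalar_mx.
have das : differentiable (fun x => (a x)%:M : 'M[R]_p) u.
  apply: differentiable_mx => i j; under eq_fun do rewrite mxE.
  have [_|ij] := eqVneq i j; first exact: da.
  exact: (differentiable_cst (0 : R^o)).
have -> : (fun x => a x *: A x) = (fun x => (a x)%:M *m A x) by apply/funext.
rewrite derive_mulmx// mul_scalar_mx; congr (_ + _).
rewrite -mul_scalar_mx; congr (_ *m _); apply/matrixP => i j.
rewrite derive_entry// mxE; under eq_fun do rewrite mxE.
by have [_|ij] := eqVneq i j; rewrite ?mulr1n// mulr0n (@derive_cst _ _ R^o).
Qed.

Lemma derive_sum_fct p q (I : finType) (A : I -> V -> 'M[R]_(p, q)) u v :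
  (forall i, differentiable (A i) u) ->
  'D_v (fun x => \sum_i A i x) u = \sum_i 'D_v (A i) u.
Proof.
move=> dA; suff [] : derivable (fun x => \sum_i A i x) u v /\
   'D_v (fun x => \sum_i A i x) u = \sum_i 'D_v (A i) u by [].
elim: (index_enum I) => [|i s [dIH IH]].
  have -> : (fun x => \sum_(i <- [::]) A i x) = cst 0 by apply/funext => x; rewrite big_nil.
  by rewrite big_nil derive_cst; split => //; exact: derivable_cst.
have -> : (fun x => \sum_(j <- i :: s) A j x) = A i + (fun x => \sum_(j <- s) A j x).
  by apply/funext => x; rewrite big_cons.
have di := diff_derivable (v := v) (dA i).
split; first exact: (derivableD di dIH).
rewrite big_cons (deriveD di dIH).
by congr (_ + _).
Qed.

End ScaleCalculus.

(** * Connections and the Gauss equation *)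

Section Christoffel.
Variables (R : realType) (n : nat) (g : 'rV[R]_n -> 'M[R]_n).

(* Vectors are rows: nabla_i Y = d_i Y + Y *m chr i. *)
Definition chr i u : 'M[R]_n := \matrix_(j, k) christoffel g k i j u.

Definition riemann_mx i j u : 'M[R]_n := \matrix_(k, l) riemann g l i j k u.

Lemma curvatureE u X Y Z :
  curvature g u X Y Z =
  Z *m (\sum_i \sum_j (X 0 i * Y 0 j) *: riemann_mx i j u).
Proof.
apply/rowP => l; rewrite mulmx_sumr summxE mxE; apply: eq_bigr => i _.
rewrite mulmx_sumr summxE; apply: eq_bigr => j _.
rewrite -scalemxAr !mxE mulr_sumr; apply: eq_bigr => k _.
by rewrite mxE mulrA.
Qed.

Variable U : set 'rV[R]_n.
Hypothesis oU : open U.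
Hypothesis sg : smooth_on U g.
Hypothesis symg : forall u, U u -> (g u)^T = g u.
Hypothesis unitg : forall u, U u -> g u \in unitmx.

Lemma dmetricE i j k u : U u -> dmetric g i j k u = (pder i g u) j k.
Proof. by move=> Uu; rewrite /pder derive_entry//; exact: smooth_diff sg Uu. Qed.

Lemma dmetric_sym i j k u : U u -> dmetric g i j k u = dmetric g i k j u.
Proof.
move=> Uu; apply: (pder_eq i oU _ Uu) => v Uv.
by rewrite -[in RHS](symg Uv) mxE.
Qed.

(** The inverse metric in the Christoffel symbols cancels against [g]. *)
Lemma koszul i j k u : U u -> (chr i u *m g u) j k =
  2^-1 * (dmetric g i j k u + dmetric g j i k u - dmetric g k i j u).
Proof.
move=> Uu; pose b := \row_l (dmetric g i j l u + dmetric g j i l u - dmetric g l i j u).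
have -> : (chr i u *m g u) j k = (row j (chr i u) *m g u) 0 k.
  by rewrite -row_mul [RHS]mxE.
have -> : row j (chr i u) = 2^-1 *: (b *m invmx (g u)).
  apply/rowP => l; rewrite !mxE /christoffel; congr (_ * _).
  apply: eq_bigr => s _; rewrite mxE mulrC; congr (_ * _).
  by rewrite -{1}(symg Uu) -trmx_inv mxE.
by rewrite -scalemxAl mulmxKV ?unitg// !mxE.
Qed.

Lemma chr_sym i j k u : U u -> chr i u j k = chr j u i k.
Proof.
move=> Uu; rewrite !mxE /christoffel; congr (_ * _); apply: eq_bigr => l _.
by rewrite (dmetric_sym l i j Uu) [dmetric g i j l u + _]addrC.
Qed.

(** Compatibility with the metric: two Koszul expressions with [j] and [k] exchanged add up to the
    derivative of [g]. *)
Lemma pder_metric i u : U u -> pder i g u = chr i u *m g u + g u *m (chr i u)^T.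
Proof.
move=> Uu; apply/matrixP => j k; rewrite -dmetricE//.
have -> : g u *m (chr i u)^T = (chr i u *m g u)^T by rewrite trmx_mul symg.
rewrite mxE [X in _ = _ + X]mxE !koszul// (dmetric_sym i k j)//.
by field.
Qed.

Lemma smooth_chr i : smooth_on U (chr i).
Proof.
apply/smooth_mxP => // j k; rewrite (_ : (fun u => _) = christoffel g k i j); last first.
  by apply/funext => u; rewrite mxE.
have sd a b c : smooth_on U (dmetric g a b c).
  by apply: smooth_pder; move: sg => /(smooth_mxP _ oU).
apply: smooth_mul => //; first exact: smooth_cst.
apply: smooth_sum => // l _; apply: smooth_mul => //.
  by have /(smooth_mxP _ oU) := smooth_invmx oU unitg sg; exact.
by apply: smooth_sub => //; exact: smooth_add.
Qed.

(** Connection matrices act on rows from the right, so the left factor of a product is applied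
    first; this reverses the order of the usual commutator. *)
Lemma riemann_mxE i j u : U u ->
  riemann_mx i j u = pder i (chr j) u - pder j (chr i) u
                     + chr j u *m chr i u - chr i u *m chr j u.
Proof.
move=> Uu; apply/matrixP => k l.
have dc a b c d : (pder a (chr b) u) c d = pder a (christoffel g d b c) u.
  rewrite /pder derive_entry; last exact: smooth_diff (smooth_chr b) Uu.
  have E : (fun v => chr b v c d) = christoffel g d b c.
    by apply/funext => v; rewrite mxE.
  exact: (congr1 (fun h : _ -> R^o => 'D_(delta_mx 0 a) h u) E).
rewrite [LHS]mxE /riemann; move: (dc i j k l) (dc j i k l).
move: (pder i (chr j) u) (pder j (chr i) u) => A B <- <-.
rewrite !mxE -[RHS]addrA -sumrB; congr (_ + _).
by apply: eq_bigr => s _; rewrite !mxE.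
Qed.

End Christoffel.

(** The algebra of pulling back a curvature: [C] stands for the ambient connection matrices, [dC]
    for their derivatives, [X] and [Y] for two velocity vectors, [H] and [H'] for the mixed second
    derivatives of the map, which cancel. *)
Lemma conn_bracket (R : realType) N (H H' X Y : 'I_N -> R) (C : 'I_N -> 'M[R]_N)
    (dC : 'I_N -> 'I_N -> 'M[R]_N) : (forall d, H' d = H d) ->
  \sum_d (H d *: C d + Y d *: \sum_c X c *: dC c d)
  - \sum_d (H' d *: C d + X d *: \sum_c Y c *: dC c d)
  + (\sum_d Y d *: C d) *m (\sum_c X c *: C c)
  - (\sum_c X c *: C c) *m (\sum_d Y d *: C d) =
  \sum_c \sum_d (X c * Y d) *:
    (dC c d - dC d c + C d *m C c - C c *m C d).
Proof.
move=> hH; under [\sum_d (H' d *: _ + _)]eq_bigr => d _ do rewrite hH.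
rewrite !big_split /= opprD addrACA subrr add0r.
have -> : \sum_d Y d *: (\sum_c X c *: dC c d) = \sum_c \sum_d (X c * Y d) *: dC c d.
  rewrite exchange_big /=; apply: eq_bigr => d _; rewrite scaler_sumr.
  by apply: eq_bigr => c _; rewrite scalerA mulrC.
have -> : \sum_d X d *: (\sum_c Y c *: dC c d) = \sum_c \sum_d (X c * Y d) *: dC d c.
  apply: eq_bigr => c _; rewrite scaler_sumr.
  by apply: eq_bigr => d _; rewrite scalerA.
have -> : (\sum_d Y d *: C d) *m (\sum_c X c *: C c) =
    \sum_c \sum_d (X c * Y d) *: (C d *m C c).
  rewrite mulmx_sumr; apply: eq_bigr => c _; rewrite mulmx_suml.
  by apply: eq_bigr => d _; rewrite -scalemxAr -scalemxAl scalerA.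
have -> : (\sum_c X c *: C c) *m (\sum_d Y d *: C d) =
    \sum_c \sum_d (X c * Y d) *: (C c *m C d).
  rewrite mulmx_suml; apply: eq_bigr => c _; rewrite mulmx_sumr.
  by apply: eq_bigr => d _; rewrite -scalemxAr -scalemxAl scalerA mulrC.
rewrite -!sumrB -big_split -sumrB /=; apply: eq_bigr => c _.
rewrite -!sumrB -big_split -sumrB /=; apply: eq_bigr => d _.
by rewrite !(scalerDr, scalerN).
Qed.

Section Gauss.
Variables (R : realType) (n N : nat) (G : 'rV[R]_N -> 'M[R]_N).
Variables (D : set 'rV[R]_N) (U : set 'rV[R]_n) (f : 'rV[R]_n -> 'rV[R]_N).

(** Matrix of the pulled-back ambient connection in the direction of the [i]-th coordinate. *)
Definition conn i u : 'M[R]_N := \sum_c pder i f u 0 c *: chr G c (f u).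

(** The rows of [V] are [p] vector fields along [f], differentiated together; [p = 1] gives a single
    field and [p = n] serves for the Jacobian. *)
Definition cov p i (V : 'rV[R]_n -> 'M[R]_(p, N)) u : 'M[R]_(p, N) :=
  pder i V u + V u *m conn i u.

Lemma ambient_covE i V u : ambient_cov G f i V u = cov i V u.
Proof.
rewrite /ambient_cov /cov; congr (_ + _); apply/rowP => k.
rewrite mulmx_sumr summxE [LHS]mxE; apply: eq_bigr => a _.
rewrite -scalemxAr [RHS]mxE [in RHS]mxE mulr_sumr; apply: eq_bigr => b _.
by rewrite [chr _ _ _ _ _]mxE mulrA.
Qed.

Definition ambient_riemann i j u : 'M[R]_N :=
  \sum_c \sum_d (pder i f u 0 c * pder j f u 0 d) *: riemann_mx G c d (f u).

Hypothesis oD : open D.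
Hypothesis sG : smooth_on D G.
Hypothesis symG : forall z, D z -> (G z)^T = G z.
Hypothesis unitG : forall z, D z -> G z \in unitmx.
Hypothesis oU : open U.
Hypothesis fD : forall u, U u -> D (f u).
Hypothesis sf : smooth_on U f.

Lemma smooth_pder_entry i c : smooth_on U (fun u => pder i f u 0 c : R^o).
Proof. by have /(smooth_mxP _ oU) := smooth_pder i sf; exact. Qed.

Lemma smooth_chr_comp c : smooth_on U (fun u => chr G c (f u)).
Proof. exact: (smooth_comp oU oD fD sf (smooth_chr oD sG unitG c)). Qed.

Lemma smooth_Gf : smooth_on U (fun u => G (f u)).
Proof. exact: (smooth_comp oU oD fD sf sG). Qed.

Lemma smooth_conn i : smooth_on U (conn i).
Proof.
apply/(smooth_mxP _ oU) => a b.
have -> : (fun u => conn i u a b : R^o) =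
    (fun u => \sum_c pder i f u 0 c * chr G c (f u) a b : R^o).
  apply/funext => u; rewrite /conn summxE; apply: eq_bigr => c _; exact: mxE.
apply: smooth_sum => [//|c _]; apply: (smooth_mul oU (smooth_pder_entry i c)).
by have /(smooth_mxP _ oU) := smooth_chr_comp c; exact.
Qed.

Lemma smooth_cov p i (V : 'rV[R]_n -> 'M[R]_(p, N)) :
  smooth_on U V -> smooth_on U (cov i V).
Proof.
move=> sV; apply: (smooth_add oU (smooth_pder i sV)).
exact: (smooth_mulmx oU sV (smooth_conn i)).
Qed.

Lemma pder_Gf i u : U u ->
  pder i (fun u => G (f u)) u = conn i u *m G (f u) + G (f u) *m (conn i u)^T.
Proof.
move=> Uu.
rewrite (pder_comp i (smooth_diff sf Uu) (smooth_diff sG (fD Uu))).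
rewrite /conn mulmx_suml linear_sum/= mulmx_sumr -big_split /=.
apply: eq_bigr => c _.
rewrite (pder_metric oD sG symG unitG c (fD Uu)).
move: (pder i f u 0 c) => a.
by rewrite scalerDr linearZ/= -scalemxAl -scalemxAr.
Qed.

(** The pulled-back connection inherits compatibility with [G] from the ambient one. *)
Lemma cov_product p q i (V : 'rV[R]_n -> 'M[R]_(p, N)) (W : 'rV[R]_n -> 'M[R]_(q, N)) u :
  differentiable V u -> differentiable W u -> U u ->
  pder i (fun u => V u *m G (f u) *m (W u)^T) u =
  cov i V u *m G (f u) *m (W u)^T + V u *m G (f u) *m (cov i W u)^T.
Proof.
move=> dV dW Uu; have dG := smooth_diff smooth_Gf Uu.
rewrite {1}/pder (derive_mulmx _ (differentiable_mulmx dV dG) (differentiable_trmx dW)).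
rewrite (derive_mulmx _ dV dG) (derive_trmx _ dW).
rewrite -!/(pder _ _ _) (pder_Gf i Uu) /cov.
move: (pder i V u) (pder i W u) => dVu dWu.
rewrite [(_ + _)^T]linearD/= trmx_mul !mulmxDl !mulmxDr !mulmxDl !mulmxA -!addrA.
by congr (_ + _); congr (_ + _); rewrite addrC.
Qed.

Lemma smooth_jac : smooth_on U (jac f).
Proof.
apply/(smooth_mxP _ oU) => i k.
have -> : (fun u => jac f u i k : R^o) = (fun u => pder i f u 0 k).
  by apply/funext => u; exact: mxE.
exact: smooth_pder_entry.
Qed.

Lemma smooth_induced_metric : smooth_on U (induced_metric G f).
Proof.
apply: (smooth_mulmx oU (smooth_mulmx oU smooth_jac smooth_Gf)).
exact: (smooth_trmx oU smooth_jac).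
Qed.

Lemma row_cov p i (V : 'rV[R]_n -> 'M[R]_(p, N)) a u : differentiable V u ->
  row a (cov i V u) = cov i (fun u => row a (V u)) u.
Proof.
move=> dV.
have rowD (A B : 'M[R]_(p, N)) : row a (A + B) = row a A + row a B.
  by apply/rowP => k; rewrite !mxE.
have drow : row a (pder i V u) = pder i (fun u => row a (V u)) u.
  apply/rowP => k; have := derive_entry (delta_mx 0 i) a k dV.
  rewrite -/(pder i V u); move: (pder i V u) => dVu dVuE; rewrite [LHS]mxE dVuE.
  rewrite /pder derive_entry; last first.
    apply: differentiable_mx => i' j'.
    have -> : (fun x => row a (V x) i' j' : R^o) = (fun x => V x a j').
      by apply/funext => x; exact: mxE.
    exact: differentiable_entry.
  have E : (fun x => row a (V x) 0 k) = (fun x => V x a k).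
    by apply/funext => x; exact: mxE.
  exact: (congr1 (fun h : _ -> R^o => 'D_(delta_mx 0 i) h u) (esym E)).
by rewrite /cov rowD row_mul drow.
Qed.

Lemma row_jac i u : row i (jac f u) = pder i f u.
Proof. exact: (rowK (fun i => pder i f u) i). Qed.

Lemma row_cov_jac i j u : U u -> row j (cov i (jac f) u) = cov i (pder j f) u.
Proof.
move=> Uu; rewrite row_cov; last exact: (smooth_diff smooth_jac Uu).
by congr (cov i _ u); apply/funext => v; exact: row_jac.
Qed.

(** Absence of torsion: second partial derivatives of [f] commute and the Christoffel symbols are
    symmetric. *)
Lemma cov_jac_sym i j u : U u -> row j (cov i (jac f) u) = row i (cov j (jac f) u).
Proof.
move=> Uu; rewrite (row_cov_jac i j Uu) (row_cov_jac j i Uu) /cov.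
apply: f_equal2.
  exact: (pder_comm i j oU sf Uu).
rewrite /conn; move: (pder i f u) (pder j f u) => X Y.
apply/rowP => k; rewrite !mulmx_sumr !summxE.
transitivity (\sum_c \sum_b X 0 c * Y 0 b * chr G c (f u) b k).
  apply: eq_bigr => c _; rewrite -scalemxAr 2!mxE mulr_sumr.
  by apply: eq_bigr => b _; rewrite mulrA.
rewrite exchange_big /=; apply: eq_bigr => b _; rewrite -scalemxAr 2!mxE mulr_sumr.
apply: eq_bigr => c _; rewrite (chr_sym oD symG c b k (fD Uu)).
by rewrite mulrA [X 0 c * _]mulrC.
Qed.

Lemma pder_conn i j u : U u ->
  pder i (conn j) u =
  \sum_d (pder i (fun v => pder j f v 0 d : R^o) u *: chr G d (f u) +
    pder j f u 0 d *: \sum_c pder i f u 0 c *: pder c (chr G d) (f u)).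
Proof.
move=> Uu.
have da d := smooth_diff (smooth_pder_entry j d) Uu.
have dC d := smooth_diff (smooth_chr_comp d) Uu.
have dm d : differentiable (fun v => pder j f v 0 d *: chr G d (f v)) u.
  apply: differentiable_mx => a b.
  have -> : (fun x => (pder j f x 0 d *: chr G d (f x)) a b : R^o) =
      (fun x => pder j f x 0 d : R^o) * (fun x => chr G d (f x) a b : R^o).
    by apply/funext => x; exact: mxE.
  exact: (differentiableM (da d) (differentiable_entry a b (dC d))).
rewrite {1}/pder (derive_sum_fct _ dm); apply: eq_bigr => d _.
rewrite (derive_scalemx _ (da d) (dC d)); apply: f_equal2; first by [].
apply: f_equal2; first by [].
exact: (pder_comp i (smooth_diff sf Uu)
  (smooth_diff (smooth_chr oD sG unitG d) (fD Uu))).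
Qed.

(** Expanding by the chain rule, the mixed second derivatives of [f] cancel by Schwarz, and what
    remains is the ambient curvature evaluated on the velocities of [f]. *)
Lemma conn_curvature i j u : U u ->
  pder i (conn j) u - pder j (conn i) u + conn j u *m conn i u - conn i u *m conn j u =
  ambient_riemann i j u.
Proof.
move=> Uu; rewrite (pder_conn i j Uu) (pder_conn j i Uu).
have hE d : pder j (fun v => pder i f v 0 d : R^o) u =
    pder i (fun v => pder j f v 0 d : R^o) u.
  have dj := derive_entry (delta_mx 0 j) 0 d (smooth_diff (smooth_pder i sf) Uu).
  have di := derive_entry (delta_mx 0 i) 0 d (smooth_diff (smooth_pder j sf) Uu).
  have e := congr1 (fun M : 'rV[R]_N => M 0 d) (pder_comm j i oU sf Uu).
  exact: (etrans (esym dj) (etrans e di)).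
have rE c d := riemann_mxE oD sG unitG c d (fD Uu).
rewrite /ambient_riemann; under [RHS]eq_bigr => c _ do under eq_bigr => d _ do rewrite rE.
rewrite /conn; exact: (conn_bracket (fun c => pder i f u 0 c) (fun c => pder j f u 0 c)
  (fun c => chr G c (f u)) (fun c d => pder c (chr G d) (f u)) hE).
Qed.

Lemma ricci_identity p i j (V : 'rV[R]_n -> 'M[R]_(p, N)) u : smooth_on U V -> U u ->
  cov i (cov j V) u - cov j (cov i V) u = V u *m ambient_riemann i j u.
Proof.
move=> sV Uu; rewrite -(conn_curvature i j Uu).
have E a b : pder a (cov b V) u =
    pder a (pder b V) u + (pder a V u *m conn b u + V u *m pder a (conn b) u).
  have dV := smooth_diff sV Uu.
  have dc := smooth_diff (smooth_conn b) Uu.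
  rewrite {1}/pder (deriveD (diff_derivable (smooth_diff (smooth_pder b sV) Uu))
    (diff_derivable (differentiable_mulmx dV dc))).
  apply: f_equal2; first by [].
  exact: (derive_mulmx _ dV dc).
rewrite {1 3}/cov (E i j) (E j i) (pder_comm i j oU sV Uu) /cov.
move: (pder i (conn j) u) (pder j (conn i) u) (pder j (pder i V) u) (pder i V u) (pder j V u)
  (conn i u) (conn j u) (V u) => A B H X Y Ci Cj W.
rewrite !(mulmxDl, mulmxDr, mulmxN, mulNmx, opprD) !mulmxA.
move: (X *m Cj) (Y *m Ci) (W *m A) (W *m B) (W *m Cj *m Ci) (W *m Ci *m Cj).
move=> t1 t2 t3 t4 t5 t6; apply/matrixP => a b; rewrite !mxE; ring.
Qed.

Let g := induced_metric G f.
Hypothesis unitg : forall u, U u -> g u \in unitmx.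

Lemma sym_induced_metric u : U u -> (g u)^T = g u.
Proof. by move=> Uu; rewrite /g /induced_metric !trmx_mul trmxK symG ?mulmxA//; exact: fD. Qed.

(** The tangential part of the pulled-back connection is symmetric in its two coordinate indices and
    compatible with [g], and the Koszul formula leaves room for only one such connection. This ties
    the Christoffel symbols of the induced metric to the ambient ones. *)
Lemma tangential_cov_jac i u : U u ->
  cov i (jac f) u *m G (f u) *m (jac f u)^T = chr g i u *m g u.
Proof.
move=> Uu; have dJ := smooth_diff smooth_jac Uu.
pose T i := cov i (jac f) u *m G (f u) *m (jac f u)^T.
have dg a : pder a g u = T a + (T a)^T.
  apply: (etrans (cov_product a dJ dJ Uu)); congr (_ + _).
  by rewrite /T !trmx_mul trmxK symG ?mulmxA//; exact: fD.
have Tsym a b k : T a b k = T b a k.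
  have rT a' b' : T a' b' k = (row b' (cov a' (jac f) u) *m G (f u) *m (jac f u)^T) 0 k.
    by rewrite -!row_mul [RHS]mxE.
  by apply: (etrans (rT a b) (etrans _ (esym (rT b a)))); rewrite (cov_jac_sym a b Uu).
rewrite -/(T i); clearbody T.
have sg := smooth_induced_metric; have symg := sym_induced_metric.
have dgE a b c : dmetric g a b c u = T a b c + T a c b.
  rewrite (dmetricE sg a b c Uu) dg mxE; congr (_ + _); exact: mxE.
apply/matrixP => j k; rewrite (koszul symg unitg i j k Uu) !dgE.
by rewrite (Tsym j i k) (Tsym i k j) (Tsym j k i); field.
Qed.

(** Gauss formula: row [j] is the second fundamental form on the coordinate vectors [i] and [j]. *)
Definition normal_cov_jac i u : 'M[R]_(n, N) := cov i (jac f) u - chr g i u *m jac f u.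

Lemma normal_cov_jac_tangent i u : U u ->
  normal_cov_jac i u *m G (f u) *m (jac f u)^T = 0.
Proof.
move=> Uu; rewrite /normal_cov_jac !mulmxBl (tangential_cov_jac i Uu).
have -> : chr g i u *m jac f u *m G (f u) *m (jac f u)^T = chr g i u *m g u.
  by rewrite /g /induced_metric !mulmxA.
exact: subrr.
Qed.

Lemma normal_part_ambient_cov i j u : U u ->
  normal_part G f u (ambient_cov G f i (pder j f) u) = row j (normal_cov_jac i u).
Proof.
move=> Uu; rewrite /normal_part ambient_covE -(row_cov_jac i j Uu) -!row_mul.
rewrite (tangential_cov_jac i Uu) mulmxK ?unitg//.
by apply/rowP => k; rewrite !mxE.
Qed.

Lemma second_ffE u X Y : U u ->
  second_ff G f u X Y = \sum_i X 0 i *: (Y *m normal_cov_jac i u).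
Proof.
move=> Uu; apply: eq_bigr => i _.
rewrite mulmx_sum_row scaler_sumr; apply: eq_bigr => j _.
by rewrite scalerA (normal_part_ambient_cov i j Uu).
Qed.

Lemma second_ff_sym u X Y : U u -> second_ff G f u X Y = second_ff G f u Y X.
Proof.
move=> Uu; rewrite /second_ff exchange_big /=; apply: eq_bigr => j _.
apply: eq_bigr => i _; apply: f_equal2; first exact: mulrC.
apply: (congr1 (normal_part G f u)); rewrite !ambient_covE.
apply: (etrans (esym (row_cov_jac i j Uu)) (etrans _ (row_cov_jac j i Uu))).
exact: cov_jac_sym.
Qed.

(** The Ricci identity is applied to the Jacobian and projected to the tangent space, after the
    Gauss formula has been substituted for the first derivatives. *)
Lemma gauss_mx i j u : U u -> riemann_mx g i j u *m g u =
  jac f u *m ambient_riemann i j u *m G (f u) *m (jac f u)^T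
  + normal_cov_jac j u *m G (f u) *m (normal_cov_jac i u)^T
  - normal_cov_jac i u *m G (f u) *m (normal_cov_jac j u)^T.
Proof.
move=> Uu; have sg := smooth_induced_metric; have symg := sym_induced_metric.
have sJ := smooth_jac; have dJ := smooth_diff sJ Uu.
have sc a := smooth_chr oU sg unitg a.
have scJ a : smooth_on U (fun v => chr g a v *m jac f v) := smooth_mulmx oU (sc a) sJ.
have sN a : smooth_on U (normal_cov_jac a).
  apply: (smooth_mxP _ oU).2 => k l.
  have -> : (fun v => normal_cov_jac a v k l : R^o) =
      (fun v => cov a (jac f) v k l - (chr g a v *m jac f v) k l : R^o).
    by apply/funext => v; rewrite /normal_cov_jac mxE; congr (_ + _); exact: mxE.
  by apply: smooth_sub => //; [have /(smooth_mxP _ oU) := smooth_cov a sJ; exact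
                              |have /(smooth_mxP _ oU) := scJ a; exact].
have dN a := smooth_diff (sN a) Uu.
have dc a := smooth_diff (sc a) Uu.
(* The Gauss formula, differentiated once more. *)
have covE a b : cov a (cov b (jac f)) u =
    pder a (chr g b) u *m jac f u + chr g b u *m cov a (jac f) u
    + cov a (normal_cov_jac b) u.
  have -> : cov b (jac f) = (fun v => chr g b v *m jac f v) + normal_cov_jac b.
    by apply/funext => v; rewrite /normal_cov_jac/= fctE /= addrC subrK.
  rewrite {1}/cov {1}/pder (deriveD (diff_derivable (smooth_diff (scJ b) Uu))
    (diff_derivable (dN b))) (derive_mulmx _ (dc b) dJ) /cov.
  rewrite -!/(pder _ _ _).
  move: (pder a (chr g b) u) (pder a (jac f) u) (pder a (normal_cov_jac b) u) => A B C.
  rewrite fctE mulmxDl mulmxDr mulmxA !addrA; congr (_ + _).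
  by rewrite -!addrA; congr (_ + (_ + _)); rewrite addrC.
(* Weingarten equation: differentiating the orthogonality of [normal_cov_jac b] to the tangent
   vectors moves the derivative onto the Jacobian, whose normal part is again the second fundamental
   form. *)
have tN a b : cov a (normal_cov_jac b) u *m G (f u) *m (jac f u)^T =
    - (normal_cov_jac b u *m G (f u) *m (normal_cov_jac a u)^T).
  have /esym := cov_product a (dN b) dJ Uu.
  rewrite (_ : pder a _ u = 0); last first.
    apply: (etrans (pder_eq (g := fun=> 0) a oU _ Uu)); last exact: derive_cst.
    by move=> v; exact: normal_cov_jac_tangent.
  move/eqP; rewrite addr_eq0 => /eqP ->; congr (- _).
  have -> : cov a (jac f) u = chr g a u *m jac f u + normal_cov_jac a u.
    by rewrite /normal_cov_jac addrC subrK.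
  by rewrite linearD/= trmx_mul mulmxDr mulmxA normal_cov_jac_tangent// mul0mx add0r.
have tE a b : cov a (cov b (jac f)) u *m G (f u) *m (jac f u)^T =
    pder a (chr g b) u *m g u + chr g b u *m chr g a u *m g u
    - normal_cov_jac b u *m G (f u) *m (normal_cov_jac a u)^T.
  rewrite covE; move: (tN a b) (tangential_cov_jac a Uu).
  move: (cov a (normal_cov_jac b) u) (cov a (jac f) u) (pder a (chr g b) u) => C B A.
  move: (normal_cov_jac a u) (normal_cov_jac b u) (chr g b u) (chr g a u) => Na Nb Cb Ca tC tB.
  rewrite !mulmxDl tC; congr (_ + _ - _); first by rewrite /g /induced_metric !mulmxA.
  by rewrite -[RHS]mulmxA -tB !mulmxA.
rewrite (riemann_mxE oU sg unitg i j Uu) -/g.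
move: (tE i j) (tE j i) (ricci_identity i j sJ Uu).
move: (cov i (cov j (jac f)) u) (cov j (cov i (jac f)) u) => A B.
move: (pder i (chr g j) u) (pder j (chr g i) u) (chr g i u) (chr g j u) => dCj dCi Ci Cj.
move: (normal_cov_jac i u) (normal_cov_jac j u) => Ni Nj tA tB <-.
rewrite !mulmxBl tA tB mulmxDl mulmxBl.
move: (dCj *m g u) (dCi *m g u) (Cj *m Ci *m g u) (Ci *m Cj *m g u) => t1 t2 t3 t4.
move: (Ni *m G (f u) *m Nj^T) (Nj *m G (f u) *m Ni^T) => t5 t6 {tA tB}.
by apply/matrixP => a b; rewrite !mxE; ring.
Qed.

End Gauss.

Lemma gauss_sum (R : realType) n N (x y : 'I_n -> R) (J : 'M[R]_(n, N))
    (K : 'I_n -> 'I_n -> 'M[R]_N) (A : 'I_n -> 'M[R]_(n, N)) (H : 'M[R]_N) :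
  \sum_i \sum_j (x i * y j) *:
    (J *m K i j *m H *m J^T + A j *m H *m (A i)^T - A i *m H *m (A j)^T) =
  J *m (\sum_i \sum_j (x i * y j) *: K i j) *m H *m J^T
  + (\sum_j y j *: A j) *m H *m (\sum_i x i *: A i)^T
  - (\sum_i x i *: A i) *m H *m (\sum_j y j *: A j)^T.
Proof.
have -> : J *m (\sum_i \sum_j (x i * y j) *: K i j) *m H *m J^T =
    \sum_i \sum_j (x i * y j) *: (J *m K i j *m H *m J^T).
  rewrite mulmx_sumr !mulmx_suml; apply: eq_bigr => i _.
  rewrite mulmx_sumr !mulmx_suml; apply: eq_bigr => j _.
  by rewrite -scalemxAr -!scalemxAl.
have -> : (\sum_j y j *: A j) *m H *m (\sum_i x i *: A i)^T =
    \sum_i \sum_j (x i * y j) *: (A j *m H *m (A i)^T).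
  rewrite [(\sum_i _)^T]linear_sum mulmx_sumr; apply: eq_bigr => i _.
  rewrite !mulmx_suml; apply: eq_bigr => j _.
  by rewrite linearZ /= -scalemxAr -!scalemxAl scalerA.
have -> : (\sum_i x i *: A i) *m H *m (\sum_j y j *: A j)^T =
    \sum_i \sum_j (x i * y j) *: (A i *m H *m (A j)^T).
  rewrite !mulmx_suml; apply: eq_bigr => i _.
  rewrite [(\sum_j _)^T]linear_sum mulmx_sumr; apply: eq_bigr => j _.
  by rewrite linearZ /= -scalemxAr -!scalemxAl scalerA mulrC.
rewrite -big_split -sumrB /=; apply: eq_bigr => i _.
rewrite -big_split -sumrB /=; apply: eq_bigr => j _.
by rewrite scalerBr scalerDr.
Qed.

Section GaussEquation.
Variables (R : realType) (n N : nat) (G : 'rV[R]_N -> 'M[R]_N).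
Variables (D : set 'rV[R]_N) (U : set 'rV[R]_n) (f : 'rV[R]_n -> 'rV[R]_N).
Hypothesis oD : open D.
Hypothesis sG : smooth_on D G.
Hypothesis symG : forall z, D z -> (G z)^T = G z.
Hypothesis unitG : forall z, D z -> G z \in unitmx.
Hypothesis oU : open U.
Hypothesis fD : forall u, U u -> D (f u).
Hypothesis sf : smooth_on U f.
Let g := induced_metric G f.
Hypothesis unitg : forall u, U u -> g u \in unitmx.

Lemma ambient_riemann_contract u (X Y : 'rV[R]_n) :
  \sum_i \sum_j (X 0 i * Y 0 j) *: ambient_riemann G f i j u =
  \sum_c \sum_d ((X *m jac f u) 0 c * (Y *m jac f u) 0 d) *: riemann_mx G c d (f u).
Proof.
transitivity (\sum_c \sum_d \sum_i \sum_j
    (X 0 i * jac f u i c * (Y 0 j * jac f u j d)) *: riemann_mx G c d (f u)).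
  rewrite (exchange_big_dep xpredT) //=.
  under eq_bigr => j _.
    under eq_bigr => i _.
      rewrite scaler_sumr; under eq_bigr => c _ do rewrite scaler_sumr.
      over.
    rewrite exchange_big /=; under eq_bigr => c _ do rewrite exchange_big /=.
    over.
  rewrite exchange_big /=; apply: eq_bigr => c _.
  rewrite exchange_big /=; apply: eq_bigr => d _.
  rewrite exchange_big /=; apply: eq_bigr => i _; apply: eq_bigr => j _.
  rewrite scalerA -!(row_jac f) ![row _ _ 0 _]mxE; congr (_ *: _).
  by rewrite mulrACA.
apply: eq_bigr => c _; apply: eq_bigr => d _.
rewrite ![(_ *m jac f u) 0 _]mxE mulr_suml scaler_suml; apply: eq_bigr => i _.
by rewrite mulr_sumr scaler_suml.
Qed.

Lemma gauss_equation u X Y : U u ->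
  sectional g u X Y =
  sectional G (f u) (X *m jac f u) (Y *m jac f u)
  + inner (G (f u)) (second_ff G f u X X) (second_ff G f u Y Y)
  - inner (G (f u)) (second_ff G f u X Y) (second_ff G f u X Y).
Proof.
move=> Uu; have sG' := symG (fD Uu).
pose NX (Z : 'rV[R]_n) : 'M[R]_(n, N) := \sum_i Z 0 i *: normal_cov_jac G f i u.
have hE Z W : second_ff G f u Z W = W *m NX Z.
  rewrite (second_ffE oD sG symG unitG oU fD sf unitg _ _ Uu).
  by rewrite mulmx_sumr; apply: eq_bigr => i _; rewrite scalemxAr.
(* [hE] puts the first argument into [NX] and leaves the second outside; symmetry supplies the two
   ways of writing the mixed term that the matrix identity calls for. *)
have hs := second_ff_sym oD symG oU fD sf X Y Uu.
have -> : inner (G (f u)) (second_ff G f u X Y) (second_ff G f u X Y) =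
    inner (G (f u)) (Y *m NX X) (X *m NX Y) by apply: f_equal2; [exact: hE|rewrite hs; exact: hE].
rewrite !hE (innerC _ _ sG') /sectional !curvatureE /inner -ambient_riemann_contract.
have KE : (\sum_i \sum_j (X 0 i * Y 0 j) *: riemann_mx g i j u) *m g u =
   jac f u *m (\sum_i \sum_j (X 0 i * Y 0 j) *: ambient_riemann G f i j u)
     *m G (f u) *m (jac f u)^T + NX Y *m G (f u) *m (NX X)^T - NX X *m G (f u) *m (NX Y)^T.
  rewrite -gauss_sum.
  rewrite mulmx_suml; apply: eq_bigr => i _; rewrite mulmx_suml; apply: eq_bigr => j _.
  by rewrite -scalemxAl (gauss_mx oD sG symG unitG oU fD sf unitg i j Uu).
rewrite -[Y *m _ *m g u]mulmxA KE.
move: (\sum_i \sum_j _) (NX X) (NX Y) => K NXX NXY.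
have entryDB (A B C : 'M[R]_1) : A 0 0 + B 0 0 - C 0 0 = (A + B - C) 0 0 by rewrite !mxE.
rewrite entryDB; congr (fun_of_matrix _ 0 0).
by rewrite mulmxBr mulmxDr mulmxBl mulmxDl !trmx_mul !mulmxA.
Qed.

End GaussEquation.

(** * Calculus of complex matrices *)

Section ComplexParts.
Variable R : realType.
Implicit Types x y : R[i].

Lemma complexP x y : Re x = Re y -> Im x = Im y -> x = y.
Proof. by case: x y => [a b] [c d] /= -> ->. Qed.

Lemma cReD x y : Re (x + y) = Re x + Re y. Proof. by case: x y => [a b] [c d]. Qed.
Lemma cImD x y : Im (x + y) = Im x + Im y. Proof. by case: x y => [a b] [c d]. Qed.
Lemma cReN x : Re (- x) = - Re x. Proof. by case: x. Qed.
Lemma cImN x : Im (- x) = - Im x. Proof. by case: x. Qed.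
Lemma cReM x y : Re (x * y) = Re x * Re y - Im x * Im y.
Proof. by case: x y => [a b] [c d]. Qed.
Lemma cImM x y : Im (x * y) = Re x * Im y + Im x * Re y.
Proof. by case: x y => [a b] [c d]. Qed.
Lemma cReJ x : Re (conjc x) = Re x. Proof. by case: x. Qed.
Lemma cImJ x : Im (conjc x) = - Im x. Proof. by case: x. Qed.
Lemma cReV x : Re x^-1 = Re x * (Re x * Re x + Im x * Im x)^-1.
Proof. by case: x => [a b]; rewrite -!expr2. Qed.
Lemma cImV x : Im x^-1 = - Im x * (Re x * Re x + Im x * Im x)^-1.
Proof. by case: x => [a b]; rewrite -!expr2 mulNr. Qed.

Lemma cRe_sum (I : Type) (r : seq I) (P : pred I) (F : I -> R[i]) :
  Re (\sum_(i <- r | P i) F i) = \sum_(i <- r | P i) Re (F i).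
Proof. exact: (big_morph _ cReD). Qed.
Lemma cIm_sum (I : Type) (r : seq I) (P : pred I) (F : I -> R[i]) :
  Im (\sum_(i <- r | P i) F i) = \sum_(i <- r | P i) Im (F i).
Proof. exact: (big_morph _ cImD). Qed.

Lemma normsq_neq0 x : x != 0 -> Re x * Re x + Im x * Im x != 0.
Proof.
apply: contraNneq => e; apply/eqP; apply: complexP => /=; nra.
Qed.

End ComplexParts.

Section ComplexSmooth.
Variables (R : realType) (n : nat) (U : set 'rV[R]_n).
Hypothesis oU : open U.
Implicit Types f g : 'rV[R]_n -> R[i].

(** [smooth_on] takes values in a normed module over the reals, so smoothness of a complex function
    of real variables is expressed by its real and imaginary parts. *)
Definition csmooth f : Prop :=
  smooth_on U (fun u => Re (f u) : R^o) /\ smooth_on U (fun u => Im (f u) : R^o).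

Lemma csmooth_cst c : csmooth (fun=> c).
Proof. by split; exact: smooth_cst. Qed.

Lemma csmooth_add f g : csmooth f -> csmooth g -> csmooth (fun u => f u + g u).
Proof.
move=> [f1 f2] [g1 g2]; split.
  by apply: (smooth_eq oU _ (smooth_add oU f1 g1)) => u _; rewrite cReD.
by apply: (smooth_eq oU _ (smooth_add oU f2 g2)) => u _; rewrite cImD.
Qed.

Lemma csmooth_mul f g : csmooth f -> csmooth g -> csmooth (fun u => f u * g u).
Proof.
move=> [f1 f2] [g1 g2]; split.
  apply: (smooth_eq oU _ (smooth_sub oU (smooth_mul oU f1 g1) (smooth_mul oU f2 g2))).
  by move=> u _; rewrite cReM.
apply: (smooth_eq oU _ (smooth_add oU (smooth_mul oU f1 g2) (smooth_mul oU f2 g1))).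
by move=> u _; rewrite cImM.
Qed.

Lemma csmooth_conj f : csmooth f -> csmooth (fun u => conjc (f u)).
Proof.
move=> [f1 f2]; split; first by apply: (smooth_eq oU _ f1) => u _; rewrite cReJ.
by apply: (smooth_eq oU _ (smooth_opp oU f2)) => u _; rewrite cImJ.
Qed.

Lemma csmooth_inv f : (forall u, U u -> f u != 0) -> csmooth f ->
  csmooth (fun u => (f u)^-1).
Proof.
move=> f0 [f1 f2].
have sN := smooth_add oU (smooth_mul oU f1 f1) (smooth_mul oU f2 f2).
have sV := smooth_inv oU (fun u Uu => normsq_neq0 (f0 u Uu)) sN.
split.
  by apply: (smooth_eq oU _ (smooth_mul oU f1 sV)) => u _; rewrite cReV.
by apply: (smooth_eq oU _ (smooth_mul oU (smooth_opp oU f2) sV)) => u _; rewrite cImV.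
Qed.

Lemma csmooth_sum (I : Type) (r : seq I) (P : pred I) (F : I -> 'rV[R]_n -> R[i]) :
  (forall i, csmooth (F i)) -> csmooth (fun u => \sum_(i <- r | P i) F i u).
Proof.
move=> sF; split.
  apply: (smooth_eq oU _ (smooth_sum r oU (fun i (_ : P i) => (sF i).1))) => u _.
  by rewrite cRe_sum.
apply: (smooth_eq oU _ (smooth_sum r oU (fun i (_ : P i) => (sF i).2))) => u _.
by rewrite cIm_sum.
Qed.

Lemma csmooth_prod (I : Type) (r : seq I) (F : I -> 'rV[R]_n -> R[i]) :
  (forall i, csmooth (F i)) -> csmooth (fun u => \prod_(i <- r) F i u).
Proof.
move=> sF; elim: r => [|i r IH].
  rewrite (_ : (fun u => _) = fun=> 1); first exact: csmooth_cst.
  by apply/funext => u; rewrite big_nil.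
rewrite (_ : (fun u => _) = fun u => F i u * \prod_(j <- r) F j u).
  exact: csmooth_mul.
by apply/funext => u; rewrite big_cons.
Qed.

Definition csmoothmx p q (F : 'rV[R]_n -> 'M[R[i]]_(p, q)) : Prop :=
  forall i j, csmooth (fun u => F u i j).

Lemma csmoothmx_cst p q (A : 'M[R[i]]_(p, q)) : csmoothmx (fun=> A).
Proof. by move=> i j; exact: csmooth_cst. Qed.

Lemma csmoothmx_add p q (F H : 'rV[R]_n -> 'M[R[i]]_(p, q)) :
  csmoothmx F -> csmoothmx H -> csmoothmx (fun u => F u + H u).
Proof.
move=> sF sH i j; rewrite (_ : (fun u => _) = fun u => F u i j + H u i j).
  exact: csmooth_add.
by apply/funext => u; rewrite mxE.
Qed.

Lemma csmoothmx_mul p q r (F : 'rV[R]_n -> 'M[R[i]]_(p, q)) (H : 'rV[R]_n -> 'M[R[i]]_(q, r)) :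
  csmoothmx F -> csmoothmx H -> csmoothmx (fun u => F u *m H u).
Proof.
move=> sF sH i j; rewrite (_ : (fun u => _) = fun u => \sum_k F u i k * H u k j).
  by apply: csmooth_sum => k; exact: csmooth_mul.
by apply/funext => u; rewrite mxE.
Qed.

Lemma csmoothmx_ctr p q (F : 'rV[R]_n -> 'M[R[i]]_(p, q)) :
  csmoothmx F -> csmoothmx (fun u => ctrmx (F u)).
Proof.
move=> sF i j; rewrite (_ : (fun u => _) = fun u => conjc (F u j i)).
  exact: csmooth_conj.
by apply/funext => u; rewrite !mxE.
Qed.

Lemma csmoothmx_opp p q (F : 'rV[R]_n -> 'M[R[i]]_(p, q)) :
  csmoothmx F -> csmoothmx (fun u => - F u).
Proof.
move=> sF i j; rewrite (_ : (fun u => _) = fun u => -1 * F u i j).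
  by apply: csmooth_mul => //; exact: csmooth_cst.
by apply/funext => u; rewrite !mxE mulN1r.
Qed.

Lemma csmooth_det p (F : 'rV[R]_n -> 'M[R[i]]_p) : csmoothmx F ->
  csmooth (fun u => \det (F u)).
Proof.
move=> sF; apply: csmooth_sum => s; apply: csmooth_mul; first exact: csmooth_cst.
exact: csmooth_prod.
Qed.

Lemma csmoothmx_inv p (F : 'rV[R]_n -> 'M[R[i]]_p) :
  (forall u, U u -> F u \in unitmx) -> csmoothmx F -> csmoothmx (fun u => invmx (F u)).
Proof.
move=> uF sF i j.
have sd : csmooth (fun u => (\det (F u))^-1).
  by apply: csmooth_inv; [move=> u /uF; rewrite unitmxE unitfE|exact: csmooth_det].
have sc : csmooth (fun u => cofactor (F u) j i).
  apply: csmooth_mul; first exact: csmooth_cst.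
  apply: csmooth_det => k l; rewrite (_ : (fun u => _) = fun u => F u (lift j k) (lift i l)).
    exact: sF.
  by apply/funext => u; rewrite !mxE.
have [s1 s2] := csmooth_mul sd sc.
by split; [apply: (smooth_eq oU _ s1)|apply: (smooth_eq oU _ s2)] => u Uu;
  rewrite /invmx uF// !mxE.
Qed.

End ComplexSmooth.

Section ComplexDerivative.
Variables (R : realType) (n : nat).
Implicit Types (f g : 'rV[R]_n -> R[i]) (v : 'rV[R]_n).

Definition cdiff f u : Prop :=
  differentiable (fun x => Re (f x) : R^o) u /\ differentiable (fun x => Im (f x) : R^o) u.

Definition cderive v f u : R[i] :=
  Complex ('D_v (fun x => Re (f x) : R^o) u) ('D_v (fun x => Im (f x) : R^o) u).

Lemma csmooth_cdiff U f u : csmooth U f -> U u -> cdiff f u.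
Proof. by move=> [f1 f2] Uu; split; [exact: smooth_diff f1 Uu|exact: smooth_diff f2 Uu]. Qed.

Lemma cderive_cst v c u : cderive v (fun=> c) u = 0.
Proof. by rewrite /cderive !(@derive_cst _ _ R^o). Qed.

Lemma cdiff_cst c u : cdiff (fun=> c) u.
Proof. by split; exact: (@differentiable_cst _ _ R^o). Qed.

Lemma cderive_eq U v f g u : open U -> (forall w, U w -> f w = g w) -> U u ->
  cderive v f u = cderive v g u.
Proof.
move=> oU fg Uu; have nfg := open_nbhs_nbhs (conj oU Uu).
rewrite /cderive (near_eq_derive (g := fun x => Re (g x) : R^o)); last first.
  by apply: filterS nfg => w Uw; rewrite fg.
rewrite [X in Complex _ X](near_eq_derive (g := fun x => Im (g x) : R^o)) //.
by apply: filterS nfg => w Uw; rewrite fg.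
Qed.

Lemma cdiff_add f g u : cdiff f u -> cdiff g u -> cdiff (fun x => f x + g x) u.
Proof.
move=> [f1 f2] [g1 g2]; split.
  rewrite (_ : (fun x => _) = (fun x => Re (f x) : R^o) + (fun x => Re (g x) : R^o)).
    exact: (differentiableD f1 g1).
  by apply/funext => x; rewrite cReD.
rewrite (_ : (fun x => _) = (fun x => Im (f x) : R^o) + (fun x => Im (g x) : R^o)).
  exact: (differentiableD f2 g2).
by apply/funext => x; rewrite cImD.
Qed.

Lemma cderive_add v f g u : cdiff f u -> cdiff g u ->
  cderive v (fun x => f x + g x) u = cderive v f u + cderive v g u.
Proof.
move=> [f1 f2] [g1 g2]; rewrite /cderive.
have -> : (fun x => Re (f x + g x) : R^o) =
    (fun x => Re (f x) : R^o) + (fun x => Re (g x) : R^o).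
  by apply/funext => x; rewrite cReD.
have -> : (fun x => Im (f x + g x) : R^o) =
    (fun x => Im (f x) : R^o) + (fun x => Im (g x) : R^o).
  by apply/funext => x; rewrite cImD.
rewrite (deriveD (diff_derivable f1) (diff_derivable g1)).
by rewrite (deriveD (diff_derivable f2) (diff_derivable g2)).
Qed.

Lemma cdiff_mul f g u : cdiff f u -> cdiff g u -> cdiff (fun x => f x * g x) u.
Proof.
move=> [f1 f2] [g1 g2]; split.
  rewrite (_ : (fun x => _) = (fun x => Re (f x) : R^o) * (fun x => Re (g x) : R^o)
      - (fun x => Im (f x) : R^o) * (fun x => Im (g x) : R^o)).
    exact: (differentiableB (differentiableM f1 g1) (differentiableM f2 g2)).
  by apply/funext => x; rewrite cReM.
rewrite (_ : (fun x => _) = (fun x => Re (f x) : R^o) * (fun x => Im (g x) : R^o)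
    + (fun x => Im (f x) : R^o) * (fun x => Re (g x) : R^o)).
  exact: (differentiableD (differentiableM f1 g2) (differentiableM f2 g1)).
by apply/funext => x; rewrite cImM.
Qed.

Lemma cderive_mul v f g u : cdiff f u -> cdiff g u ->
  cderive v (fun x => f x * g x) u = cderive v f u * g u + f u * cderive v g u.
Proof.
move=> [f1 f2] [g1 g2]; rewrite /cderive.
have -> : (fun x => Re (f x * g x) : R^o) =
    (fun x => Re (f x) : R^o) * (fun x => Re (g x) : R^o)
      - (fun x => Im (f x) : R^o) * (fun x => Im (g x) : R^o).
  by apply/funext => x; rewrite cReM.
have -> : (fun x => Im (f x * g x) : R^o) =
    (fun x => Re (f x) : R^o) * (fun x => Im (g x) : R^o)
    + (fun x => Im (f x) : R^o) * (fun x => Re (g x) : R^o).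
  by apply/funext => x; rewrite cImM.
have {}f1 := diff_derivable (v := v) f1; have {}f2 := diff_derivable (v := v) f2.
have {}g1 := diff_derivable (v := v) g1; have {}g2 := diff_derivable (v := v) g2.
rewrite (deriveB (derivableM f1 g1) (derivableM f2 g2)).
rewrite (deriveD (derivableM f1 g2) (derivableM f2 g1)).
rewrite (deriveM f1 g1) (deriveM f2 g2) (deriveM f1 g2) (deriveM f2 g1).
move: ('D_v (fun x => Re (f x) : R^o) u) ('D_v (fun x => Im (f x) : R^o) u)
  ('D_v (fun x => Re (g x) : R^o) u) ('D_v (fun x => Im (g x) : R^o) u) => a b c d.
apply: complexP; rewrite !(cReD, cImD, cReM, cImM) /= /GRing.scale /=; ring.
Qed.

Lemma cderive_sum v (I : Type) (r : seq I) (F : I -> 'rV[R]_n -> R[i]) u :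
  (forall i, cdiff (F i) u) -> cdiff (fun x => \sum_(i <- r) F i x) u /\
  cderive v (fun x => \sum_(i <- r) F i x) u = \sum_(i <- r) cderive v (F i) u.
Proof.
move=> dF; elim: r => [|i r [dIH IH]].
  have -> : (fun x => \sum_(i <- [::]) F i x) = fun=> 0.
    by apply/funext => x; rewrite big_nil.
  by rewrite big_nil; split; [exact: cdiff_cst|exact: cderive_cst].
have -> : (fun x => \sum_(j <- i :: r) F j x) = fun x => F i x + \sum_(j <- r) F j x.
  by apply/funext => x; rewrite big_cons.
split; first exact: (cdiff_add (dF i) dIH).
by rewrite big_cons (cderive_add v (dF i) dIH) IH.
Qed.

Lemma cderive_conj v f u : cdiff f u ->
  cderive v (fun x => conjc (f x)) u = conjc (cderive v f u).
Proof.
move=> [f1 f2]; rewrite /cderive.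
have -> : (fun x => Re (conjc (f x)) : R^o) = fun x => Re (f x).
  by apply/funext => x; rewrite cReJ.
have -> : (fun x => Im (conjc (f x)) : R^o) = - (fun x => Im (f x) : R^o).
  by apply/funext => x; rewrite cImJ.
by rewrite (deriveN (diff_derivable f2)).
Qed.

Definition cdiffmx p q (F : 'rV[R]_n -> 'M[R[i]]_(p, q)) u :=
  forall i j, cdiff (fun x => F x i j) u.

Definition cderivemx p q v (F : 'rV[R]_n -> 'M[R[i]]_(p, q)) u : 'M[R[i]]_(p, q) :=
  \matrix_(i, j) cderive v (fun x => F x i j) u.

Lemma csmoothmx_cdiff p q U (F : 'rV[R]_n -> 'M[R[i]]_(p, q)) u :
  csmoothmx U F -> U u -> cdiffmx F u.
Proof. by move=> sF Uu i j; exact: csmooth_cdiff (sF i j) Uu. Qed.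

Lemma cderivemx_cst p q v (A : 'M[R[i]]_(p, q)) u : cderivemx v (fun=> A) u = 0.
Proof. by apply/matrixP => i j; rewrite [LHS]mxE [RHS]mxE cderive_cst. Qed.

Lemma cderivemx_eq p q U v (F H : 'rV[R]_n -> 'M[R[i]]_(p, q)) u : open U ->
  (forall w, U w -> F w = H w) -> U u -> cderivemx v F u = cderivemx v H u.
Proof.
move=> oU FH Uu; apply/matrixP => i j; rewrite [LHS]mxE [RHS]mxE.
by apply: (cderive_eq v oU _ Uu) => w Uw; rewrite FH.
Qed.

Lemma cderivemx_add p q v (F H : 'rV[R]_n -> 'M[R[i]]_(p, q)) u :
  cdiffmx F u -> cdiffmx H u ->
  cderivemx v (fun x => F x + H x) u = cderivemx v F u + cderivemx v H u.
Proof.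
move=> dF dH; apply/matrixP => i j; rewrite [LHS]mxE [RHS]mxE ![cderivemx _ _ _ _ _]mxE.
rewrite -(cderive_add v (dF i j) (dH i j)).
by congr (cderive v _ u); apply/funext => x; rewrite mxE.
Qed.

Lemma cderivemx_mul p q r v (F : 'rV[R]_n -> 'M[R[i]]_(p, q))
    (H : 'rV[R]_n -> 'M[R[i]]_(q, r)) u :
  cdiffmx F u -> cdiffmx H u ->
  cderivemx v (fun x => F x *m H x) u = cderivemx v F u *m H u + F u *m cderivemx v H u.
Proof.
move=> dF dH; apply/matrixP => i j; rewrite [LHS]mxE.
have -> : (fun x => (F x *m H x) i j) = fun x => \sum_k F x i k * H x k j.
  by apply/funext => x; rewrite mxE.
have [_ ->] := cderive_sum v (index_enum 'I_q) (fun k => cdiff_mul (dF i k) (dH k j)).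
rewrite [RHS]mxE ![(_ *m _) i j]mxE -big_split /=; apply: eq_bigr => k _.
by rewrite (cderive_mul v (dF i k) (dH k j)) ![cderivemx _ _ _ _ _]mxE.
Qed.

Lemma cderivemx_ctr p q v (F : 'rV[R]_n -> 'M[R[i]]_(p, q)) u :
  cdiffmx F u -> cderivemx v (fun x => ctrmx (F x)) u = ctrmx (cderivemx v F u).
Proof.
move=> dF; apply/matrixP => i j; rewrite [LHS]mxE [RHS]mxE [_^T _ _]mxE.
rewrite [cderivemx _ _ _ _ _]mxE -(cderive_conj v (dF j i)).
by congr (cderive v _ u); apply/funext => x; rewrite !mxE.
Qed.

Lemma cderivemx_opp p q v (F : 'rV[R]_n -> 'M[R[i]]_(p, q)) u :
  cdiffmx F u -> cderivemx v (fun x => - F x) u = - cderivemx v F u.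
Proof.
move=> dF; apply/eqP; rewrite -addr_eq0; apply/eqP.
have dN : cdiffmx (fun x => - F x) u.
  move=> i j; rewrite (_ : (fun x => _) = fun x => -1 * F x i j).
    exact: (cdiff_mul (cdiff_cst _ _) (dF i j)).
  by apply/funext => x; rewrite mxE mulN1r.
rewrite -(cderivemx_add v dN dF) -[RHS](cderivemx_cst v (0 : 'M[R[i]]_(p, q)) u).
by congr (cderivemx v _ u); apply/funext => x; rewrite addrC subrr.
Qed.

Lemma derive_Re_tr p v (F : 'rV[R]_n -> 'M[R[i]]_p) u : cdiffmx F u ->
  'D_v (fun x => Re (\tr (F x)) : R^o) u = Re (\tr (cderivemx v F u)).
Proof.
move=> dF; have [_] := cderive_sum v (index_enum 'I_p) (fun i => dF i i).
move=> /(congr1 (@complex.Re R)) e; apply: (etrans e).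
by congr Re; apply: eq_bigr => i _; rewrite mxE.
Qed.

End ComplexDerivative.

Section ConjugateTranspose.
Variable R : realType.

Lemma ctrmxM p q r (A : 'M[R[i]]_(p, q)) (B : 'M[R[i]]_(q, r)) :
  ctrmx (A *m B) = ctrmx B *m ctrmx A.
Proof. by rewrite /ctrmx trmx_mul map_mxM. Qed.

Lemma ctrmxD p q (A B : 'M[R[i]]_(p, q)) : ctrmx (A + B) = ctrmx A + ctrmx B.
Proof. by rewrite /ctrmx linearD/= map_mxD. Qed.

Lemma ctrmxN p q (A : 'M[R[i]]_(p, q)) : ctrmx (- A) = - ctrmx A.
Proof. by rewrite /ctrmx linearN/= map_mxN. Qed.

Lemma ctrmxK p q (A : 'M[R[i]]_(p, q)) : ctrmx (ctrmx A) = A.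
Proof. by apply/matrixP => i j; rewrite !mxE conjcK. Qed.

Lemma ctrmx1 p : ctrmx (1%:M : 'M[R[i]]_p) = 1%:M.
Proof. by rewrite /ctrmx trmx1 map_mx1. Qed.

Lemma ctrmxZ p q c (A : 'M[R[i]]_(p, q)) : ctrmx (c *: A) = conjc c *: ctrmx A.
Proof. by rewrite /ctrmx linearZ/= map_mxZ. Qed.

Lemma ctrmx_inv p (A : 'M[R[i]]_p) : ctrmx (invmx A) = invmx (ctrmx A).
Proof. by rewrite /ctrmx trmx_inv map_invmx. Qed.

Lemma Re_tr_ctrmx p (A : 'M[R[i]]_p) : Re (\tr (ctrmx A)) = Re (\tr A).
Proof.
by rewrite /mxtrace !cRe_sum; apply: eq_bigr => i _; rewrite !mxE cReJ.
Qed.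

End ConjugateTranspose.

(** * Real coordinates of complex matrices *)

Section CoordinatesC.
Variables (R : realType) (m : nat).
Notation N := (gr_dim m).
Notation cm := (@cmatrix R m).
Implicit Types (x y z : 'rV[R]_N) (A : 'M[R[i]]_(2, m)).

Definition rmatrix A : 'rV[R]_N :=
  row_mx (mxvec (map_mx (@complex.Re R) A)) (mxvec (map_mx (@complex.Im R) A)).

Lemma cmatrixE z i j : cm z i j =
  Complex (z 0 (lshift (2 * m) (mxvec_index i j))) (z 0 (rshift (2 * m) (mxvec_index i j))).
Proof. by rewrite !mxE. Qed.

Lemma rmatrixK : cancel rmatrix cm.
Proof.
move=> A; apply/matrixP => i j; rewrite cmatrixE row_mxEl row_mxEr !mxvecE !mxE.
by case: (A i j).
Qed.

Lemma cmatrixK : cancel cm rmatrix.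
Proof.
move=> z; rewrite /rmatrix -[RHS](@hsubmxK _ 1 (2 * m) (2 * m) z); congr row_mx.
  rewrite -[RHS]vec_mxK; congr mxvec; apply/matrixP => i j.
  by rewrite !mxE.
rewrite -[RHS]vec_mxK; congr mxvec; apply/matrixP => i j.
by rewrite !mxE.
Qed.

Lemma cmatrixD x y : cm (x + y) = cm x + cm y.
Proof. by apply/matrixP => i j; rewrite [RHS]mxE !cmatrixE !mxE. Qed.

Lemma cmatrixZ (a : R) x : cm (a *: x) = Complex a 0 *: cm x.
Proof.
apply/matrixP => i j; rewrite [RHS]mxE !cmatrixE !mxE.
by apply: complexP; rewrite ?(cReM, cImM) /= mul0r ?subr0 ?addr0.
Qed.

Lemma cmatrix0 : cm 0 = 0.
Proof. by apply/matrixP => i j; rewrite cmatrixE !mxE. Qed.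

Lemma cmatrix_sum (I : Type) (r : seq I) (P : pred I) (F : I -> 'rV[R]_N) :
  cm (\sum_(i <- r | P i) F i) = \sum_(i <- r | P i) cm (F i).
Proof. exact: (big_morph _ cmatrixD cmatrix0). Qed.

Lemma smooth_cmatrix U : open U -> csmoothmx U cm.
Proof.
move=> oU i j; split.
  by apply: (smooth_eq oU _ (smooth_coord (lshift (2 * m) (mxvec_index i j)))) => z _;
    rewrite cmatrixE.
by apply: (smooth_eq oU _ (smooth_coord (rshift (2 * m) (mxvec_index i j)))) => z _;
  rewrite cmatrixE.
Qed.

Lemma derive_coord n (v z : 'rV[R]_n) k : 'D_v (fun x : 'rV[R]_n => x 0 k : R^o) z = v 0 k.
Proof.
have := @derive_mx R ('rV[R]_n) 1 n id z v (@derivable_id _ _ z v).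
by rewrite derive_id => /matrixP/(_ 0 k); rewrite mxE.
Qed.

Lemma cderive_cmatrix v z : cderivemx v cm z = cm v.
Proof.
apply/matrixP => i j; rewrite [LHS]mxE cmatrixE /cderive.
have -> : (fun x => Re (cm x i j) : R^o) = fun x => x 0 (lshift (2 * m) (mxvec_index i j)).
  by apply/funext => x; rewrite cmatrixE.
have -> : (fun x => Im (cm x i j) : R^o) = fun x => x 0 (rshift (2 * m) (mxvec_index i j)).
  by apply/funext => x; rewrite cmatrixE.
by rewrite !derive_coord.
Qed.

End CoordinatesC.

(** Compatibility of the connection with the metric, as a ring identity in which conjugates are
    independent letters: [P (X Zs + Z Xs) P] and [Q (Xs Z + Zs X) Q] stand for the derivatives of
    [P] and [Q] along [X]. Each of [M] and [Mh] has two expressions, one through [P] and one through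
    [Q], and each trace uses the one that fits. *)
Lemma trace_leibniz (F : comNzRingType) p q (P : 'M[F]_p) (Q : 'M[F]_q)
    (Z X Y : 'M[F]_(p, q)) (Zs Xs Ws M : 'M[F]_(q, p)) (Mh : 'M[F]_(p, q)) :
  M = Zs *m P -> M = Q *m Zs -> Mh = P *m Z -> Mh = Z *m Q ->
  \tr (P *m (X *m Zs + Z *m Xs) *m P *m Y *m Q *m Ws
       + P *m Y *m (Q *m (Xs *m Z + Zs *m X) *m Q) *m Ws) =
  \tr (P *m (X *m M *m Y + Y *m M *m X) *m Q *m Ws)
  + \tr (P *m Y *m Q *m (Ws *m Mh *m Xs + Xs *m Mh *m Ws)).
Proof.
move=> M1 M2 Mh1 Mh2.
have e1 : P *m X *m Zs *m P *m Y *m Q *m Ws = P *m X *m M *m Y *m Q *m Ws.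
  by rewrite M1 !mulmxA.
have e2 : P *m Y *m Q *m Zs *m X *m Q *m Ws = P *m Y *m M *m X *m Q *m Ws.
  by rewrite M2 !mulmxA.
have e3 : \tr (P *m Z *m Xs *m P *m Y *m Q *m Ws) = \tr (P *m Y *m Q *m Ws *m Mh *m Xs).
  rewrite Mh1 -[P *m Z *m Xs *m P *m Y *m Q *m Ws]mulmxA.
  rewrite -!(mulmxA (P *m Z *m Xs)) mxtrace_mulC !mulmxA; congr (\tr _).
have e4 : P *m Y *m Q *m Xs *m Z *m Q *m Ws = P *m Y *m Q *m Xs *m Mh *m Ws.
  by rewrite Mh2 !mulmxA.
rewrite !(mulmxDl, mulmxDr) !mxtraceD !mulmxA e1 e2 e3 e4; ring.
Qed.

(** [M X M + Xd] is the derivative of [M] along [X]. Its part [M X M] cancels against the commutator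
    of the connection, so only the terms with [Xd] and [Yd] survive. *)
Lemma curvature_cancel (F : comNzRingType) p q (X Y W : 'M[F]_(p, q)) (M Xd Yd : 'M[F]_(q, p)) :
  (Y *m (M *m X *m M + Xd) *m W + W *m (M *m X *m M + Xd) *m Y)
  - (X *m (M *m Y *m M + Yd) *m W + W *m (M *m Y *m M + Yd) *m X)
  + (X *m M *m (Y *m M *m W + W *m M *m Y) + (Y *m M *m W + W *m M *m Y) *m M *m X)
  - (Y *m M *m (X *m M *m W + W *m M *m X) + (X *m M *m W + W *m M *m X) *m M *m Y) =
  Y *m Xd *m W + W *m Xd *m Y - X *m Yd *m W - W *m Yd *m X.
Proof.
rewrite !(mulmxDl, mulmxDr) !mulmxA.
move: (Y *m M *m X *m M *m W) (W *m M *m X *m M *m Y) (X *m M *m Y *m M *m W)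
  (W *m M *m Y *m M *m X) (X *m M *m W *m M *m Y) (Y *m M *m W *m M *m X)
  (Y *m Xd *m W) (W *m Xd *m Y) (X *m Yd *m W) (W *m Yd *m X).
by move=> *; apply/matrixP => a b; rewrite !mxE; ring.
Qed.

Lemma trace_curvature (F : comNzRingType) p q (X Y : 'M[F]_(p, q)) (Xd Yd : 'M[F]_(q, p)) :
  \tr ((Y *m Xd *m Y + Y *m Xd *m Y - X *m Yd *m Y - Y *m Yd *m X) *m Xd) =
  \tr (Y *m Xd *m Y *m Xd) + \tr (Y *m Xd *m Y *m Xd)
  - \tr (X *m Yd *m Y *m Xd) - \tr (Y *m Yd *m X *m Xd).
Proof.
rewrite mulmxBl mulmxBl mulmxDl; move: (_ *m Xd) (_ *m Xd) (_ *m Xd) => A B C.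
by rewrite 2!linearB linearD.
Qed.

Lemma mxtrace_rot2 (F : comNzRingType) p q (A C : 'M[F]_(p, q)) (B D : 'M[F]_(q, p)) :
  \tr (A *m B *m C *m D) = \tr (C *m D *m A *m B).
Proof. by rewrite -mulmxA mxtrace_mulC !mulmxA. Qed.

Lemma trace_rotP (F : comNzRingType) p q (X : 'M[F]_(p, q)) (Ys : 'M[F]_(q, p))
    (P : 'M[F]_p) (Q : 'M[F]_q) :
  \tr (X *m (Q *m Ys *m P) *m X *m (Q *m Ys *m P)) =
  \tr (P *m X *m (Q *m Ys *m P) *m X *m (Q *m Ys)).
Proof. by rewrite !mulmxA mxtrace_mulC !mulmxA. Qed.

(** * The bounded symmetric domain *)

Section SymmetricDomainAlgebra.
Variables (R : realType) (m : nat) (Z : 'M[R[i]]_(2, m)).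
Implicit Types X Y W : 'M[R[i]]_(2, m).

Definition Pmx : 'M[R[i]]_2 := invmx (1%:M - Z *m ctrmx Z).
Definition Qmx : 'M[R[i]]_m := invmx (1%:M - ctrmx Z *m Z).
Definition Mmx : 'M[R[i]]_(m, 2) := ctrmx Z *m Pmx.

(* The metric at Z, as a form on complex matrices. *)
Definition gform X Y : R := Re (\tr (Pmx *m X *m Qmx *m ctrmx Y)).

Definition Gamma X Y := X *m Mmx *m Y + Y *m Mmx *m X.

(* The adjoint of X for the Hermitian metric at Z. *)
Definition dagger X : 'M[R[i]]_(m, 2) := Qmx *m ctrmx X *m Pmx.

Definition Rcurv X Y W : 'M[R[i]]_(2, m) :=
  Y *m dagger X *m W + W *m dagger X *m Y - X *m dagger Y *m W - W *m dagger Y *m X.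

Lemma gformDl X Y W : gform (X + Y) W = gform X W + gform Y W.
Proof. by rewrite /gform mulmxDr !mulmxDl mxtraceD cReD. Qed.

Lemma gformZl (a : R) X W : gform (Complex a 0 *: X) W = a * gform X W.
Proof.
by rewrite /gform -scalemxAr -!scalemxAl mxtraceZ cReM /= mul0r subr0.
Qed.

Lemma ctrmx_P : ctrmx Pmx = Pmx.
Proof. by rewrite /Pmx ctrmx_inv ctrmxD ctrmxN ctrmx1 ctrmxM ctrmxK. Qed.

Lemma ctrmx_Q : ctrmx Qmx = Qmx.
Proof. by rewrite /Qmx ctrmx_inv ctrmxD ctrmxN ctrmx1 ctrmxM ctrmxK. Qed.

Lemma gformC X Y : gform X Y = gform Y X.
Proof.
rewrite /gform -Re_tr_ctrmx !ctrmxM ctrmxK ctrmx_P ctrmx_Q.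
by rewrite mxtrace_mulC !mulmxA mxtrace_mulC !mulmxA mxtrace_mulC !mulmxA.
Qed.

Lemma gform_dagger A Y : gform A Y = Re (\tr (A *m dagger Y)).
Proof. by rewrite /gform /dagger -!mulmxA mxtrace_mulC !mulmxA. Qed.

Hypothesis uA : 1%:M - Z *m ctrmx Z \in unitmx.
Hypothesis uB : 1%:M - ctrmx Z *m Z \in unitmx.

(** [Z^*] intertwines [1 - Z Z^*] and [1 - Z^* Z], hence their inverses. *)
Lemma M_Q : Mmx = Qmx *m ctrmx Z.
Proof.
have e : (1%:M - ctrmx Z *m Z) *m ctrmx Z = ctrmx Z *m (1%:M - Z *m ctrmx Z).
  by rewrite mulmxBl mulmxBr mul1mx mulmx1 mulmxA.
by rewrite /Mmx /Pmx /Qmx -[LHS](mulKmx uB) [_ *m (ctrmx Z *m _)]mulmxA e -!mulmxA mulmxV ?mulmx1.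
Qed.

Lemma Q_P : Qmx = 1%:M + Mmx *m Z.
Proof.
rewrite M_Q -mulmxA; apply: (can_inj (mulKmx uB)); rewrite mulmxDr mulmx1.
by rewrite [_ *m (Qmx *m _)]mulmxA /Qmx mulmxV // mul1mx subrK.
Qed.

Lemma ctrmx_M : ctrmx Mmx = Pmx *m Z.
Proof. by rewrite /Mmx ctrmxM ctrmxK ctrmx_P. Qed.

Lemma Z_Q : Z *m Qmx = Pmx *m Z.
Proof. by rewrite -ctrmx_M M_Q ctrmxM ctrmxK ctrmx_Q. Qed.

Lemma Gamma_sym X Y : Gamma X Y = Gamma Y X.
Proof. by rewrite /Gamma addrC. Qed.

(** The derivative of [Pmx] along [X]: the sign produced by inversion cancels the one in
    [1 - Z Z^*]. *)
Definition dP X := Pmx *m (X *m ctrmx Z + Z *m ctrmx X) *m Pmx.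
Definition dQ X := Qmx *m (ctrmx X *m Z + ctrmx Z *m X) *m Qmx.

Lemma gform_derivative X Y W :
  Re (\tr (dP X *m Y *m Qmx *m ctrmx W + Pmx *m Y *m dQ X *m ctrmx W)) =
  gform (Gamma X Y) W + gform Y (Gamma X W).
Proof.
rewrite {2}/gform.
have -> : ctrmx (Gamma X W) = ctrmx W *m (Pmx *m Z) *m ctrmx X + ctrmx X *m (Pmx *m Z) *m ctrmx W.
  by rewrite /Gamma ctrmxD (ctrmxM (X *m Mmx) W) (ctrmxM X Mmx)
    (ctrmxM (W *m Mmx) X) (ctrmxM W Mmx) ctrmx_M !mulmxA.
rewrite (@trace_leibniz _ _ _ Pmx Qmx Z X Y (ctrmx Z) (ctrmx X) (ctrmx W) Mmx (Pmx *m Z)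
  erefl M_Q erefl (esym Z_Q)).
exact: cReD.
Qed.

Definition dM X := ctrmx X *m Pmx + ctrmx Z *m dP X.

(** Writing [Qmx] as [1 + Mmx Z] splits the product rule into the part that cancels in the curvature
    and the adjoint of [X]. *)
Lemma dM_E X : dM X = Mmx *m X *m Mmx + dagger X.
Proof.
rewrite /dM /dP /dagger Q_P /Mmx; move: Pmx => P.
rewrite !(mulmxDl, mulmxDr) mul1mx !mulmxA.
by rewrite addrCA.
Qed.

(* d_X Gamma(Y, W) - d_Y Gamma(X, W) + Gamma(X, Gamma(Y, W)) - Gamma(Y, Gamma(X, W)) *)
Lemma curvature_Gamma X Y W :
  (Y *m dM X *m W + W *m dM X *m Y) - (X *m dM Y *m W + W *m dM Y *m X)
  + Gamma X (Gamma Y W) - Gamma Y (Gamma X W) = Rcurv X Y W.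
Proof.
by rewrite !dM_E; exact: curvature_cancel.
Qed.

Definition sect X Y : R := gform (Rcurv X Y Y) X.

Lemma sectE X Y : sect X Y =
  2 * Re (\tr (Y *m dagger X *m Y *m dagger X))
  - Re (\tr (X *m dagger Y *m Y *m dagger X)) - Re (\tr (Y *m dagger Y *m X *m dagger X)).
Proof.
have ReE (a b c d : R[i]) : Re (a + b - c - d) = Re a + Re b - Re c - Re d.
  by rewrite !(cReD, cReN).
rewrite /sect gform_dagger (trace_curvature X Y (dagger X) (dagger Y)) ReE.
by rewrite mulrDl mul1r.
Qed.

(** Cyclicity matches the two mixed traces with their counterparts. For the first trace conjugate
    transposition, which preserves real parts, is needed as well. *)
Lemma sect_sym X Y : sect X Y = sect Y X.
Proof.
have e2 := congr1 (@complex.Re R) (mxtrace_rot2 X Y (dagger Y) (dagger X)).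
have e3 := congr1 (@complex.Re R) (mxtrace_rot2 Y X (dagger Y) (dagger X)).
suff e1 : Re (\tr (Y *m dagger X *m Y *m dagger X)) = Re (\tr (X *m dagger Y *m X *m dagger Y)).
  apply: (etrans (sectE X Y) (etrans _ (esym (sectE Y X)))).
  exact: (f_equal2 (fun a b => a - b)
    (f_equal2 (fun a b => a - b) (congr1 (fun t => 2 * t) e1) e2) e3).
have daggerJ : ctrmx (dagger X) = Pmx *m X *m Qmx.
  by rewrite /dagger (ctrmxM (Qmx *m ctrmx X) Pmx) (ctrmxM Qmx (ctrmx X)) ctrmxK
    ctrmx_P ctrmx_Q mulmxA.
have c : ctrmx (Y *m dagger X *m Y *m dagger X) =
    Pmx *m X *m (Qmx *m ctrmx Y *m Pmx) *m X *m (Qmx *m ctrmx Y).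
  rewrite (ctrmxM (Y *m dagger X *m Y) (dagger X)) (ctrmxM (Y *m dagger X) Y).
  by rewrite (ctrmxM Y (dagger X)) daggerJ; move: Pmx Qmx => P Q; rewrite !mulmxA.
apply: (etrans (esym (Re_tr_ctrmx _))).
exact: (congr1 (@complex.Re R) (etrans (congr1 mxtrace c)
  (esym (trace_rotP X (ctrmx Y) Pmx Qmx)))).
Qed.

Lemma sect_diag X : sect X X = 0.
Proof. by rewrite sectE; ring. Qed.

End SymmetricDomainAlgebra.

(** Obtained by differentiating [F^-1 F = 1]. *)
Lemma cderivemx_inv (R : realType) n p (U : set 'rV[R]_n) v (F : 'rV[R]_n -> 'M[R[i]]_p) u :
  open U -> csmoothmx U F -> (forall u, U u -> F u \in unitmx) -> U u ->
  cderivemx v (fun x => invmx (F x)) u =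
  - (invmx (F u) *m cderivemx v F u *m invmx (F u)).
Proof.
move=> oU sF uF Uu.
have dF := csmoothmx_cdiff sF Uu.
have dV := csmoothmx_cdiff (csmoothmx_inv oU uF sF) Uu.
have := cderivemx_mul v dV dF.
rewrite (cderivemx_eq v (H := fun=> 1%:M) oU _ Uu); last first.
  by move=> w Uw; rewrite mulVmx// uF.
rewrite cderivemx_cst => /esym/(congr1 (fun A => A *m invmx (F u))).
move: (cderivemx v (fun x => invmx (F x)) u) (cderivemx v F u) => A B.
rewrite mulmxDl mulmxK ?uF// mul0mx => /eqP; rewrite addr_eq0 => /eqP ->.
by [].
Qed.

Lemma mxunit_kermx0 (F : fieldType) n (A : 'M[F]_n) :
  (forall x : 'rV_n, x *m A = 0 -> x = 0) -> A \in unitmx.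
Proof.
move=> A0; rewrite -row_free_unit -kermx_eq0; apply/eqP/row_matrixP => i.
by rewrite row0; apply: A0; rewrite -row_mul mulmx_ker row0.
Qed.

Lemma Re_tr_gram_eq0 (R : realType) p q (A : 'M[R[i]]_(p, q)) :
  Re (\tr (A *m ctrmx A)) = 0 -> A = 0.
Proof.
have E : Re (\tr (A *m ctrmx A)) = \sum_i \sum_j (Re (A i j) ^+ 2 + Im (A i j) ^+ 2).
  rewrite cRe_sum; apply: eq_bigr => i _; rewrite mxE cRe_sum; apply: eq_bigr => j _.
  by rewrite !mxE cReM cReJ cImJ; ring.
rewrite E => /eqP; rewrite psumr_eq0; last first.
  by move=> i _; apply: sumr_ge0 => j _; rewrite addr_ge0 ?sqr_ge0.
move=> /allP A0; apply/matrixP => i j; rewrite mxE.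
have := A0 i (mem_index_enum _); rewrite psumr_eq0; last first.
  by move=> k _; rewrite addr_ge0 ?sqr_ge0.
move=> /allP/(_ j (mem_index_enum _)) /=.
rewrite paddr_eq0 ?sqr_ge0// !sqrf_eq0 => /andP[/eqP r0 /eqP i0].
exact: complexP.
Qed.

(** * Metric and connection of the Grassmannian *)

Section AmbientGeometry.
Variables (R : realType) (m : nat).
Notation N := (gr_dim m).
Notation cm := (@cmatrix R m).
Notation G := (@gr_metric R m).
Notation e_ a := (cm (delta_mx 0 a)).
Implicit Types (x y z : 'rV[R]_N).

(* An open set containing the domain on which the formula for the metric makes
   sense. *)
Definition regular_set : set 'rV[R]_N :=
  [set z | 1%:M - cm z *m ctrmx (cm z) \in unitmx /\
           1%:M - ctrmx (cm z) *m cm z \in unitmx].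

Lemma csmooth_neq0_open n (f : 'rV[R]_n -> R[i]) : csmooth setT f ->
  open [set z | f z != 0].
Proof.
move=> [f1 f2].
have := smooth_add openT (smooth_mul openT f1 f1) (smooth_mul openT f2 f2).
set h := (fun u => _ : R^o) => sh.
have -> : [set z | f z != 0] = h @^-1` [set x | x != 0].
  apply/seteqP; split => z /=; first exact: normsq_neq0.
  by apply: contraNneq; rewrite /h => ->; rewrite /= !mul0r addr0.
apply: open_comp; last exact: open_neq.
by move=> z _; apply: differentiable_continuous; exact: smooth_diff sh _.
Qed.

Lemma csmooth_A U : open U -> csmoothmx U (fun z => 1%:M - cm z *m ctrmx (cm z)).
Proof.
move=> oU; have sZ := smooth_cmatrix (R := R) (m := m) oU.
apply: (csmoothmx_add oU (csmoothmx_cst _ _)); apply: (csmoothmx_opp oU).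
exact: (csmoothmx_mul oU sZ (csmoothmx_ctr oU sZ)).
Qed.

Lemma csmooth_B U : open U -> csmoothmx U (fun z => 1%:M - ctrmx (cm z) *m cm z).
Proof.
move=> oU; have sZ := smooth_cmatrix (R := R) (m := m) oU.
apply: (csmoothmx_add oU (csmoothmx_cst _ _)); apply: (csmoothmx_opp oU).
exact: (csmoothmx_mul oU (csmoothmx_ctr oU sZ) sZ).
Qed.

Lemma open_regular_set : open regular_set.
Proof.
have -> : regular_set = [set z | \det (1%:M - cm z *m ctrmx (cm z)) != 0] `&`
    [set z | \det (1%:M - ctrmx (cm z) *m cm z) != 0].
  by apply/seteqP; split => z; rewrite /regular_set /= !unitmxE !unitfE.
apply: openI; apply: csmooth_neq0_open.
  exact: (csmooth_det openT (csmooth_A openT)).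
exact: (csmooth_det openT (csmooth_B openT)).
Qed.

Notation D := regular_set.
Notation oD := open_regular_set.

Lemma smooth_P : csmoothmx D (fun z => Pmx (cm z)).
Proof. by apply: (csmoothmx_inv oD _ (csmooth_A oD)) => z []. Qed.

Lemma smooth_Q : csmoothmx D (fun z => Qmx (cm z)).
Proof. by apply: (csmoothmx_inv oD _ (csmooth_B oD)) => z []. Qed.

Lemma cdiff_cmatrix z : cdiffmx cm z.
Proof. exact: (csmoothmx_cdiff (smooth_cmatrix (R := R) (m := m) openT)). Qed.

Lemma cdiff_ctr_cmatrix z : cdiffmx (fun x => ctrmx (cm x)) z.
Proof.
exact: (csmoothmx_cdiff (csmoothmx_ctr openT (smooth_cmatrix (R := R) (m := m) openT))).
Qed.

Lemma cderive_ctr_cmatrix v z : cderivemx v (fun x => ctrmx (cm x)) z = ctrmx (cm v).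
Proof. by rewrite (cderivemx_ctr v (cdiff_cmatrix z)) cderive_cmatrix. Qed.

Lemma cderive_P v z : D z -> cderivemx v (fun x => Pmx (cm x)) z = dP (cm z) (cm v).
Proof.
move=> Dz; rewrite (cderivemx_inv v oD (csmooth_A oD) _ Dz); last by move=> u [].
have dZZ := csmoothmx_cdiff (csmoothmx_mul openT (smooth_cmatrix (R := R) (m := m) openT)
  (csmoothmx_ctr openT (smooth_cmatrix (R := R) (m := m) openT))) (I : setT z).
have dN := csmoothmx_cdiff (csmoothmx_opp openT (csmoothmx_mul openT
  (smooth_cmatrix (R := R) (m := m) openT)
  (csmoothmx_ctr openT (smooth_cmatrix (R := R) (m := m) openT)))) (I : setT z).
rewrite (cderivemx_add v (csmoothmx_cdiff (csmoothmx_cst setT _) I) dN) cderivemx_cst add0r.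
rewrite (cderivemx_opp v dZZ) (cderivemx_mul v (cdiff_cmatrix z) (cdiff_ctr_cmatrix z)).
by rewrite cderive_cmatrix cderive_ctr_cmatrix mulmxN mulNmx opprK.
Qed.

Lemma cderive_Q v z : D z -> cderivemx v (fun x => Qmx (cm x)) z = dQ (cm z) (cm v).
Proof.
move=> Dz; rewrite (cderivemx_inv v oD (csmooth_B oD) _ Dz); last by move=> u [].
have dZZ := csmoothmx_cdiff (csmoothmx_mul openT (csmoothmx_ctr openT
  (smooth_cmatrix (R := R) (m := m) openT)) (smooth_cmatrix (R := R) (m := m) openT)) (I : setT z).
have dN := csmoothmx_cdiff (csmoothmx_opp openT (csmoothmx_mul openT (csmoothmx_ctr openT
  (smooth_cmatrix (R := R) (m := m) openT)) (smooth_cmatrix (R := R) (m := m) openT))) (I : setT z).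
rewrite (cderivemx_add v (csmoothmx_cdiff (csmoothmx_cst setT _) I) dN) cderivemx_cst add0r.
rewrite (cderivemx_opp v dZZ) (cderivemx_mul v (cdiff_ctr_cmatrix z) (cdiff_cmatrix z)).
by rewrite cderive_cmatrix cderive_ctr_cmatrix mulmxN mulNmx opprK.
Qed.

Lemma smooth_gr_metric : smooth_on D G.
Proof.
apply/(smooth_mxP _ oD) => a b.
have sPQ := csmoothmx_mul oD (csmoothmx_mul oD (csmoothmx_mul oD smooth_P
  (csmoothmx_cst D (e_ a))) smooth_Q) (csmoothmx_cst D (ctrmx (e_ b))).
have [s _] := csmooth_sum oD (index_enum 'I_2) xpredT (fun i => sPQ i i).
by apply: (smooth_eq oD _ s) => z _; rewrite mxE.
Qed.

Lemma gform_suml z (I : finType) (c : I -> R) (F : I -> 'M[R[i]]_(2, m)) Y :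
  gform (cm z) (\sum_i Complex (c i) 0 *: F i) Y = \sum_i c i * gform (cm z) (F i) Y.
Proof.
elim: (index_enum I) => [|i s IH]; first by rewrite !big_nil /gform mulmx0 !mul0mx mxtrace0.
by rewrite !big_cons gformDl gformZl IH.
Qed.

Lemma cmatrix_expand x : cm x = \sum_a Complex (x 0 a) 0 *: e_ a.
Proof.
rewrite {1}(row_sum_delta x) cmatrix_sum; apply: eq_bigr => a _.
by rewrite cmatrixZ.
Qed.

Lemma inner_gr_metric z x y : inner (G z) x y = gform (cm z) (cm x) (cm y).
Proof.
rewrite (cmatrix_expand x) gform_suml.
rewrite (_ : inner _ _ _ = \sum_a x 0 a * \sum_b y 0 b * G z a b).
  apply: eq_bigr => a _; congr (_ * _); rewrite gformC (cmatrix_expand y) gform_suml.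
  by apply: eq_bigr => b _; rewrite gformC [G z a b]mxE.
rewrite /inner -mulmxA mxE; apply: eq_bigr => a _; congr (_ * _).
by rewrite mxE; apply: eq_bigr => b _; rewrite [y^T _ _]mxE mulrC.
Qed.

Lemma inner_delta n (S : 'M[R]_n) a b : inner S (delta_mx 0 a) (delta_mx 0 b) = S a b.
Proof. by rewrite /inner -rowE trmx_delta -colE !mxE. Qed.

Lemma sym_gr_metric z : (G z)^T = G z.
Proof.
apply/matrixP => a b; rewrite [LHS]mxE -(inner_delta (G z) b a) -(inner_delta (G z) a b).
by rewrite !inner_gr_metric gformC. Qed.

(** On [regular_set] the matrices [Pmx] and [Qmx] are invertible but need not be positive. A vector
    [x] of the kernel is therefore tested against [P x Q], on which the form is the squared norm of
    [P x Q]. *)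
Lemma unit_gr_metric z : D z -> G z \in unitmx.
Proof.
move=> [uA uB]; apply: mxunit_kermx0 => x xG.
have uP : Pmx (cm z) \in unitmx by rewrite unitmx_inv.
have uQ : Qmx (cm z) \in unitmx by rewrite unitmx_inv.
have gx Y : gform (cm z) (cm x) Y = 0.
  by rewrite -[Y]rmatrixK -inner_gr_metric /inner xG mul0mx mxE.
have := Re_tr_gram_eq0 (gx (Pmx (cm z) *m cm x *m Qmx (cm z))).
move=> /(congr1 (fun A => A *m invmx (Qmx (cm z)))); rewrite mulmxK// mul0mx.
move=> /(congr1 (fun A => invmx (Pmx (cm z)) *m A)); rewrite mulKmx// mulmx0.
by move=> /(congr1 (@rmatrix R m)); rewrite cmatrixK -(cmatrix0 R m) cmatrixK.
Qed.

Lemma dmetric_gr a b c z : D z -> dmetric G a b c z =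
  gform (cm z) (Gamma (cm z) (e_ a) (e_ b)) (e_ c)
  + gform (cm z) (e_ b) (Gamma (cm z) (e_ a) (e_ c)).
Proof.
move=> Dz; have [uA uB] := Dz; rewrite -gform_derivative//.
have dPz := csmoothmx_cdiff smooth_P Dz; have dQz := csmoothmx_cdiff smooth_Q Dz.
have dk p q (A : 'M[R[i]]_(p, q)) := csmoothmx_cdiff (csmoothmx_cst D A) Dz.
have dPY := csmoothmx_cdiff (csmoothmx_mul oD smooth_P (csmoothmx_cst D (e_ b))) Dz.
have dPYQ := csmoothmx_cdiff (csmoothmx_mul oD (csmoothmx_mul oD smooth_P
  (csmoothmx_cst D (e_ b))) smooth_Q) Dz.
have dall := csmoothmx_cdiff (csmoothmx_mul oD (csmoothmx_mul oD (csmoothmx_mul oD smooth_P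
  (csmoothmx_cst D (e_ b))) smooth_Q) (csmoothmx_cst D (ctrmx (e_ c)))) Dz.
have E : (fun z => G z b c : R^o) =
    fun z => Re (\tr (Pmx (cm z) *m e_ b *m Qmx (cm z) *m ctrmx (e_ c))).
  by apply/funext => u; rewrite mxE.
rewrite /dmetric /pder E (derive_Re_tr _ dall); congr (Re (\tr _)).
rewrite (cderivemx_mul _ dPYQ (dk _ _ (ctrmx (e_ c)))) cderivemx_cst mulmx0 addr0.
rewrite (cderivemx_mul _ dPY dQz) (cderivemx_mul _ dPz (dk _ _ (e_ b))).
by rewrite cderivemx_cst mulmx0 addr0 mulmxDl (cderive_P _ Dz) (cderive_Q _ Dz).
Qed.

(** [Gamma] is symmetric and compatible with the metric; inserting [dmetric_gr] into the Koszul
    formula cancels everything but [Gamma]. *)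
Lemma chr_gr a z x : D z -> cm (x *m chr G a z) = Gamma (cm z) (e_ a) (cm x).
Proof.
move=> Dz; have sG := smooth_gr_metric; have [uA uB] := Dz.
have row_chr b : row b (chr G a z) = rmatrix (Gamma (cm z) (e_ a) (e_ b)).
  apply: (can_inj (mulmxK (unit_gr_metric Dz))); apply/rowP => c.
  have -> : (row b (chr G a z) *m G z) 0 c = (chr G a z *m G z) b c.
    by rewrite -row_mul mxE.
  rewrite (koszul (fun u (_ : D u) => sym_gr_metric u) unit_gr_metric a b c Dz).
  have -> : (rmatrix (Gamma (cm z) (e_ a) (e_ b)) *m G z) 0 c =
      gform (cm z) (Gamma (cm z) (e_ a) (e_ b)) (e_ c).
    have := inner_gr_metric z (rmatrix (Gamma (cm z) (e_ a) (e_ b))) (delta_mx 0 c).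
    by rewrite rmatrixK => <-; rewrite /inner trmx_delta -colE [RHS]mxE.
  rewrite !dmetric_gr// (Gamma_sym _ (e_ b) (e_ a)) (Gamma_sym _ (e_ c) (e_ a)).
  rewrite (Gamma_sym _ (e_ c) (e_ b)).
  have cancel (t1 t2 t3 t4 : R) : t2 = t3 -> 2^-1 * (t1 + t2 + (t1 + t4) - (t3 + t4)) = t1.
    by move=> ->; field.
  exact: cancel (gformC _ _ _).
rewrite mulmx_sum_row cmatrix_sum [in RHS](cmatrix_expand x).
have GammaZ (I : finType) (c : I -> R) (F : I -> 'M[R[i]]_(2, m)) X :
    Gamma (cm z) X (\sum_i Complex (c i) 0 *: F i) =
    \sum_i Complex (c i) 0 *: Gamma (cm z) X (F i).
  rewrite /Gamma mulmx_sumr !mulmx_suml -big_split /=; apply: eq_bigr => i _.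
  by rewrite -scalemxAr -!scalemxAl scalerDr.
rewrite GammaZ; apply: eq_bigr => b _.
by rewrite row_chr cmatrixZ rmatrixK.
Qed.

End AmbientGeometry.

(** * Curvature in matrix form *)

Section AmbientCurvature.
Variables (R : realType) (m : nat).
Notation N := (gr_dim m).
Notation cm := (@cmatrix R m).
Notation G := (@gr_metric R m).
Notation D := (@regular_set R m).
Notation oD := (@open_regular_set R m).
Notation e_ a := (cm (delta_mx 0 a)).
Implicit Types (x y z w : 'rV[R]_N) (X Y : 'M[R[i]]_(2, m)).

Lemma cmatrix_derive v (F : 'rV[R]_N -> 'rV[R]_N) z : differentiable F z ->
  cm ('D_v F z) = cderivemx v (fun x => cm (F x)) z.
Proof.
move=> dF; apply/matrixP => i j; rewrite [RHS]mxE cmatrixE.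
rewrite (derive_entry v 0 (lshift _ _) dF) (derive_entry v 0 (rshift _ _) dF) /cderive.
have -> : (fun x => Re (cm (F x) i j) : R^o) =
    fun x => F x 0 (lshift (2 * m) (mxvec_index i j)).
  by apply/funext => x; rewrite cmatrixE.
have -> : (fun x => Im (cm (F x) i j) : R^o) =
    fun x => F x 0 (rshift (2 * m) (mxvec_index i j)).
  by apply/funext => x; rewrite cmatrixE.
by [].
Qed.

Lemma smooth_M : csmoothmx D (fun z => Mmx (cm z)).
Proof.
exact: (csmoothmx_mul oD (csmoothmx_ctr oD (smooth_cmatrix oD)) (@smooth_P R m)).
Qed.

Lemma cderive_M v z : D z -> cderivemx v (fun x => Mmx (cm x)) z = dM (cm z) (cm v).
Proof.
move=> Dz; rewrite (cderivemx_mul v (cdiff_ctr_cmatrix z)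
  (csmoothmx_cdiff (@smooth_P R m) Dz)).
by rewrite cderive_ctr_cmatrix (cderive_P v Dz).
Qed.

Lemma cderive_Gamma v z Y X : D z ->
  cderivemx v (fun x => Gamma (cm x) Y X) z =
  Y *m dM (cm z) (cm v) *m X + X *m dM (cm z) (cm v) *m Y.
Proof.
move=> Dz; have sM := smooth_M.
have half (A B : 'M[R[i]]_(2, m)) :
    cdiffmx (fun x => A *m Mmx (cm x) *m B) z /\
    cderivemx v (fun x => A *m Mmx (cm x) *m B) z = A *m dM (cm z) (cm v) *m B.
  have sA := csmoothmx_cst D A; have sB := csmoothmx_cst D B.
  have sAM := csmoothmx_mul oD sA sM.
  split; first exact: csmoothmx_cdiff (csmoothmx_mul oD sAM sB) Dz.
  rewrite (cderivemx_mul v (csmoothmx_cdiff sAM Dz) (csmoothmx_cdiff sB Dz)).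
  rewrite (cderivemx_mul v (csmoothmx_cdiff sA Dz) (csmoothmx_cdiff sM Dz)).
  by rewrite !cderivemx_cst mul0mx mulmx0 add0r addr0 (cderive_M v Dz).
have [d1 E1] := half Y X; have [d2 E2] := half X Y.
by rewrite /Gamma (cderivemx_add v d1 d2) E1 E2.
Qed.

Lemma cmatrixN x : cm (- x) = - cm x.
Proof. by apply/eqP; rewrite -addr_eq0 -cmatrixD addNr cmatrix0. Qed.

(** Under [cmatrix], right multiplication by [chr] becomes [Gamma]; the curvature matrix turns into
    derivatives of [Gamma] plus its commutator, which [curvature_Gamma] evaluates. *)
Lemma riemann_gr a b w z : D z ->
  cm (w *m riemann_mx G a b z) = Rcurv (cm z) (e_ a) (e_ b) (cm w).
Proof.
move=> Dz; have [uA uB] := Dz; have sG := @smooth_gr_metric R m.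
have uG := @unit_gr_metric R m.
rewrite (riemann_mxE oD sG uG a b Dz) mulmxBr mulmxDr mulmxBr !mulmxA.
have dchr c d : cm (w *m pder c (chr G d) z) =
    e_ d *m dM (cm z) (e_ c) *m cm w + cm w *m dM (cm z) (e_ c) *m e_ d.
  have dd := smooth_diff (smooth_chr oD sG uG d) Dz.
  have dw : differentiable (fun=> w : 'rV[R]_N) z by exact: differentiable_cst.
  have E : w *m pder c (chr G d) z = 'D_(delta_mx 0 c) (fun x => w *m chr G d x) z.
    rewrite (derive_mulmx _ dw dd) derive_cst.
    by rewrite mul0mx add0r.
  rewrite E (cmatrix_derive _ (differentiable_mulmx dw dd)).
  rewrite (cderivemx_eq _ (H := fun x => Gamma (cm x) (e_ d) (cm w)) oD _ Dz).
    exact: cderive_Gamma.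
  by move=> u Du; exact: chr_gr.
move: (dchr a b) (dchr b a); move: (pder a (chr G b) z) (pder b (chr G a) z) => A B dA dB.
rewrite (cmatrixD (w *m A - w *m B + _)) (cmatrixD (w *m A - w *m B)) (cmatrixD (w *m A)).
rewrite (cmatrixN (w *m B)) (cmatrixN (w *m _ *m _)) dA dB.
rewrite (chr_gr a (w *m chr G b z) Dz) (chr_gr b w Dz).
rewrite (chr_gr b (w *m chr G a z) Dz) (chr_gr a w Dz).
exact: (curvature_Gamma uA uB (e_ a) (e_ b) (cm w)).
Qed.

(** The coefficients are real, [dagger] being conjugate-linear over the complex numbers. *)
Lemma dagger_sum z (I : finType) (c : I -> R) (F : I -> 'M[R[i]]_(2, m)) :
  dagger (cm z) (\sum_i Complex (c i) 0 *: F i) = \sum_i Complex (c i) 0 *: dagger (cm z) (F i).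
Proof.
rewrite /dagger; move: (Pmx _) (Qmx _) => P Q.
elim: (index_enum I) => [|i s IH].
  by rewrite !big_nil /ctrmx trmx0 map_mx0 mulmx0 mul0mx.
rewrite !big_cons -IH ctrmxD ctrmxZ mulmxDr mulmxDl -scalemxAr -scalemxAl.
by rewrite /conjc oppr0.
Qed.

Lemma Rcurv_suml z (I : finType) (c : I -> R) (F : I -> 'M[R[i]]_(2, m)) Y W :
  Rcurv (cm z) (\sum_i Complex (c i) 0 *: F i) Y W =
  \sum_i Complex (c i) 0 *: Rcurv (cm z) (F i) Y W.
Proof.
rewrite /Rcurv dagger_sum; move: (dagger (cm z)) => d.
rewrite !(mulmx_suml, mulmx_sumr) -big_split -!sumrB /=.
apply: eq_bigr => i _.
by rewrite -!scalemxAr -!scalemxAl !scalerBr scalerDr.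
Qed.

Lemma RcurvN z X Y W : Rcurv (cm z) X Y W = - Rcurv (cm z) Y X W.
Proof.
have swap (V : zmodType) (a b c d : V) : a + b - c - d = - (c + d - a - b).
  by rewrite -!addrA -!opprD !addrA opprB.
exact: swap.
Qed.

Lemma Rcurv_sumr z (I : finType) (c : I -> R) (F : I -> 'M[R[i]]_(2, m)) X W :
  Rcurv (cm z) X (\sum_i Complex (c i) 0 *: F i) W =
  \sum_i Complex (c i) 0 *: Rcurv (cm z) X (F i) W.
Proof.
rewrite RcurvN Rcurv_suml -sumrN; apply: eq_bigr => i _.
by rewrite -scalerN -RcurvN.
Qed.

Lemma curvature_gr z x y w : D z ->
  cm (curvature G z x y w) = Rcurv (cm z) (cm x) (cm y) (cm w).
Proof.
move=> Dz; rewrite curvatureE mulmx_sumr cmatrix_sum.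
rewrite [in RHS](cmatrix_expand x) Rcurv_suml; apply: eq_bigr => a _.
rewrite mulmx_sumr cmatrix_sum [in RHS](cmatrix_expand y) Rcurv_sumr scaler_sumr.
apply: eq_bigr => b _; rewrite -scalemxAr cmatrixZ riemann_gr// scalerA.
by congr (_ *: _); apply: complexP; rewrite ?(cReM, cImM) /=; ring.
Qed.

Lemma sectional_gr z x y : D z -> sectional G z x y = sect (cm z) (cm x) (cm y).
Proof. by move=> Dz; rewrite /sectional inner_gr_metric curvature_gr. Qed.

End AmbientCurvature.

(** * The Einstein constant *)

Section RicciTrace.
Variables (R : realType) (m : nat).
Notation N := (gr_dim m).
Notation cm := (@cmatrix R m).
Notation e_ a := (cm (delta_mx 0 a)).
Implicit Types (X Y : 'M[R[i]]_(2, m)).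

Lemma mxvec_index_inj p q (i i' : 'I_p) (j j' : 'I_q) :
  (mxvec_index i j == mxvec_index i' j') = (i == i') && (j == j').
Proof.
apply/eqP/andP => [|[/eqP-> /eqP->]//].
by move=> /cast_ord_inj/enum_rank_inj[-> ->].
Qed.

Lemma cmatrix_lshift i j : e_ (lshift (2 * m) (mxvec_index i j)) = delta_mx i j.
Proof.
apply/matrixP => k l; rewrite cmatrixE !mxE eqxx /= eq_lshift eq_rlshift mxvec_index_inj.
by case: (_ && _).
Qed.

Lemma cmatrix_rshift i j :
  e_ (rshift (2 * m) (mxvec_index i j)) = Complex 0 1 *: (delta_mx i j : 'M[R[i]]_(2, m)).
Proof.
apply/matrixP => k l; rewrite cmatrixE !mxE eqxx /= eq_rshift eq_lrshift mxvec_index_inj.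
by case: (_ && _); rewrite ?mulr1 ?mulr0.
Qed.

(** The trace is taken over elementary matrices and their multiples by [i]. A complex-linear [L]
    contributes twice the real part of its complex trace, an antilinear one contributes zero. *)
Lemma trace_real (T : 'M[R]_N) (L : 'M[R[i]]_(2, m) -> 'M[R[i]]_(2, m)) :
  (forall a, delta_mx 0 a *m T = rmatrix (L (e_ a))) ->
  \tr T = \sum_i \sum_j (Re (L (delta_mx i j) i j)
                         + Im (L (Complex 0 1 *: delta_mx i j) i j)).
Proof.
move=> TL; rewrite /mxtrace big_split_ord /=.
have TE a : T a a = rmatrix (L (e_ a)) 0 a by rewrite -TL -rowE mxE.
have mxvec_sum (F : 'I_(2 * m) -> R) : \sum_k F k = \sum_i \sum_j F (mxvec_index i j).
  by rewrite (reindex _ (curry_mxvec_bij 2 m)) pair_bigA /=; apply: eq_bigr => -[].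
rewrite !mxvec_sum -big_split /=; apply: eq_bigr => i _.
rewrite -big_split /=; apply: eq_bigr => j _.
rewrite !TE cmatrix_lshift cmatrix_rshift /rmatrix.
by rewrite row_mxEl row_mxEr !mxvecE !mxE.
Qed.

Lemma sum_delta_mulr p q (B : 'M[R[i]]_q) :
  \sum_(i < p) \sum_(j < q) ((delta_mx i j : 'M[R[i]]_(p, q)) *m B) i j = p%:R * \tr B.
Proof.
transitivity (\sum_(i < p) \tr B); last by rewrite sumr_const card_ord mulr_natl.
apply: eq_bigr => i _; apply: eq_bigr => j _.
rewrite mxE (bigD1 j)//= mxE !eqxx mul1r big1 ?addr0// => k kj.
by rewrite mxE (negPf kj) andbF mul0r.
Qed.

Lemma sum_delta_mull p q (A : 'M[R[i]]_p) :
  \sum_(i < p) \sum_(j < q) (A *m (delta_mx i j : 'M[R[i]]_(p, q))) i j = q%:R * \tr A.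
Proof.
rewrite exchange_big /=.
transitivity (\sum_(j < q) \tr A); last by rewrite sumr_const card_ord mulr_natl.
apply: eq_bigr => j _; apply: eq_bigr => i _.
rewrite mxE (bigD1 i)//= mxE !eqxx mulr1 big1 ?addr0// => k ki.
by rewrite mxE (negPf ki) mulr0.
Qed.

Lemma ricci_trace (Z Y : 'M[R[i]]_(2, m)) (T : 'M[R]_N) :
  (forall a, delta_mx 0 a *m T = rmatrix (Rcurv Z (e_ a) Y Y)) ->
  \tr T = - (2 * m%:R + 4) * gform Z Y Y.
Proof.
move=> TL; rewrite (trace_real (L := fun X => Rcurv Z X Y Y) TL).
set A := Y *m dagger Z Y; set B := dagger Z Y *m Y.
(* [C1] is the antilinear term: its contributions from a basis vector and from [i] times that vector
   cancel. Those of the complex-linear terms [C2] and [C3] add up, whence the factor [2]. *)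
have entry (C1 C2 C3 : 'M[R[i]]_(2, m)) i j :
    Re ((C1 + C1 - C2 - C3) i j) + Im ((- Complex 0 1 *: (C1 + C1 + C2 + C3)) i j) =
    - 2 * Re (C2 i j + C3 i j).
  rewrite !mxE; move: (C1 i j) (C2 i j) (C3 i j) => c1 c2 c3.
  by rewrite !(cReD, cImD, cReN, cImN, cReM, cImM) /=; ring.
have Ec i j : Re (Rcurv Z (delta_mx i j) Y Y i j) +
    Im (Rcurv Z (Complex 0 1 *: delta_mx i j) Y Y i j) =
    - 2 * Re ((delta_mx i j *m B) i j + (A *m delta_mx i j) i j).
  have -> : Rcurv Z (Complex 0 1 *: delta_mx i j) Y Y = - Complex 0 1 *:
      (Y *m dagger Z (delta_mx i j) *m Y + Y *m dagger Z (delta_mx i j) *m Y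
       + delta_mx i j *m dagger Z Y *m Y + Y *m dagger Z Y *m delta_mx i j).
    have dN : dagger Z (Complex 0 1 *: delta_mx i j) = - Complex 0 1 *: dagger Z (delta_mx i j).
      rewrite /dagger ctrmxZ; move: (Pmx Z) (Qmx Z) => P Q.
      rewrite -scalemxAr -scalemxAl; congr (_ *: _).
      by apply: complexP => /=; rewrite ?oppr0.
    rewrite /Rcurv dN; move: (dagger Z (delta_mx i j)) (dagger Z Y) (delta_mx i j) => d d' E.
    by rewrite -!scalemxAr -!scalemxAl !scaleNr !scalerDr !opprD.
  rewrite /Rcurv /A /B !mulmxA; move: (delta_mx i j *m dagger Z Y *m Y) (Y *m dagger Z Y *m delta_mx i j)
    (Y *m dagger Z (delta_mx i j) *m Y) => C2 C3 C1.
  exact: entry.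
under eq_bigr => i _ do under eq_bigr => j _ do rewrite Ec.
under eq_bigr => i _ do rewrite -mulr_sumr -cRe_sum big_split /=.
(* Multiplication by [B] on the right has trace [2 tr B], multiplication by [A] on the left
   [m tr A], and both traces agree, whence [2 (m + 2)]. *)
rewrite -mulr_sumr -cRe_sum big_split /= sum_delta_mulr sum_delta_mull.
have -> : \tr B = \tr A by rewrite /A /B mxtrace_mulC.
rewrite gform_dagger -/A -mulrDl -natrD.
have ReM_nat k (c : R[i]) : Re (k%:R * c) = k%:R * Re c.
  by elim: k => [|k IH]; rewrite ?mul0r// -natr1 mulrDl mul1r cReD IH -natr1 mulrDl mul1r.
rewrite ReM_nat natrD; ring.
Qed.

End RicciTrace.

(** * Positivity of the metric *)

Section PositiveDefinite.
Variables (R : realType).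

Lemma pos_def_unit p (A : 'M[R[i]]_p) : pos_def A -> A \in unitmx.
Proof.
move=> pA; apply: mxunit_kermx0 => v vA; apply/eqP; apply/negPn/negP => v0.
by have := pA v v0; rewrite vA mul0mx mxE ltxx.
Qed.

Lemma pos_def_inv p (A : 'M[R[i]]_p) : ctrmx A = A -> pos_def A -> pos_def (invmx A).
Proof.
move=> hA pA v v0; have uA := pos_def_unit pA.
have w0 : v *m invmx A != 0.
  apply: contraNneq v0 => e; apply/eqP.
  by rewrite -[v](mulmxKV uA) e mul0mx.
by have := pA _ w0; rewrite (mulmxKV uA) (ctrmxM v) ctrmx_inv hA mulmxA.
Qed.

Lemma ctrmx_conj p q (A : 'M[R[i]]_(p, q)) : ctrmx A = map_mx Num.conj A^T.
Proof. by apply/matrixP => i j; rewrite !mxE. Qed.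

(* Diagonalizing P unitarily turns the trace into a positive combination of values
   of the form Q. *)
Lemma trace_pos_def p q (P : 'M[R[i]]_p) (Q : 'M[R[i]]_q) (X : 'M[R[i]]_(p, q)) :
  ctrmx P = P -> pos_def P -> pos_def Q -> X != 0 -> 0 < \tr (P *m X *m Q *m ctrmx X).
Proof.
move=> hP pP pQ X0.
have nP : P \is normalmx by apply/normalmxP; rewrite -ctrmx_conj hP.
have PE := orthomx_spectralP nP; have uV := spectral_unitarymx P.
move: PE; rewrite (invmx_unitary uV) -ctrmx_conj.
have {uV} VV : spectralmx P *m ctrmx (spectralmx P) = 1%:M.
  by rewrite ctrmx_conj; exact/unitarymxP.
move: (spectralmx P) (spectral_diag P) VV => V d VV PE.
have dE i : d 0 i = (row i V *m P *m ctrmx (row i V)) 0 0.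
  have -> : (row i V *m P *m ctrmx (row i V)) 0 0 = (V *m P *m ctrmx V) i i.
    by rewrite -row_mul !mxE; apply: eq_bigr => k _; rewrite !mxE.
  by rewrite PE !mulmxA VV mul1mx -mulmxA VV mulmx1 mxE eqxx.
have V0 i : row i V != 0.
  apply/eqP => r0; have := congr1 (fun A : 'M[R[i]]_p => row i A) VV.
  rewrite row_mul r0 mul0mx => /rowP/(_ i); rewrite !mxE eqxx => /eqP.
  by rewrite eq_sym oner_eq0.
have d0 i : 0 < d 0 i by rewrite dE; exact: pP.
have -> : \tr (P *m X *m Q *m ctrmx X) =
    \sum_i d 0 i * (row i (V *m X) *m Q *m ctrmx (row i (V *m X))) 0 0.
  rewrite PE -!mulmxA mxtrace_mulC -!mulmxA.
  apply: eq_bigr => i _; rewrite mul_diag_mx mxE; congr (_ * _).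
  rewrite -row_mul -!mulmxA -ctrmxM !mulmxA.
  by rewrite !mxE; apply: eq_bigr => k _; rewrite !mxE.
have VX0 : V *m X != 0.
  apply: contraNneq X0 => e; apply/eqP.
  by rewrite -[X]mul1mx -(mulmx1C VV) -mulmxA e mulmx0.
have [i ri] : exists i, row i (V *m X) != 0.
  apply/existsP; apply: contraNT VX0 => /existsPn r0; apply/eqP/row_matrixP => i.
  by rewrite row0; apply/eqP; have := r0 i; rewrite negbK.
have ge0 j : 0 <= d 0 j * (row j (V *m X) *m Q *m ctrmx (row j (V *m X))) 0 0.
  apply: mulr_ge0; first exact: ltW.
  have [->|rj] := eqVneq (row j (V *m X)) 0.
    by rewrite !mul0mx mxE.
  by rewrite ltW// pQ.
rewrite (bigD1 i)//= ltr_wpDr ?sumr_ge0//.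
by rewrite mulr_gt0 ?pQ.
Qed.

Lemma ctrmx_1B p q (A : 'M[R[i]]_(p, q)) : ctrmx (1%:M - A *m ctrmx A) = 1%:M - A *m ctrmx A.
Proof. by rewrite ctrmxD ctrmxN ctrmx1 ctrmxM ctrmxK. Qed.

End PositiveDefinite.

Section DomainPositivity.
Variables (R : realType) (m : nat) (z : 'rV[R]_(gr_dim m)).
Hypothesis Dz : @gr_domain R m z.
Notation Z := (cmatrix z).

(** Membership in the domain is positivity of [1 - Z Z^*]; this explicit inverse carries
    invertibility over to [1 - Z^* Z]. *)
Lemma domain_inverse :
  (1%:M - ctrmx Z *m Z) *m (1%:M + ctrmx Z *m Pmx Z *m Z) = 1%:M.
Proof.
have uA := pos_def_unit Dz; have PA : (1%:M - Z *m ctrmx Z) *m Pmx Z = 1%:M by rewrite mulmxV.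
move: (Pmx Z) PA; move: (cmatrix z) (ctrmx Z) => W Ws P PA.
rewrite mulmxDr mulmx1 !mulmxA.
have -> : (1%:M - Ws *m W) *m Ws *m P *m W = Ws *m ((1%:M - W *m Ws) *m P) *m W.
  by rewrite !mulmxA mulmxBl mulmxBr mul1mx mulmx1 !mulmxA.
by rewrite PA mulmx1 subrK.
Qed.

Lemma domain_regular : regular_set z.
Proof.
split; first exact: pos_def_unit Dz.
by have [] := mulmx1_unit domain_inverse.
Qed.

Lemma pos_def_P : pos_def (Pmx Z).
Proof. by apply: pos_def_inv Dz; exact: ctrmx_1B. Qed.

(** By [domain_inverse], [Qmx] is the identity plus a pull-back of the positive form [Pmx]. *)
Lemma pos_def_Q : pos_def (Qmx Z).
Proof.
have -> : Qmx Z = 1%:M + ctrmx Z *m Pmx Z *m Z.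
  have uB := domain_regular.2.
  by rewrite -[RHS](mulKmx uB) domain_inverse mulmx1.
move=> v v0; rewrite mulmxDr mulmxDl mulmx1 mxE ltr_wpDr//.
  have -> : v *m (ctrmx Z *m Pmx Z *m Z) *m ctrmx v =
      (v *m ctrmx Z) *m Pmx Z *m ctrmx (v *m ctrmx Z).
    by rewrite (ctrmxM v) ctrmxK !mulmxA.
  have [->|w0] := eqVneq (v *m ctrmx Z) 0; first by rewrite !mul0mx mxE.
  exact: ltW (pos_def_P w0).
have vv i : 0 <= v 0 i * ctrmx v i 0 by rewrite !mxE mulcJ_ge0.
rewrite mxE lt_def sumr_ge0// andbT psumr_eq0//.
apply: contraNN v0 => /allP v0; apply/eqP/rowP => i; rewrite [RHS]mxE.
have := v0 i (mem_index_enum _); rewrite !mxE mulf_eq0 conjc_eq0 orbb.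
by move=> /eqP.
Qed.

Lemma gform_pos X : X != 0 -> 0 < gform Z X X.
Proof.
move=> X0; have := trace_pos_def (ctrmx_P Z) pos_def_P pos_def_Q X0.
by rewrite ltcE => /andP[_].
Qed.

Lemma inner_gr_metric_pos x : x != 0 -> 0 < inner (@gr_metric R m z) x x.
Proof.
move=> x0; rewrite inner_gr_metric gform_pos//.
by apply: contraNneq x0 => e; rewrite -[x]cmatrixK e -(cmatrix0 R m) cmatrixK.
Qed.

End DomainPositivity.

Lemma inner1_pos (R : realType) n (x : 'rV[R]_n) : x != 0 -> 0 < inner 1%:M x x.
Proof.
move=> x0; rewrite /inner mulmx1 mxE lt_def sumr_ge0 ?andbT; last first.
  by move=> i _; rewrite mxE -expr2 sqr_ge0.
rewrite psumr_eq0; last by move=> i _; rewrite mxE -expr2 sqr_ge0.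
apply: contraNN x0 => /allP x0; apply/eqP/rowP => i; rewrite [RHS]mxE; apply/eqP.
by have := x0 i (mem_index_enum _); rewrite mxE mulf_eq0 orbb.
Qed.

(** * Orthonormal frames *)

Section OrthonormalFrames.
Variables (R : realType) (n : nat) (S : 'M[R]_n).
Hypothesis posS : forall x : 'rV[R]_n, x != 0 -> 0 < inner S x x.

(** Fewer than [n] linear equations in [n] unknowns have a nonzero solution, and positivity of [S]
    allows it to be normalized. *)
Lemma exists_unit_orthogonal k (F : 'M[R]_(k, n)) : (k < n)%N ->
  exists x : 'rV[R]_n, x *m S *m F^T = 0 /\ inner S x x = 1.
Proof.
move=> kn; have : kermx (S *m F^T) != 0.
  rewrite kermx_eq0 /row_free ltn_eqF//.
  by apply: leq_ltn_trans kn; exact: rank_leq_col.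
move=> /rowV0Pn[y /sub_kermxP yF y0].
pose c := (Num.sqrt (inner S y y))^-1; exists (c *: y); split.
  by rewrite -!scalemxAl -mulmxA yF scaler0.
rewrite innerZl innerZr mulrA -expr2 exprVn sqr_sqrtr; last exact/ltW/posS.
by rewrite mulVf// gt_eqF// posS.
Qed.

Hypothesis symS : S^T = S.

Lemma orthonormal_col_mx k (x : 'rV[R]_n) (F : 'M[R]_(k, n)) :
  F *m S *m F^T = 1%:M -> x *m S *m F^T = 0 -> inner S x x = 1 ->
  col_mx x F *m S *m (col_mx x F)^T = 1%:M.
Proof.
move=> FF xF xx; rewrite mul_col_mx tr_col_mx mul_col_row FF xF.
have -> : F *m S *m x^T = 0.
  by apply: (can_inj (@trmxK _ _ _)); rewrite !trmx_mul trmxK symS mulmxA xF trmx0.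
have -> : x *m S *m x^T = 1%:M.
  by apply/matrixP => i j; rewrite !ord1 [LHS]xx mxE.
by rewrite -scalar_mx_block.
Qed.

Lemma exists_orthonormal k : (k <= n)%N -> exists F : 'M[R]_(k, n), F *m S *m F^T = 1%:M.
Proof.
elim: k => [|k IH] kn; first by exists 0; apply/matrixP => -[].
have [F FF] := IH (ltnW kn); have [x [xF xx]] := exists_unit_orthogonal F kn.
by exists (col_mx x F); exact: (orthonormal_col_mx FF xF xx).
Qed.

End OrthonormalFrames.

(** * Extremal hyperplanes *)

Section SquareNorm.
Variable R : realType.

Definition sqnorm p q (A : 'M[R]_(p, q)) : R := \sum_i \sum_j A i j ^+ 2.

Lemma sqnormE p q (A : 'M[R]_(p, q)) : sqnorm A = \tr (A *m A^T).
Proof.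
apply: eq_bigr => i _; rewrite mxE; apply: eq_bigr => j _.
by rewrite mxE expr2.
Qed.

Lemma sqnorm_ge0 p q (A : 'M[R]_(p, q)) : 0 <= sqnorm A.
Proof. by apply: sumr_ge0 => i _; apply: sumr_ge0 => j _; exact: sqr_ge0. Qed.

Lemma sqnorm_eq0 p q (A : 'M[R]_(p, q)) : sqnorm A = 0 -> A = 0.
Proof.
move/eqP; rewrite psumr_eq0; last first.
  by move=> i _; apply: sumr_ge0 => j _; exact: sqr_ge0.
move=> /allP A0; apply/matrixP => i j; rewrite mxE; apply/eqP.
have := A0 i (mem_index_enum _); rewrite psumr_eq0; last by move=> k _; exact: sqr_ge0.
by move=> /allP/(_ j (mem_index_enum _)); rewrite sqrf_eq0.
Qed.

Lemma sqnorm_tr p q (A : 'M[R]_(p, q)) : sqnorm A^T = sqnorm A.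
Proof. by rewrite !sqnormE trmxK mxtrace_mulC. Qed.

Lemma sqnorm_block p1 p2 q1 q2 (A : 'M[R]_(p1, q1)) (B : 'M[R]_(p1, q2))
    (C : 'M[R]_(p2, q1)) (D : 'M[R]_(p2, q2)) :
  sqnorm (block_mx A B C D) = sqnorm A + sqnorm B + (sqnorm C + sqnorm D).
Proof.
by rewrite !sqnormE tr_block_mx mulmx_block mxtrace_block !mxtraceD.
Qed.

(** Pythagoras for the projection onto scalar matrices: the right side is the defect in
    Cauchy-Schwarz for the trace, and it vanishes only on scalar matrices. *)
Lemma sqnorm_traceless p (A : 'M[R]_p) : (0 < p)%N ->
  sqnorm (A - (\tr A / p%:R)%:M) = sqnorm A - (\tr A) ^+ 2 / p%:R.
Proof.
move=> p0; have pn0 : p%:R != 0 :> R by rewrite pnatr_eq0 -lt0n.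
set a := \tr A / p%:R; rewrite !sqnormE.
have -> : (A - a%:M) *m (A - a%:M)^T = A *m A^T - a *: A - a *: A^T + (a * a)%:M.
  rewrite linearB /= tr_scalar_mx mulmxBl !mulmxBr mul_mx_scalar !mul_scalar_mx.
  rewrite scale_scalar_mx; move: (A *m A^T) (a *: A) (a *: A^T) => B C D.
  by apply/matrixP => i j; rewrite !mxE; ring.
rewrite !mxtraceD ![\tr (- _)]linearN /= !mxtraceZ mxtrace_tr mxtrace_scalar /a.
by rewrite -mulr_natr; field.
Qed.

End SquareNorm.

(** * Sum of squares for a symmetric matrix and a hyperplane *)

Section CasoratiAlgebra.
Variables (R : realType) (k : nat).
Hypothesis k0 : (0 < k)%N.
Notation n := k.+1.
Implicit Types (H : 'M[R]_n) (K : 'M[R]_(k, n)) (w : 'rV[R]_n).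

Lemma block_conj H K w : H^T = H ->
  (col_mx w K : 'M[R]_(1 + k, n)) *m H *m (col_mx w K)^T =
  block_mx (w *m H *m w^T) (w *m H *m K^T) (w *m H *m K^T)^T (K *m H *m K^T).
Proof.
move=> symH; rewrite mul_col_mx tr_col_mx mul_col_row.
by rewrite !trmx_mul trmxK symH mulmxA.
Qed.

(** The conormal [w] and the rows of [K] form an orthogonal matrix, and conjugation by it preserves
    trace and norm. *)
Lemma hyperplane_decomposition H K w : H^T = H -> K *m K^T = 1%:M ->
  w *m K^T = 0 -> w *m w^T = 1%:M ->
  \tr H = (w *m H *m w^T) 0 0 + \tr (K *m H *m K^T) /\
  sqnorm H = (w *m H *m w^T) 0 0 ^+ 2 + 2 * sqnorm (w *m H *m K^T)
             + sqnorm (K *m H *m K^T).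
Proof.
move=> symH KK wK ww; pose Q : 'M[R]_n := col_mx w K.
have QQ : Q *m Q^T = 1%:M.
  suff : (col_mx w K : 'M[R]_(1 + k, n)) *m (col_mx w K)^T = 1%:M by [].
  rewrite tr_col_mx mul_col_row KK wK ww.
  have -> : K *m w^T = 0.
    by apply: (can_inj (@trmxK _ _ _)); rewrite trmx_mul trmxK wK trmx0.
  by rewrite -scalar_mx_block.
have QQ' := mulmx1C QQ.
have E := block_conj K w symH.
split.
  have -> : \tr H = \tr (Q *m H *m Q^T) by rewrite mxtrace_mulC mulmxA QQ' mul1mx.
  apply: (etrans (congr1 (@mxtrace _ (1 + k)) E)).
  by rewrite mxtrace_block trace_mx11.
have -> : sqnorm H = sqnorm (Q *m H *m Q^T).
  rewrite !sqnormE !trmx_mul trmxK !mulmxA -[Q *m H *m Q^T *m Q]mulmxA QQ' mulmx1.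
  by rewrite [RHS]mxtrace_mulC !mulmxA QQ' mul1mx.
apply: (etrans (congr1 (@sqnorm _ (1 + k) (1 + k)) E)).
rewrite sqnorm_block sqnorm_tr.
have -> : sqnorm (w *m H *m w^T) = (w *m H *m w^T) 0 0 ^+ 2 by rewrite /sqnorm !big_ord1.
ring.
Qed.

(** The common constant of both generalized delta-Casorati curvatures: in the second one the minus
    sign is absorbed into the last factor of the numerator. *)
Definition casorati_coef (r : R) : R :=
  let d : R := n%:R in (d - 1) * (d + r) * (d ^+ 2 - d - r) / (r * d).

(* For r > n (n - 1) the coefficient is negative, so that bounding this quantity
   covers the supremum as well as the infimum of the hyperplane values. *)
Definition casorati_gap (r : R) H K : R :=
  (n%:R + r) * (n%:R^-1 * sqnorm H)
  + casorati_coef r * (k%:R^-1 * sqnorm (K *m H *m K^T)) - (\tr H) ^+ 2.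

Lemma exists_conormal K : exists w : 'rV[R]_n, w *m K^T = 0 /\ w *m w^T = 1%:M.
Proof.
have [w [wK ww]] := exists_unit_orthogonal (@inner1_pos R n) K (ltnSn k).
exists w; rewrite mulmx1 in wK; split=> //.
move: ww; rewrite /inner mulmx1 => ww.
by apply/matrixP => i j; rewrite !ord1 ww mxE.
Qed.

(* The inequality and its equality case are read off this sum of squares. *)
Lemma casorati_gapE (r : R) H K w : 0 < r -> H^T = H -> K *m K^T = 1%:M ->
  w *m K^T = 0 -> w *m w^T = 1%:M ->
  let B := K *m H *m K^T in let b := (w *m H *m w^T) 0 0 in
  casorati_gap r H K =
    (n%:R + r) / n%:R * 2 * sqnorm (w *m H *m K^T)
    + (n%:R + r) * k%:R / r * sqnorm (B - (\tr B / k%:R)%:M)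
    + (n%:R * \tr B - r * b) ^+ 2 / (r * n%:R).
Proof.
move=> r0 symH KK wK ww B b; rewrite sqnorm_traceless//.
have [trE sqE] := hyperplane_decomposition symH KK wK ww.
rewrite /casorati_gap /casorati_coef trE sqE -/B -/b.
move: (sqnorm _) (sqnorm B) (\tr B) => s S t.
have kE : n%:R = k%:R + 1 :> R by rewrite -natr1.
have : k%:R != 0 :> R by rewrite pnatr_eq0 -lt0n.
have : k%:R + 1 != 0 :> R by rewrite natr1 pnatr_eq0.
rewrite kE; move: (k%:R : R) => c c1 c0.
by field; rewrite c1 c0 gt_eqF.
Qed.

Lemma casorati_gap_ge0 (r : R) H K : 0 < r -> H^T = H -> K *m K^T = 1%:M ->
  0 <= casorati_gap r H K.
Proof.
move=> r0 symH KK; have [w [wK ww]] := exists_conormal K.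
rewrite (casorati_gapE r0 symH KK wK ww).
have n0 : 0 < n%:R :> R by rewrite ltr0n.
have rn : 0 < n%:R + r by rewrite addr_gt0.
rewrite !addr_ge0//.
- by rewrite mulr_ge0 ?sqnorm_ge0// mulr_ge0// divr_ge0// ltW.
- by rewrite mulr_ge0 ?sqnorm_ge0// divr_ge0 ?mulr_ge0// ltW.
- by rewrite mulr_ge0 ?sqr_ge0// invr_ge0 mulr_ge0// ltW.
Qed.

Lemma casorati_gap_eq0 (r : R) H K w : 0 < r -> H^T = H -> K *m K^T = 1%:M ->
  w *m K^T = 0 -> w *m w^T = 1%:M -> casorati_gap r H K = 0 ->
  exists a, [/\ K *m H *m K^T = a%:M, w *m H *m K^T = 0 &
    (w *m H *m w^T) 0 0 = n%:R * (n%:R - 1) / r * a].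
Proof.
move=> r0 symH KK wK ww; rewrite (casorati_gapE r0 symH KK wK ww) /=.
have n0 : 0 < n%:R :> R by rewrite ltr0n.
have c0 : 0 < k%:R :> R by rewrite ltr0n.
have rn : 0 < n%:R + r by rewrite addr_gt0.
set B := K *m H *m K^T; set b := _ 0 0.
have t1 : 0 <= (n%:R + r) / n%:R * 2 * sqnorm (w *m H *m K^T).
  by rewrite mulr_ge0 ?sqnorm_ge0// mulr_ge0// divr_ge0// ltW.
have t2 : 0 <= (n%:R + r) * k%:R / r * sqnorm (B - (\tr B / k%:R)%:M).
  by rewrite mulr_ge0 ?sqnorm_ge0// divr_ge0 ?mulr_ge0// ltW.
have t3 : 0 <= (n%:R * \tr B - r * b) ^+ 2 / (r * n%:R).
  by rewrite mulr_ge0 ?sqr_ge0// invr_ge0 mulr_ge0// ltW.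
move=> /eqP; rewrite paddr_eq0 ?addr_ge0// paddr_eq0// => /andP[/andP[e1 e2] e3].
exists (\tr B / k%:R); split.
- move: e2; rewrite mulf_eq0 gt_eqF ?divr_gt0 ?mulr_gt0//= => /eqP/sqnorm_eq0/eqP.
  by rewrite subr_eq0 => /eqP.
- by move: e1; rewrite mulf_eq0 gt_eqF ?mulr_gt0 ?invr_gt0//= => /eqP/sqnorm_eq0.
(* The last square gives [n tr B = r b], and [tr B] is [n - 1] times the diagonal value. *)
- move: e3; rewrite mulf_eq0 invr_eq0 [(r * _) == 0]gt_eqF ?mulr_gt0// orbF sqrf_eq0.
  rewrite subr_eq0 => /eqP e3; have kE : n%:R - 1 = k%:R :> R by rewrite -natr1 addrK.
  rewrite kE; apply: (mulfI (x := r)); first by rewrite gt_eqF.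
  by rewrite -e3; field; rewrite !gt_eqF.
Qed.

End CasoratiAlgebra.

(** * Attained extrema over hyperplanes *)

Section HyperplaneExtrema.
Variables (R : realType) (k : nat).
Hypothesis k0 : (0 < k)%N.
Notation n := k.+1.
Implicit Types (H : 'M[R]_n) (K : 'M[R]_(k, n)) (w : 'rV[R]_n).

(** Hyperplanes enter through orthonormal frames, which form a compact set of matrices. [H] will be
    the second fundamental form in an orthonormal tangent frame. *)
Definition hyperplane_values H : set R :=
  [set c | exists K : 'M[R]_(k, n), K *m K^T = 1%:M /\
     c = k%:R^-1 * sqnorm (K *m H *m K^T)].

Lemma smooth_sqnorm p q (F : 'rV[R]_p -> 'M[R]_(q, q)) :
  smooth_on setT F -> smooth_on setT (fun v => sqnorm (F v) : R^o).
Proof.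
move=> /(smooth_mxP _ openT) sF.
apply: smooth_sum => [|i _]; first exact: openT.
apply: smooth_sum => [|j _]; first exact: openT.
apply: (smooth_eq openT _ (smooth_mul openT (sF i j) (sF i j))) => v _.
by rewrite expr2.
Qed.

Lemma smooth_continuous p (f : 'rV[R]_p -> R^o) : smooth_on setT f -> continuous f.
Proof. by move=> sf v; apply: differentiable_continuous; exact: smooth_diff sf I. Qed.

Lemma smooth_vec_mx p q : smooth_on setT (fun v : 'rV[R]_(p * q) => vec_mx v : 'M[R]_(p, q)).
Proof.
apply/(smooth_mxP _ openT) => i j.
apply: (smooth_eq openT _ (smooth_coord (mxvec_index i j))) => v _.
by rewrite mxE.
Qed.

Lemma orthonormal_entry_le1 K i j : K *m K^T = 1%:M -> `|K i j| <= 1.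
Proof.
move=> KK; have : \sum_l K i l ^+ 2 = 1.
  have /matrixP/(_ i i) := KK; rewrite !mxE eqxx mulr1n => <-.
  by apply: eq_bigr => l _; rewrite mxE expr2.
rewrite (bigD1 j)//= => e.
have : 0 <= \sum_(l < n | l != j) K i l ^+ 2 by apply: sumr_ge0 => l _; exact: sqr_ge0.
have : `|K i j| ^+ 2 = K i j ^+ 2 by rewrite real_normK// num_real.
have := normr_ge0 (K i j); move: (`|K i j|) (\sum_(_ | _) _) e => x y; nra.
Qed.

Lemma exists_orthonormal_rows : exists K, K *m K^T = 1%:M.
Proof.
have [F] := exists_orthonormal (@inner1_pos R n) (trmx1 _ _) (leqnSn k).
by rewrite mulmx1; exists F.
Qed.

(** A continuous function on the closed and bounded set of orthonormal [k]-frames has a minimum. The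
    sign of [c] is free, so one statement yields infimum and supremum. *)
Lemma attained_extremum (c : R) H : exists2 K0 : 'M[R]_(k, n), K0 *m K0^T = 1%:M &
  forall K, K *m K^T = 1%:M ->
    c * sqnorm (K0 *m H *m K0^T) <= c * sqnorm (K *m H *m K^T).
Proof.
(* Frames are flattened to row vectors, the setting of [EVT_min_rV]. *)
pose A : set 'rV[R]_(k * n) := [set v | (vec_mx v : 'M[R]_(k, n)) *m (vec_mx v)^T = 1%:M].
have sv := @smooth_vec_mx k n.
have A0 : A !=set0.
  by have [K KK] := exists_orthonormal_rows; exists (mxvec K); rewrite /A /= mxvecK.
have cA : compact A.
  apply: bounded_closed_compact.
    exists 1; split; first exact: num_real.
    move=> M M1 v Av; apply: le_trans (ltW M1).
    rewrite /Num.Def.normr /= mx_normrE; apply: bigmax_le => // -[i j] _ /=.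
    rewrite ord1 -(vec_mxK v).
    by case/mxvec_indexP: j => a b; rewrite mxvecE orthonormal_entry_le1.
  have -> : A = (fun v => sqnorm (vec_mx v *m (vec_mx v)^T - 1%:M : 'M[R]_k) : R^o)
      @^-1` [set 0].
    apply/seteqP; split => v /=.
      by rewrite /A /= => ->; rewrite subrr /sqnorm big1// => i _; rewrite big1// => j _;
        rewrite mxE expr0n.
    by move=> /sqnorm_eq0/eqP; rewrite subr_eq0 => /eqP.
  apply: closed_comp; last exact: closed_eq.
  move=> v _; apply: smooth_continuous; apply: smooth_sqnorm.
  apply: smooth_add; first exact: openT.
    by apply: (smooth_mulmx openT sv); exact: (smooth_trmx openT sv).
  exact: smooth_cst.
have cf : continuous (fun v => c * sqnorm ((vec_mx v : 'M[R]_(k, n)) *m H *m (vec_mx v)^T) : R^o).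
  apply: smooth_continuous; apply: (smooth_mul openT (smooth_cst (W := R^o) c)).
  apply: smooth_sqnorm; apply: (smooth_mulmx openT); last exact: (smooth_trmx openT sv).
  by apply: (smooth_mulmx openT sv); exact: smooth_cst.
have [v vA vmin] := EVT_min_rV A0 cA (continuous_subspaceT cf).
exists (vec_mx v); first by move: vA; rewrite inE.
move=> K KK; have := vmin (mxvec K); rewrite mxvecK; apply.
by rewrite inE /A /= mxvecK.
Qed.

Lemma inf_hyperplane_values H : exists K0 : 'M[R]_(k, n), [/\ K0 *m K0^T = 1%:M,
  inf (hyperplane_values H) = k%:R^-1 * sqnorm (K0 *m H *m K0^T) &
  forall K, K *m K^T = 1%:M -> inf (hyperplane_values H) <= k%:R^-1 * sqnorm (K *m H *m K^T)].
Proof.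
have [K0 KK0 K0min] := attained_extremum k%:R^-1 H.
have lb : lbound (hyperplane_values H) (k%:R^-1 * sqnorm (K0 *m H *m K0^T)).
  by move=> _ [K [KK ->]]; exact: K0min.
have V0 : hyperplane_values H (k%:R^-1 * sqnorm (K0 *m H *m K0^T)) by exists K0.
have E : inf (hyperplane_values H) = k%:R^-1 * sqnorm (K0 *m H *m K0^T).
  apply/eqP; rewrite eq_le; apply/andP; split.
    by apply: ge_inf => //; exists (k%:R^-1 * sqnorm (K0 *m H *m K0^T)).
  by apply: lb_le_inf => //; exists (k%:R^-1 * sqnorm (K0 *m H *m K0^T)).
by exists K0; split => // K /K0min; rewrite E.
Qed.

Lemma sup_hyperplane_values H : exists K0 : 'M[R]_(k, n), [/\ K0 *m K0^T = 1%:M,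
  sup (hyperplane_values H) = k%:R^-1 * sqnorm (K0 *m H *m K0^T) &
  forall K, K *m K^T = 1%:M -> k%:R^-1 * sqnorm (K *m H *m K^T) <= sup (hyperplane_values H)].
Proof.
have [K0 KK0 K0min] := attained_extremum (- k%:R^-1) H.
have ub : ubound (hyperplane_values H) (k%:R^-1 * sqnorm (K0 *m H *m K0^T)).
  by move=> _ [K [KK ->]]; have := K0min _ KK; rewrite !mulNr lerN2.
have V0 : hyperplane_values H (k%:R^-1 * sqnorm (K0 *m H *m K0^T)) by exists K0.
have E : sup (hyperplane_values H) = k%:R^-1 * sqnorm (K0 *m H *m K0^T).
  apply/eqP; rewrite eq_le; apply/andP; split.
    by apply: ge_sup => //; exists (k%:R^-1 * sqnorm (K0 *m H *m K0^T)).
  by apply: ub_le_sup => //; exists (k%:R^-1 * sqnorm (K0 *m H *m K0^T)).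
exists K0; split => // K KK; rewrite E.
by have := K0min _ KK; rewrite !mulNr lerN2.
Qed.

(** The distinguished entry of [special_diag] sits at the last index, so the other rows of [Q] span
    the hyperplane and the last row is its conormal. *)
Lemma special_diag_frame (r a : R) H (Q : 'M[R]_n) : Q *m Q^T = 1%:M ->
  Q *m H *m Q^T = special_diag n r a ->
  let K := row' ord_max Q in let w := row ord_max Q in
  [/\ K *m K^T = 1%:M, w *m K^T = 0, w *m w^T = 1%:M &
   [/\ K *m H *m K^T = a%:M, w *m H *m K^T = 0 &
    (w *m H *m w^T) 0 0 = n%:R * (n%:R - 1) / r * a]].
Proof.
move=> QQ QH K w.
have rK i : row i K = row (lift ord_max i) Q by apply/rowP => j; rewrite !mxE.
have rw i : row i w = row ord_max Q by apply/rowP => j; rewrite !mxE.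
have ent (A : 'M[R]_n) i j : inner A (row i Q) (row j Q) = (Q *m A *m Q^T) i j.
  by rewrite inner_mulmx.
have one p q (B : 'M[R]_(p, n)) (C : 'M[R]_(q, n)) : B *m C^T = B *m 1%:M *m C^T by rewrite mulmx1.
have Q1 : Q *m 1%:M *m Q^T = 1%:M by rewrite mulmx1.
have lS (i : 'I_k) : ((lift ord_max i).+1 == n)%N = false.
  by rewrite lift_max eqSS ltn_eqF.
split.
- apply/matrixP => i j; rewrite one inner_mulmx !rK ent Q1 !mxE.
  by rewrite (inj_eq (@lift_inj _ ord_max)).
- apply/matrixP => i j; rewrite one inner_mulmx rK rw ent Q1 !mxE.
  by rewrite (negbTE (neq_lift _ _)).
- apply/matrixP => i j; rewrite one inner_mulmx !rw ent Q1 !ord1 !mxE.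
  by rewrite eqxx.
split.
- apply/matrixP => i j; rewrite inner_mulmx !rK ent QH !mxE lS.
  by rewrite (inj_eq (@lift_inj _ ord_max)).
- apply/matrixP => i j; rewrite inner_mulmx rK rw ent QH !mxE.
  by rewrite (negbTE (neq_lift _ _)) mulr0n.
- by rewrite inner_mulmx !rw ent QH !mxE !eqxx mulr1n.
Qed.

(** Converse of [special_diag_frame]: the conormal is appended as last row. One entrywise
    computation, [ent], serves for the identity matrix and for [H]. *)
Lemma special_diag_exists (r a : R) H K w : H^T = H -> K *m K^T = 1%:M ->
  w *m K^T = 0 -> w *m w^T = 1%:M ->
  K *m H *m K^T = a%:M -> w *m H *m K^T = 0 ->
  (w *m H *m w^T) 0 0 = n%:R * (n%:R - 1) / r * a ->
  exists2 Q : 'M[R]_n, Q *m Q^T = 1%:M & Q *m H *m Q^T = special_diag n r a.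
Proof.
move=> symH KK wK ww KH wH wHw.
pose Q : 'M[R]_n := \matrix_i (if unlift ord_max i is Some j then row j K else w).
have rl i : row (lift ord_max i) Q = row i K by rewrite rowK liftK.
have rm : row ord_max Q = w by rewrite rowK unlift_none.
have innK (A : 'M[R]_n) i j : inner A (row i K) (row j K) = (K *m A *m K^T) i j.
  by rewrite inner_mulmx.
have rw0 : row 0 w = w by apply/rowP => j; rewrite mxE.
have innw (A : 'M[R]_n) j : inner A w (row j K) = (w *m A *m K^T) 0 j.
  by rewrite inner_mulmx rw0.
have lmax i : (lift ord_max i == ord_max :> 'I_n) = false.
  by apply/negbTE; rewrite eq_sym neq_lift.
have lS (i : 'I_k) : ((lift ord_max i).+1 == n)%N = false.
  by rewrite lift_max eqSS ltn_eqF.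
have ent (A : 'M[R]_n) (x y : R) (D : 'rV[R]_n) : A^T = A ->
    K *m A *m K^T = x%:M -> w *m A *m K^T = 0 -> inner A w w = y ->
    (forall i, D 0 (lift ord_max i) = x) -> D 0 ord_max = y ->
    Q *m A *m Q^T = diag_mx D.
  move=> sA KA wA wAw Dl Dm; apply/matrixP => i j; rewrite inner_mulmx [RHS]mxE.
  case: (unliftP ord_max i) => [i'|] ->; case: (unliftP ord_max j) => [j'|] ->.
  - by rewrite !rl innK KA mxE (inj_eq (@lift_inj _ ord_max)) Dl.
  - by rewrite rl rm innerC// innw wA mxE lmax mulr0n.
  - by rewrite rl rm innw wA mxE (negbTE (neq_lift _ _)) mulr0n.
  - by rewrite rm eqxx mulr1n Dm.
exists Q.
  rewrite -[Q in Q *m _](mulmx1 Q) (ent 1%:M 1 1 (const_mx 1)) ?trmx1 ?mulmx1//.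
  - by apply/matrixP => i j; rewrite !mxE.
  - by rewrite /inner mulmx1 ww mxE.
  - by move=> i; rewrite mxE.
  - by rewrite mxE.
apply: (ent H a (n%:R * (n%:R - 1) / r * a)) => //.
- by move=> i; rewrite mxE lS.
- by rewrite mxE eqxx.
Qed.

End HyperplaneExtrema.

Lemma mulmx1_tr (F : comUnitRingType) n (E g : 'M[F]_n) :
  E *m g *m E^T = 1%:M -> [/\ E \in unitmx, g \in unitmx, invmx g = E^T *m E &
    E^T *m E *m g = 1%:M].
Proof.
move=> EgE; have [uEg uEt] := mulmx1_unit EgE.
have uE : E \in unitmx by rewrite -unitmx_tr.
have ug : g \in unitmx by move: uEg; rewrite unitmx_mul => /andP[].
have e : E^T *m E *m g = 1%:M by rewrite -mulmxA; apply: mulmx1C.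
split => //; apply: (can_inj (mulmxK ug)); rewrite mulVmx//.
Qed.

(** * Hypersurfaces *)

Section FrameChange.
Variables (F : comUnitRingType) (n : nat) (E g : 'M[F]_n).
Hypothesis EgE : E *m g *m E^T = 1%:M.

(** [A *m g *m E^T] holds the coordinates of the rows of [A] in the orthonormal frame [E], and
    multiplication by [E] recovers these rows. *)
Lemma frame_expand q (A : 'M[F]_(q, n)) : A *m g *m E^T *m E = A.
Proof.
have [uE ug gE _] := mulmx1_tr EgE.
by rewrite -!mulmxA -gE mulmxV ?mulmx1.
Qed.

Lemma frame_coords q (A : 'M[F]_(q, n)) : g^T = g ->
  (A *m g *m E^T) *m (A *m g *m E^T)^T = A *m g *m A^T.
Proof.
move=> sg; rewrite (trmx_mul (A *m g)) trmxK mulmxA frame_expand.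
by rewrite trmx_mul sg mulmxA.
Qed.

Lemma frame_mul q (K : 'M[F]_(q, n)) : (K *m E) *m g *m (K *m E)^T = K *m K^T.
Proof. by rewrite trmx_mul !mulmxA -(mulmxA K) -(mulmxA K) EgE mulmx1. Qed.

Lemma frame_conj q (A : 'M[F]_(q, n)) (H : 'M[F]_n) :
  (A *m g *m E^T) *m (E *m H *m E^T) *m (A *m g *m E^T)^T = A *m H *m A^T.
Proof.
have e : E^T *m (A *m g *m E^T)^T = A^T by rewrite -trmx_mul frame_expand.
by rewrite !mulmxA frame_expand -(mulmxA (A *m H)) e.
Qed.

End FrameChange.

Section Hypersurface.
Variables (R : realType) (k N : nat).
Notation n := k.+1.
Variables (G : 'rV[R]_N -> 'M[R]_N) (D : set 'rV[R]_N) (U : set 'rV[R]_n).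
Variable f : 'rV[R]_n -> 'rV[R]_N.
Hypothesis oD : open D.
Hypothesis sG : smooth_on D G.
Hypothesis symG : forall z, D z -> (G z)^T = G z.
Hypothesis unitG : forall z, D z -> G z \in unitmx.
Hypothesis oU : open U.
Hypothesis fD : forall u, U u -> D (f u).
Hypothesis sf : smooth_on U f.
Hypothesis posG : forall u x, U u -> x != 0 -> 0 < inner (G (f u)) x x.
Hypothesis freeJ : forall u, U u -> row_free (jac f u).
Hypothesis N_n : N = n.+1.
Notation g := (induced_metric G f).

Lemma inner_induced_metric u x y :
  inner (g u) x y = inner (G (f u)) (x *m jac f u) (y *m jac f u).
Proof. by rewrite /inner /induced_metric trmx_mul !mulmxA. Qed.

Lemma induced_metric_pos u x : U u -> x != 0 -> 0 < inner (g u) x x.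
Proof.
move=> Uu x0; rewrite inner_induced_metric posG//.
apply: contraNneq x0 => e; apply/eqP.
by apply: (row_free_inj (freeJ Uu)); rewrite e mul0mx.
Qed.

Lemma induced_metric_unit u : U u -> g u \in unitmx.
Proof.
move=> Uu; apply: mxunit_kermx0 => x xg; apply/eqP; apply/negPn/negP => x0.
by have := induced_metric_pos Uu x0; rewrite /inner xg mul0mx mxE ltxx.
Qed.

Lemma exists_tangent_frame u : U u -> exists E, Defs.orthonormal g u (E : 'M[R]_n).
Proof.
move=> Uu; apply: (exists_orthonormal (fun x => induced_metric_pos Uu (x := x)) _ (leqnn n)).
exact: (sym_induced_metric symG fD Uu).
Qed.

Lemma normal_atP u v : normal_at G f u v <-> v *m G (f u) *m (jac f u)^T = 0.
Proof.
have v0 : row 0 v = v by apply/rowP => i; rewrite mxE.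
have E i : (v *m G (f u) *m (jac f u)^T) 0 i = inner (G (f u)) v (pder i f u).
  by rewrite inner_mulmx row_jac v0.
split=> [nv|nv i]; first by apply/rowP => i; rewrite E nv mxE.
by rewrite -E nv mxE.
Qed.

Lemma exists_unit_normal u : U u -> exists e, unit_normal G f u e.
Proof.
move=> Uu; have nN : (n < N)%N by rewrite N_n.
have [e [eJ ee]] := exists_unit_orthogonal (fun x => posG (x := x) Uu) (jac f u) nN.
by exists e; split => //; apply/normal_atP.
Qed.

(** In codimension one, [e] and a tangent frame are [N] orthonormal vectors, so a vector orthogonal
    to all of them vanishes. *)
Lemma normal_span u e v : U u -> unit_normal G f u e -> normal_at G f u v ->
  v = inner (G (f u)) v e *: e.
Proof.
move=> Uu [/normal_atP ne ee] /normal_atP nv; have [E EE] := exists_tangent_frame Uu.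
set c := inner _ v e; apply/eqP; rewrite -subr_eq0; apply/negPn/negP => w0.
set w := v - c *: e in w0 *.
have nw : w *m G (f u) *m (jac f u)^T = 0.
  by rewrite /w !mulmxBl -!scalemxAl ne nv scaler0 subr0.
have we : inner (G (f u)) w e = 0.
  by rewrite /w -scaleNr innerDl innerZl ee -/c mulr1 subrr.
have sGu := symG (fD Uu).
pose F : 'M[R]_(1 + n, N) := col_mx e (E *m jac f u).
have FF : F *m G (f u) *m F^T = 1%:M.
  apply: orthonormal_col_mx => //.
    by move: EE; rewrite /Defs.orthonormal /induced_metric trmx_mul !mulmxA.
  by rewrite trmx_mul !mulmxA ne mul0mx.
have wF : w *m G (f u) *m F^T = 0.
  rewrite /F tr_col_mx mul_mx_row trmx_mul mulmxA nw mul0mx.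
  have -> : w *m G (f u) *m e^T = 0 by apply/matrixP => i j; rewrite !ord1 [LHS]we mxE.
  by rewrite row_mx0.
have : row_free F.
  by apply/row_freeP; exists (G (f u) *m F^T); rewrite mulmxA.
rewrite /row_free => /eqP rF; have /row_fullP[B BF] : row_full F.
  by rewrite /row_full rF N_n.
have : w *m G (f u) *m w^T = 0.
  by rewrite -[w in w^T]mulmx1 -BF !trmx_mul mulmxA mulmxA wF !mul0mx.
move=> ww; have := posG Uu w0; rewrite /inner ww mxE ltxx.
by [].
Qed.

Definition hmat u e : 'M[R]_n := \matrix_(i, j)
  inner (G (f u)) (second_ff G f u (delta_mx 0 i) (delta_mx 0 j)) e.

Lemma inner_suml (S : 'M[R]_N) (I : finType) (F : I -> 'rV[R]_N) y :
  inner S (\sum_i F i) y = \sum_i inner S (F i) y.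
Proof. by rewrite /inner !mulmx_suml summxE. Qed.

Lemma second_ff_delta u i j : second_ff G f u (delta_mx 0 i) (delta_mx 0 j) =
  normal_part G f u (ambient_cov G f i (pder j f) u).
Proof.
rewrite /second_ff (bigD1 i)//= [X in _ + X]big1 ?addr0; last first.
  by move=> i' ii'; rewrite big1// => j' _; rewrite mxE (negPf ii') andbF mul0r scale0r.
rewrite (bigD1 j)//= big1 ?addr0; last first.
  by move=> j' jj'; rewrite ![delta_mx _ _ _ _]mxE (negPf jj') andbF mulr0 scale0r.
by rewrite !mxE !eqxx mulr1 scale1r.
Qed.

Lemma inner_second_ff u X Y e :
  inner (G (f u)) (second_ff G f u X Y) e = (X *m hmat u e *m Y^T) 0 0.
Proof.
rewrite /second_ff inner_suml -mulmxA [RHS]mxE; apply: eq_bigr => i _.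
rewrite inner_suml mxE mulr_sumr; apply: eq_bigr => j _.
by rewrite innerZl [hmat _ _ _ _]mxE second_ff_delta [Y^T _ _]mxE mulrCA mulrC mulrA.
Qed.

Lemma sym_hmat u e : U u -> (hmat u e)^T = hmat u e.
Proof.
move=> Uu; apply/matrixP => i j; rewrite 3!mxE.
by rewrite (second_ff_sym oD symG oU fD sf _ _ Uu).
Qed.

Lemma second_ff_normal u X Y : U u -> normal_at G f u (second_ff G f u X Y).
Proof.
move=> Uu; apply/normal_atP.
rewrite (second_ffE oD sG symG unitG oU fD sf induced_metric_unit _ _ Uu).
rewrite !mulmx_suml big1// => i _; rewrite -!scalemxAl.
rewrite -(mulmxA Y) -(mulmxA Y).
rewrite (normal_cov_jac_tangent oD sG symG unitG oU fD sf induced_metric_unit i Uu).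
by rewrite mulmx0 scaler0.
Qed.

Lemma shape_operatorE u e E : U u -> Defs.orthonormal g u E ->
  E *m shape_operator G f u e *m invmx E = E *m hmat u e *m E^T.
Proof.
move=> Uu EE; have [uE ug gE _] := mulmx1_tr EE.
by rewrite /shape_operator -/(hmat u e) gE !mulmxA mulmxK.
Qed.

Lemma casoratiE q u e (F : 'M[R]_(q, n)) :
  casorati G f u e F = q%:R^-1 * sqnorm (F *m hmat u e *m F^T).
Proof.
congr (_ * _); apply: eq_bigr => i _; apply: eq_bigr => j _.
by rewrite inner_second_ff [in RHS]inner_mulmx.
Qed.

(** Coordinates in [E] identify orthonormal frames of tangent hyperplanes with matrices [K]; the
    subspace [L] is recovered as the span of the frame. *)
Lemma hyperplane_casoratiE u e E : U u -> Defs.orthonormal g u E ->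
  hyperplane_casorati G f u e = hyperplane_values (k := k) (E *m hmat u e *m E^T).
Proof.
move=> Uu EE; have [uE ug gE EEg] := mulmx1_tr EE.
apply/seteqP; split => [c [L [F [_ [_ [FF ->]]]]]|c [K [KK ->]]].
  exists (F *m g u *m E^T); split.
    by rewrite (frame_coords EE _ (sym_induced_metric symG fD Uu)).
  by rewrite casoratiE (frame_conj EE).
have KEg : K *m E *m g u *m (K *m E)^T = 1%:M by rewrite (frame_mul EE).
exists <<K *m E>>%MS, (K *m E); split; last split.
- rewrite mxrank_gen; apply/eqP.
  by apply/row_freeP; exists (g u *m (K *m E)^T); rewrite mulmxA.
- by apply/eqmxP/eqmx_sym; exact: genmxE.
by split => //; rewrite casoratiE trmx_mul !mulmxA.
Qed.

(** Frame and normal are existential in [special_shape]. A change of frame is an orthogonal [Q], and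
    any other unit normal is [s e] with [s^2 = 1], the sign being absorbed into [a]. *)
Lemma special_shapeP r u E e : U u -> Defs.orthonormal g u E -> unit_normal G f u e ->
  special_shape G f r u <-> exists (Q : 'M[R]_n) (a : R), Q *m Q^T = 1%:M /\
    Q *m (E *m hmat u e *m E^T) *m Q^T = special_diag n r a.
Proof.
move=> Uu EE ne.
split=> [[E' [e' [a [EE' [ne' sh]]]]]|[Q [a [QQ QH]]]].
  set s := inner (G (f u)) e' e.
  have e'E : e' = s *: e := normal_span Uu ne ne'.1.
  have s2 : s * s = 1.
    by have := ne'.2; rewrite e'E innerZl innerZr ne.2 mulr1.
  have hE : hmat u e = s *: hmat u e'.
    by apply/matrixP => i j; rewrite !mxE e'E innerZr mulrA s2 mul1r.
  exists (E' *m g u *m E^T), (s * a); split.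
    by rewrite (frame_coords EE _ (sym_induced_metric symG fD Uu)).
  rewrite (frame_conj EE) hE -scalemxAr -scalemxAl.
  rewrite -(shape_operatorE e' Uu EE') sh.
  apply/matrixP => i j; rewrite !mxE mulrnAr; congr (_ *+ _).
  by case: ifP => // _; rewrite mulrCA.
have QEE : Defs.orthonormal g u (Q *m E) by rewrite /Defs.orthonormal (frame_mul EE).
exists (Q *m E), e, a; split => //; split => //.
by rewrite (shape_operatorE e Uu QEE) trmx_mul -QH !mulmxA.
Qed.

End Hypersurface.

Section ExtremalHyperplane.
Variables (R : realType) (k : nat).
Hypothesis k0 : (0 < k)%N.
Notation n := k.+1.
Implicit Types (H : 'M[R]_n) (K : 'M[R]_(k, n)).

(** For the converse, the hyperplane read off [Q] may differ from that of [K0]. The gap vanishes on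
    it and, [K0] being a minimizer, is no larger at [K0]. *)
Lemma extremal_casorati_gap (r : R) H (K0 : 'M[R]_(k, n)) :
  0 < r -> H^T = H -> K0 *m K0^T = 1%:M ->
  (forall K, K *m K^T = 1%:M ->
     casorati_coef k r * (k%:R^-1 * sqnorm (K0 *m H *m K0^T)) <=
     casorati_coef k r * (k%:R^-1 * sqnorm (K *m H *m K^T))) ->
  casorati_gap r H K0 = 0 <->
  exists (Q : 'M[R]_n) (a : R), Q *m Q^T = 1%:M /\ Q *m H *m Q^T = special_diag n r a.
Proof.
move=> r0 symH KK0 K0min; split=> [gap0|[Q [a [QQ QH]]]].
  have [w [wK ww]] := exists_conormal K0.
  have [a [KH wH wHw]] := casorati_gap_eq0 k0 r0 symH KK0 wK ww gap0.
  have [Q QQ QH] := special_diag_exists symH KK0 wK ww KH wH wHw.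
  by exists Q, a.
have [KK wK ww [KH wH wHw]] := special_diag_frame QQ QH.
apply/eqP; rewrite eq_le casorati_gap_ge0// andbT.
apply: (@le_trans _ _ (casorati_gap r H (row' ord_max Q))).
  by rewrite /casorati_gap lerD2r lerD2l K0min.
rewrite (casorati_gapE k0 r0 symH KK wK ww) /= KH wH wHw mxtrace_scalar.
have c0 : k%:R != 0 :> R by rewrite pnatr_eq0 -lt0n.
have -> : a *+ k / k%:R = a by rewrite -[a *+ k]mulr_natr mulfK.
have z p q : sqnorm (0 : 'M[R]_(p, q)) = 0.
  by rewrite /sqnorm big1// => i _; rewrite big1// => j _; rewrite mxE expr0n.
rewrite subrr !z !mulr0 !add0r -[a *+ k]mulr_natr.
have kE : n%:R - 1 = k%:R :> R by rewrite -natr1 addrK.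
rewrite kE (_ : n%:R * _ - _ = 0) ?expr0n ?mul0r//.
by field; rewrite gt_eqF.
Qed.

End ExtremalHyperplane.

Lemma double_strict_sum (R : realType) n (T : 'I_n -> 'I_n -> R) :
  (forall i j, T i j = T j i) -> (forall i, T i i = 0) ->
  2 * (\sum_(i < n) \sum_(j < n | (i < j)%N) T i j) = \sum_i \sum_j T i j.
Proof.
move=> Tsym Tdiag.
have split3 i : \sum_j T i j = \sum_(j < n | (i < j)%N) T i j + \sum_(j < n | (j < i)%N) T i j.
  rewrite (bigID (fun j : 'I_n => (i < j)%N)) /=; congr (_ + _).
  rewrite (bigID (fun j : 'I_n => (j < i)%N)) /= [X in _ + X]big1 ?addr0.
    by apply: eq_bigl => j; case: ltngtP.
  move=> j; rewrite -!leqNgt => /andP[ji ij].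
  by rewrite (_ : j = i) ?Tdiag//; apply/val_inj/eqP; rewrite eqn_leq ji ij.
under [RHS]eq_bigr => i _ do rewrite split3.
rewrite big_split /= mulrDl mul1r; congr (_ + _).
rewrite (exchange_big_dep xpredT) //=; apply: eq_bigr => j _.
by apply: eq_bigr => i _.
Qed.

(** * The inequality at a point *)

Section PointwiseInequality.
Variables (R : realType) (k N : nat).
Hypothesis k0 : (0 < k)%N.
Notation n := k.+1.
Variables (G : 'rV[R]_N -> 'M[R]_N) (D : set 'rV[R]_N) (U : set 'rV[R]_n).
Variable f : 'rV[R]_n -> 'rV[R]_N.
Hypothesis oD : open D.
Hypothesis sG : smooth_on D G.
Hypothesis symG : forall z, D z -> (G z)^T = G z.
Hypothesis unitG : forall z, D z -> G z \in unitmx.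
Hypothesis oU : open U.
Hypothesis fD : forall u, U u -> D (f u).
Hypothesis sf : smooth_on U f.
Hypothesis posG : forall u x, U u -> x != 0 -> 0 < inner (G (f u)) x x.
Hypothesis freeJ : forall u, U u -> row_free (jac f u).
Hypothesis N_n : N = n.+1.
Hypothesis sect_sym : forall z x y, D z -> sectional G z x y = sectional G z y x.
Hypothesis sect_diag : forall z x, D z -> sectional G z x x = 0.
Notation g := (induced_metric G f).
Variables (u : 'rV[R]_n) (E : 'M[R]_n) (e : 'rV[R]_N).
Hypothesis Uu : U u.
Hypothesis EE : Defs.orthonormal g u E.
Hypothesis ne : unit_normal G f u e.
Let H := E *m hmat G f u e *m E^T.

Lemma symH : H^T = H.
Proof. by rewrite /H !trmx_mul trmxK (sym_hmat oD symG oU fD sf e Uu) mulmxA. Qed.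

(** Gauss equation with [h(X, Y)] a multiple of [e]; symmetry and vanishing on the diagonal turn the
    sum over [i < j] into half of the full double sum. *)
Lemma double_scalar_curvature :
  2 * scalar_curvature g u E =
  \sum_i \sum_j sectional G (f u) (row i E *m jac f u) (row j E *m jac f u)
  + (\tr H) ^+ 2 - sqnorm H.
Proof.
have ug := induced_metric_unit (G := G) posG freeJ.
have hE i j : second_ff G f u (row i E) (row j E) = H i j *: e.
  have nij := second_ff_normal oD sG symG unitG oU fD sf posG freeJ (row i E) (row j E) Uu.
  rewrite (normal_span symG fD posG freeJ N_n Uu ne nij) inner_second_ff.
  by rewrite /H [in RHS]inner_mulmx.
have sE i j : sectional g u (row i E) (row j E) =
    sectional G (f u) (row i E *m jac f u) (row j E *m jac f u)
    + H i i * H j j - H i j ^+ 2.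
  rewrite (gauss_equation oD sG symG unitG oU fD sf ug _ _ Uu) !hE.
  by rewrite !innerZl !innerZr ne.2 !mulr1 expr2.
have Hs i j : H i j = H j i by rewrite -[in LHS]symH mxE.
rewrite /scalar_curvature double_strict_sum; first last.
- by move=> i; rewrite sE (sect_diag _ (fD Uu)) add0r expr2 subrr.
- move=> i j; rewrite !sE (sect_sym _ _ (fD Uu)) [H i i * _]mulrC (Hs i j) //.
rewrite /sqnorm -[in RHS]addrA -sumrN.
have -> : (\tr H) ^+ 2 = \sum_i \sum_j H i i * H j j.
  rewrite expr2 mulr_suml; apply: eq_bigr => i _; exact: mulr_sumr.
rewrite -!big_split /=; apply: eq_bigr => i _.
rewrite -sumrN -!big_split /=; apply: eq_bigr => j _.
by rewrite sE addrA.
Qed.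

(** As [|h|^2 = n C], the term [sqnorm H] raises the coefficient of the Casorati curvature from [r]
    to [n + r]. *)
Lemma casorati_gapP (r ext : R) (K0 : 'M[R]_(k, n)) :
  ext = k%:R^-1 * sqnorm (K0 *m H *m K0^T) ->
  r * casorati G f u e E + casorati_coef k r * ext - ((\tr H) ^+ 2 - sqnorm H) =
  casorati_gap r H K0.
Proof.
move=> ->; rewrite casoratiE -/H /casorati_gap.
have n0 : n%:R != 0 :> R by rewrite pnatr_eq0.
rewrite mulrDl mulVKf//; ring.
Qed.

Lemma pointwise_extremal (r ext : R) (K0 : 'M[R]_(k, n)) : 0 < r ->
  K0 *m K0^T = 1%:M -> ext = k%:R^-1 * sqnorm (K0 *m H *m K0^T) ->
  (forall K : 'M[R]_(k, n), K *m K^T = 1%:M -> casorati_coef k r * ext <=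
     casorati_coef k r * (k%:R^-1 * sqnorm (K *m H *m K^T))) ->
  let delta := r * casorati G f u e E + casorati_coef k r * ext in
  (\tr H) ^+ 2 - sqnorm H <= delta /\
  ((\tr H) ^+ 2 - sqnorm H = delta <-> special_shape G f r u).
Proof.
move=> r0 KK0 extE extmin delta; have gE := casorati_gapP r extE.
rewrite -/delta in gE; have sH := symH; split.
  by rewrite -subr_ge0 gE casorati_gap_ge0.
rewrite (special_shapeP symG fD posG freeJ N_n r Uu EE ne) -/H.
rewrite extE in extmin; rewrite -(extremal_casorati_gap k0 r0 sH KK0 extmin) -gE.
split=> [->|/eqP]; first by rewrite subrr.
by rewrite subr_eq0 => /eqP.
Qed.

Lemma casorati_coef_gt0 (r : R) : 0 < r -> r < n%:R * (n%:R - 1) -> 0 < casorati_coef k r.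
Proof.
move=> r0 rn; rewrite /casorati_coef.
have k1 : 0 < n%:R - 1 :> R by rewrite -natr1 addrK ltr0n.
have n0 : 0 < n%:R :> R by rewrite ltr0n.
have q0 : 0 < n%:R ^+ 2 - n%:R - r by rewrite subr_gt0 expr2 -[X in _ - X]mulr1 -mulrBr.
by apply: divr_gt0; rewrite !mulr_gt0// addr_gt0.
Qed.

Lemma casorati_coef_lt0 (r : R) : n%:R * (n%:R - 1) < r -> casorati_coef k r < 0.
Proof.
move=> rn; have k1 : 0 < n%:R - 1 :> R by rewrite -natr1 addrK ltr0n.
have n0 : 0 < n%:R :> R by rewrite ltr0n.
have r0 : 0 < r by apply: lt_trans rn; rewrite mulr_gt0.
have q0 : n%:R ^+ 2 - n%:R - r < 0 by rewrite subr_lt0 expr2 -[X in _ - X]mulr1 -mulrBr.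
rewrite /casorati_coef pmulr_llt0 ?invr_gt0 ?mulr_gt0//.
by rewrite pmulr_rlt0// mulr_gt0// addr_gt0.
Qed.

Lemma pointwise_delta (r : R) : 0 < r -> r < n%:R * (n%:R - 1) ->
  (\tr H) ^+ 2 - sqnorm H <= delta_casorati G f r u E e /\
  ((\tr H) ^+ 2 - sqnorm H = delta_casorati G f r u E e <-> special_shape G f r u).
Proof.
move=> r0 rn; have [K0 [KK0 infE infle]] := inf_hyperplane_values H.
have c0 := casorati_coef_gt0 r0 rn.
rewrite /delta_casorati (hyperplane_casoratiE symG fD e Uu EE) -/H.
apply: (pointwise_extremal r0 KK0 infE) => K KK.
by rewrite ler_pM2l// infle.
Qed.

Lemma pointwise_delta_hat (r : R) : n%:R * (n%:R - 1) < r ->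
  (\tr H) ^+ 2 - sqnorm H <= delta_casorati_hat G f r u E e /\
  ((\tr H) ^+ 2 - sqnorm H = delta_casorati_hat G f r u E e <-> special_shape G f r u).
Proof.
move=> rn; have [K0 [KK0 supE suple]] := sup_hyperplane_values H.
have c0 := casorati_coef_lt0 rn.
have r0 : 0 < r by apply: le_lt_trans rn; rewrite mulr_ge0// subr_ge0 ler1n.
(* The minus sign turns [r - n^2 + n] into the factor [n^2 - n - r] of [casorati_coef]. *)
have -> : delta_casorati_hat G f r u E e =
    r * casorati G f u e E + casorati_coef k r * sup (hyperplane_values (k := k) H).
  rewrite /delta_casorati_hat (hyperplane_casoratiE symG fD e Uu EE) -/H /casorati_coef.
  rewrite -mulNr; congr (_ + _ * _); rewrite -mulNr; congr (_ / _); ring.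
apply: (pointwise_extremal r0 KK0 supE) => K KK.
(* The coefficient is negative, so the supremum gives the least product. *)
by rewrite ler_nM2l// suple.
Qed.

End PointwiseInequality.

(** * Normal fields, flatness and quasi-umbilicity *)

Section UnitNormalField.
Variables (R : realType) (k N : nat).
Notation n := k.+1.
Variables (G : 'rV[R]_N -> 'M[R]_N) (D : set 'rV[R]_N) (U : set 'rV[R]_n).
Variable f : 'rV[R]_n -> 'rV[R]_N.
Hypothesis oD : open D.
Hypothesis sG : smooth_on D G.
Hypothesis symG : forall z, D z -> (G z)^T = G z.
Hypothesis unitG : forall z, D z -> G z \in unitmx.
Hypothesis oU : open U.
Hypothesis fD : forall u, U u -> D (f u).
Hypothesis sf : smooth_on U f.
Hypothesis posG : forall u x, U u -> x != 0 -> 0 < inner (G (f u)) x x.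
Hypothesis freeJ : forall u, U u -> row_free (jac f u).
Hypothesis N_n : N = n.+1.
Notation g := (induced_metric G f).

Lemma normal_part_normal u v : U u -> normal_at G f u (normal_part G f u v).
Proof.
move=> Uu; have ug := induced_metric_unit (G := G) posG freeJ Uu.
apply/normal_atP; rewrite /normal_part !mulmxBl.
have -> : v *m G (f u) *m (jac f u)^T *m invmx (g u) *m jac f u *m G (f u) *m (jac f u)^T =
    v *m G (f u) *m (jac f u)^T *m invmx (g u) *m g u.
  by rewrite /induced_metric !mulmxA.
by rewrite mulmxKV// subrr.
Qed.

Lemma normal_part_id u v : normal_at G f u v -> normal_part G f u v = v.
Proof. by move=> /normal_atP nv; rewrite /normal_part nv !mul0mx subr0. Qed.

Lemma inner_normal_part u v e : U u -> normal_at G f u e ->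
  inner (G (f u)) (normal_part G f u v) e = inner (G (f u)) v e.
Proof.
move=> Uu /normal_atP ne; have sGu := symG (fD Uu).
have e0 : jac f u *m G (f u) *m e^T = 0.
  by apply: (can_inj (@trmxK _ _ _)); rewrite !trmx_mul trmxK sGu mulmxA ne trmx0.
pose c := v *m G (f u) *m (jac f u)^T *m invmx (g u).
have -> : normal_part G f u v = v + -1 *: (c *m jac f u) by rewrite scaleN1r.
rewrite innerDl innerZl (_ : inner _ (c *m _) _ = 0) ?mulr0 ?addr0//.
by rewrite /inner -!(mulmxA c) e0 mulmx0 mxE.
Qed.

Lemma normal_part_unit u v e : U u -> unit_normal G f u e ->
  normal_part G f u v = inner (G (f u)) v e *: e.
Proof.
move=> Uu ne; have nv := normal_part_normal v Uu.
rewrite {1}(normal_span symG fD posG freeJ N_n Uu ne nv).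
by rewrite (inner_normal_part v Uu ne.1).
Qed.

Lemma open_pos (s : 'rV[R]_n -> R^o) : smooth_on U s ->
  open (U `&` [set u | 0 < s u]).
Proof.
move=> ss; rewrite openE => u [Uu su]; rewrite /interior.
have cs : {for u, continuous s} by apply: differentiable_continuous; exact: smooth_diff ss Uu.
have U_nbhs := open_nbhs_nbhs (conj oU Uu).
have s_nbhs : nbhs u (s @^-1` [set x : R | 0 < x]).
  by apply: cs; apply: open_nbhs_nbhs; split => //; exact: open_gt.
exact: filterI U_nbhs s_nbhs.
Qed.

Lemma smooth_normal_part e0 : smooth_on U (fun u => normal_part G f u e0).
Proof.
have sJ := smooth_jac oU sf; have sGf := smooth_Gf oD sG oU fD sf.
have sg := smooth_induced_metric oD sG oU fD sf.
have ug := induced_metric_unit (G := G) posG freeJ.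
have sc : smooth_on U (fun=> e0) := smooth_cst e0.
have sP := smooth_mulmx oU (smooth_mulmx oU (smooth_mulmx oU (smooth_mulmx oU sc sGf)
  (smooth_trmx oU sJ)) (smooth_invmx oU ug sg)) sJ.
apply/(smooth_mxP _ oU) => i j.
have sPij := (smooth_mxP _ oU).1 sP i j.
have scij := (smooth_mxP _ oU).1 sc i j.
apply: (smooth_eq oU _ (smooth_sub oU scij sPij)) => u _.
by rewrite /normal_part [RHS]mxE [X in _ = _ + X]mxE.
Qed.

Lemma smooth_scalemx (W : set 'rV[R]_n) (a : 'rV[R]_n -> R^o) (V : 'rV[R]_n -> 'rV[R]_N) :
  open W -> smooth_on W a -> smooth_on W V -> smooth_on W (fun u => a u *: V u).
Proof.
move=> oW sa sV; apply/(smooth_mxP _ oW) => i j.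
have sVij := (smooth_mxP _ oW).1 sV i j.
by apply: (smooth_eq oW _ (smooth_mul oW sa sVij)) => u _; rewrite mxE.
Qed.

(** A unit normal at [u0], kept constant in coordinates, is projected to the normal line and
    normalized on the open set where the projection is nonzero. *)
Lemma local_unit_normal u0 : U u0 ->
  exists (W : set 'rV[R]_n) (nu : 'rV[R]_n -> 'rV[R]_N),
    [/\ open W, W u0, W `<=` U, smooth_on W nu &
        forall u, W u -> unit_normal G f u (nu u)].
Proof.
move=> Uu0; have [e0 [ne0 ee0]] := exists_unit_normal posG N_n Uu0.
pose v u := normal_part G f u e0; have sv : smooth_on U v := smooth_normal_part e0.
pose s u : R^o := inner (G (f u)) (v u) (v u).
have ss : smooth_on U s := smooth_inner oU (smooth_Gf oD sG oU fD sf) sv sv.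
pose W := U `&` [set u | 0 < s u].
have oW : open W := open_pos ss.
have WU : W `<=` U by move=> u [].
exists W, (fun u => (Num.sqrt (s u))^-1 *: v u); split; [exact: oW| |exact: WU| |].
- by split => //; rewrite /s /v /= normal_part_id// ee0.
- apply: (smooth_scalemx oW); last exact: (smooth_subset WU sv).
  apply: (smooth_inv oW); first by move=> u [_ su]; rewrite gt_eqF// sqrtr_gt0.
  by apply: (smooth_sqrt oW); [move=> u []|exact: (smooth_subset WU ss)].
move=> u [Uu su]; split.
  apply/normal_atP; rewrite -!scalemxAl.
  by have /normal_atP -> := normal_part_normal e0 Uu; rewrite scaler0.
rewrite innerZl innerZr mulrA -invfM -expr2 sqr_sqrtr ?ltW//.
by rewrite mulVf// gt_eqF.
Qed.

Lemma pder_inner i (V W : 'rV[R]_n -> 'rV[R]_N) u :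
  differentiable V u -> differentiable W u -> U u ->
  pder i (fun v => inner (G (f v)) (V v) (W v) : R^o) u =
  inner (G (f u)) (cov G f i V u) (W u) + inner (G (f u)) (V u) (cov G f i W u).
Proof.
move=> dV dW Uu; have dG := smooth_diff (smooth_Gf oD sG oU fD sf) Uu.
have d1 := differentiable_mulmx (differentiable_mulmx dV dG) (differentiable_trmx dW).
have e := congr1 (fun M : 'M[R]_1 => M 0 0)
  (cov_product oD sG symG unitG oU fD sf i dV dW Uu).
apply: (etrans (esym (derive_entry (delta_mx 0 i) 0 0 d1))); apply: (etrans e).
exact: mxE.
Qed.

Section FlatNormal.
Variables (W : set 'rV[R]_n) (nu : 'rV[R]_n -> 'rV[R]_N).
Hypothesis oW : open W.
Hypothesis WU : W `<=` U.
Hypothesis snu : smooth_on W nu.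
Hypothesis unu : forall u, W u -> unit_normal G f u (nu u).

(** The derivative of a unit field is orthogonal to it, so in the frame [nu] the normal connection
    is plain differentiation of the coordinate. *)
Lemma normal_cov_coord i (xi : 'rV[R]_n -> 'rV[R]_N) u : smooth_on W xi ->
  (forall v, W v -> normal_at G f v (xi v)) -> W u ->
  normal_cov G f i xi u =
  pder i (fun v => inner (G (f v)) (xi v) (nu v) : R^o) u *: nu u.
Proof.
move=> sxi nxi Wu; have Uu := WU Wu; have [nnu nu1] := unu Wu.
rewrite /normal_cov (normal_part_unit _ Uu (unu Wu)) ambient_covE; congr (_ *: _).
have dnu := smooth_diff snu Wu; have dxi := smooth_diff sxi Wu.
have sGu := symG (fD Uu).
have nn : inner (G (f u)) (nu u) (cov G f i nu u) = 0.
  have := pder_inner i dnu dnu Uu.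
  have -> : pder i (fun v => inner (G (f v)) (nu v) (nu v) : R^o) u = 0.
    apply: (etrans (pder_eq (g := fun=> 1 : R^o) i oW _ Wu)); last exact: derive_cst.
    by move=> v Wv; have [] := unu Wv.
  rewrite (innerC _ _ sGu); move: (inner _ _ _) => x; lra.
rewrite (pder_inner i dxi dnu Uu).
rewrite [X in _ = _ + X](_ : _ = 0) ?addr0//.
by rewrite (normal_span symG fD posG freeJ N_n Uu (unu Wu) (nxi _ Wu)) innerZl nn mulr0.
Qed.

(** With [phi] the coordinate of [xi] along [nu], the claim becomes symmetry of the second partial
    derivatives of [phi]. *)
Lemma normal_cov_comm i j (xi : 'rV[R]_n -> 'rV[R]_N) u : smooth_on W xi ->
  (forall v, W v -> normal_at G f v (xi v)) -> W u ->
  normal_cov G f i (normal_cov G f j xi) u = normal_cov G f j (normal_cov G f i xi) u.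
Proof.
move=> sxi nxi Wu.
pose phi v : R^o := inner (G (f v)) (xi v) (nu v).
have sphi : smooth_on W phi.
  exact: (smooth_inner oW (smooth_subset WU (smooth_Gf oD sG oU fD sf)) sxi snu).
have second a b : normal_cov G f a (normal_cov G f b xi) u = pder a (pder b phi) u *: nu u.
  pose eta v := pder b phi v *: nu v.
  have seta : smooth_on W eta := smooth_scalemx oW (smooth_pder b sphi) snu.
  have neta v : W v -> normal_at G f v (eta v).
    move=> Wv; apply/normal_atP; rewrite -!scalemxAl.
    by have [/normal_atP -> _] := unu Wv; rewrite scaler0.
  (* The derivative at [u] depends only on the germ, so the inner field may be replaced by [eta],
     which agrees with it on the open set [W]. *)
  have E : normal_cov G f a (normal_cov G f b xi) u = normal_cov G f a eta u.
    have eqW v : W v -> normal_cov G f b xi v = eta v.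
      by move=> Wv; exact: normal_cov_coord.
    rewrite {1}/normal_cov [in RHS]/normal_cov !ambient_covE /cov.
    by rewrite (pder_eq (g := eta) a oW eqW Wu) (eqW _ Wu).
  rewrite E (normal_cov_coord a seta neta Wu); congr (_ *: _).
  apply: (pder_eq a oW _ Wu) => v Wv; have [_ nu1] := unu Wv.
  by rewrite /eta innerZl nu1 mulr1.
by rewrite !second (pder_comm_real i j oW sphi Wu).
Qed.

End FlatNormal.

Lemma hypersurface_flat_normal : flat_normal_connection G f U.
Proof.
move=> W xi oW WU sxi nxi u Wu i j.
have [W' [nu [oW' W'u W'U snu unu]]] := local_unit_normal (WU u Wu).
have oI : open (W `&` W') := openI oW oW'.
apply: (normal_cov_comm (W := W `&` W') (nu := nu) oI) => //.
- by move=> v [/WU].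
- by apply: smooth_subset snu => v [].
- by move=> v [_ /unu].
- by apply: smooth_subset sxi => v [].
- by move=> v [/nxi].
Qed.

(** [w] is the last vector of the frame in [special_shape]. Every unit normal is a multiple of the
    one given there, so the same [w] serves for all of them, with rescaled eigenvalues. *)
Lemma special_distinguished (r : R) u e : U u -> unit_normal G f u e ->
  special_shape G f r u -> exists w : 'rV[R]_n, w != 0 /\
  forall e', unit_normal G f u e' ->
    distinguished_direction G f u (shape_operator G f u e') w.
Proof.
move=> Uu ne [E [e' [a [EE [ne' sh]]]]].
have [uE ug gE _] := mulmx1_tr EE.
pose w := row ord_max E; pose b := n%:R * (n%:R - 1) / r * a.
have EA : E *m shape_operator G f u e' = special_diag n r a *m E.
  by rewrite -sh mulmxKV.
exists w; split.
  rewrite /w rowE; apply/eqP => /(congr1 (fun x => x *m invmx E)).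
  rewrite mulmxK// mul0mx => /rowP/(_ ord_max); rewrite !mxE !eqxx => /eqP.
  by rewrite oner_eq0.
move=> e1 ne1; pose s := inner (G (f u)) e1 e'.
have eE : e1 = s *: e' := normal_span symG fD posG freeJ N_n Uu ne' ne1.1.
have shE : shape_operator G f u e1 = s *: shape_operator G f u e'.
  rewrite /shape_operator scalemxAl; congr (_ *m _).
  by apply/matrixP => i j; rewrite !mxE [in LHS]eE innerZr.
exists (s * a), (s * b); rewrite shE; split; apply/eigenspaceP; last first.
  rewrite -scalemxAr -row_mul EA row_mul row_diag_mx -scalemxAl -rowE mxE eqxx.
  by rewrite scalerA.
(* Vectors orthogonal to [w] have last coordinate zero in the frame, and on those the diagonal
   matrix is multiplication by [a]. *)
set Y := kermx _; have Yw : Y *m g u *m w^T = 0 by rewrite -mulmxA mulmx_ker.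
pose Y' := Y *m g u *m E^T; have YE : Y' *m E = Y := frame_expand EE Y.
have Y'0 i : Y' i ord_max = 0.
  have w0 : row 0 w = row ord_max E by apply/rowP => j; rewrite mxE.
  have := congr1 (fun M : 'M[R]_(n, 1) => M i 0) Yw.
  by rewrite inner_mulmx w0 [X in _ = X -> _]mxE /Y' inner_mulmx.
clearbody Y'; rewrite -scalemxAr -YE -mulmxA EA mulmxA -scalerA [in RHS]scalemxAl; congr (_ *: (_ *m _)).
rewrite /special_diag mul_mx_diag; apply/matrixP => i j; rewrite !mxE mulrC.
case: (unliftP ord_max j) => [j'|] ->; last by rewrite Y'0 !mulr0.
by rewrite lift_max eqSS ltn_eqF.
Qed.

Lemma special_quasi_umbilical (r : R) : (forall u, U u -> special_shape G f r u) ->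
  invariantly_quasi_umbilical G f U.
Proof.
move=> sp u0 Uu0; have [W [nu [oW Wu0 WU snu unu]]] := local_unit_normal Uu0.
exists W, (fun=> nu); split => //; split => //; split => //; split.
  split; first by [].
  split; first by move=> u /unu[].
  move=> u Wu al be; have [_ ->] := unu _ Wu.
  (* Since [N - n = 1], the index set of the normal frame has a single element. *)
  suff -> : al == be by [].
  by move: al be; rewrite N_n subSnn => al be; rewrite !ord1.
move=> u Wu; have [w [w0 dw]] := special_distinguished (WU _ Wu) (unu _ Wu) (sp _ (WU _ Wu)).
by exists w; split => // _; exact: dw (unu _ Wu).
Qed.

End UnitNormalField.

(** Once the sizes are identified, a right inverse of a square matrix is a left inverse. The
    equation [p = q] is a hypothesis because [1 + n] and [gr_dim m] agree only propositionally. *)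
Lemma orthonormal_basis_resolution (F : comUnitRingType) p q (A : 'M[F]_(p, q)) (S : 'M[F]_q) :
  p = q -> A *m S *m A^T = 1%:M -> S *m A^T *m A = 1%:M.
Proof.
move=> pq; move: A; rewrite pq => A AA; apply: mulmx1C; rewrite mulmxA; exact: AA.
Qed.

(** * Sums of sectional curvatures over frames *)

Section EinsteinSum.
Variables (R : realType) (m n : nat) (z : 'rV[R]_(gr_dim m)).
Hypothesis Dz : regular_set z.
Hypothesis N_n : gr_dim m = n.+1.
Notation G := (@gr_metric R m).
Notation cm := (@cmatrix R m).
Notation S x y := (sectional G z x y).

Lemma sectional_gr_sym x y : S x y = S y x.
Proof. by rewrite !sectional_gr// sect_sym. Qed.

Lemma sectional_gr_diag x : S x x = 0.
Proof. by rewrite sectional_gr// sect_diag. Qed.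

(** The sum over an orthonormal basis is the trace of [X |-> R(X, y) y], whose coordinate matrix is
    [T]. *)
Lemma sum_sectional_gr p (F : 'M[R]_(p, gr_dim m)) y : p = gr_dim m ->
  F *m G z *m F^T = 1%:M ->
  \sum_a S (row a F) y = - (2 * m%:R + 4) * inner (G z) y y.
Proof.
move=> pN FF; have FF' := orthonormal_basis_resolution pN FF.
pose T : 'M[R]_(gr_dim m) :=
  \matrix_a rmatrix (Rcurv (cm z) (cm (delta_mx 0 a)) (cm y) (cm y)).
have TL a : delta_mx 0 a *m T = rmatrix (Rcurv (cm z) (cm (delta_mx 0 a)) (cm y) (cm y)).
  by rewrite -rowE rowK.
have Tx x : x *m T = rmatrix (Rcurv (cm z) (cm x) (cm y) (cm y)).
  apply: (can_inj (@cmatrixK R m)); rewrite rmatrixK (cmatrix_expand x) Rcurv_suml.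
  rewrite mulmx_sum_row cmatrix_sum; apply: eq_bigr => a _.
  by rewrite cmatrixZ rowK rmatrixK.
rewrite inner_gr_metric -(ricci_trace TL).
transitivity (\tr (F *m T *m G z *m F^T)); last first.
  by rewrite mxtrace_mulC !mulmxA mxtrace_mulC !mulmxA FF' mul1mx.
apply: eq_bigr => a _; rewrite inner_mulmx row_mul Tx sectional_gr// /sect.
by rewrite inner_gr_metric rmatrixK.
Qed.

(** For each tangent vector the sum is its Ricci value less the curvature of its plane with [e].
    These [n] plane curvatures add up to the Ricci value of [e], whence [n - 1]. *)
Lemma sum_sectional_tangent (E : 'M[R]_(n, gr_dim m)) (e : 'rV[R]_(gr_dim m)) :
  E *m G z *m E^T = 1%:M -> e *m G z *m E^T = 0 -> inner (G z) e e = 1 ->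
  \sum_i \sum_j S (row i E) (row j E) = - (2 * m%:R + 4) * (n%:R - 1).
Proof.
move=> EE eE ee; pose F : 'M[R]_(1 + n, gr_dim m) := col_mx e E.
have FF : F *m G z *m F^T = 1%:M := orthonormal_col_mx (@sym_gr_metric R m z) EE eE ee.
have re : row 0 e = e by apply/rowP => j; rewrite mxE.
have sumF y : \sum_i S (row i E) y = - (2 * m%:R + 4) * inner (G z) y y - S e y.
  rewrite -(sum_sectional_gr y (esym N_n : (1 + n)%N = _) FF) big_split_ord /= big_ord1.
  rewrite rowKu re addrAC subrr add0r; apply: eq_bigr => i _.
  by rewrite rowKd.
rewrite exchange_big /=.
under eq_bigr => j _ do rewrite sumF.
rewrite big_split /= sumrN.
have -> : \sum_j S e (row j E) = - (2 * m%:R + 4).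
  under eq_bigr => j _ do rewrite sectional_gr_sym.
  by rewrite sumF ee mulr1 sectional_gr_diag subr0.
rewrite -mulr_sumr (eq_bigr (fun=> 1)) => [|j _]; last first.
  by rewrite -inner_mulmx EE mxE eqxx.
by rewrite sumr_const card_ord; ring.
Qed.

End EinsteinSum.

(** * Hypersurfaces of the Grassmannian *)

Section GrassmannianHypersurface.
Variables (R : realType) (m n : nat).
Variables (U : set 'rV[R]_n) (f : 'rV[R]_n -> 'rV[R]_(gr_dim m)).
Notation G := (@gr_metric R m).
Notation g := (induced_metric G f).
Hypothesis n_gt1 : (1 < n)%N.
Hypothesis N_n : gr_dim m = n.+1.
Hypothesis oU : open U.
Hypothesis sf : smooth_on U f.
Hypothesis fD : forall u, U u -> gr_domain (f u).
Hypothesis freeJ : forall u, U u -> row_free (jac f u).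

Let fD' u (Uu : U u) : regular_set (f u) := domain_regular (fD Uu).
Let posG u x (Uu : U u) := @inner_gr_metric_pos R m (f u) (fD Uu) x.

Lemma rho_bound (r : R) u E e : U u -> Defs.orthonormal g u E -> unit_normal G f u e ->
  (0 < r -> r < n%:R * (n%:R - 1) ->
    (normalized_scalar_curvature g u E <=
       delta_casorati G f r u E e / (n%:R * (n%:R - 1)) - (n%:R + 9) / (2 * n%:R)) /\
    (normalized_scalar_curvature g u E =
       delta_casorati G f r u E e / (n%:R * (n%:R - 1)) - (n%:R + 9) / (2 * n%:R)
     <-> special_shape G f r u)) /\
  (n%:R * (n%:R - 1) < r ->
    (normalized_scalar_curvature g u E <=
       delta_casorati_hat G f r u E e / (n%:R * (n%:R - 1)) - (n%:R + 9) / (2 * n%:R)) /\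
    (normalized_scalar_curvature g u E =
       delta_casorati_hat G f r u E e / (n%:R * (n%:R - 1)) - (n%:R + 9) / (2 * n%:R)
     <-> special_shape G f r u)).
Proof.
(* [n] becomes [k.+1] throughout, since the pointwise results are indexed by the dimension [k] of
   the hyperplanes. *)
case: n n_gt1 N_n U f oU sf fD freeJ fD' posG u E e => [//|k] k1 Nk U' f' oU' sf' fD1 freeJ'
  fD'' posG' u E e Uu EE ne.
have k0 : (0 < k)%N by [].
have oD := @open_regular_set R m; have sG := @smooth_gr_metric R m.
have symG (z : 'rV[R]_(gr_dim m)) (_ : regular_set z) := sym_gr_metric z.
have unitG := @unit_gr_metric R m.
set K := (\tr (E *m hmat G f' u e *m E^T)) ^+ 2 - sqnorm (E *m hmat G f' u e *m E^T).
have c1 : 0 < k.+1%:R - 1 :> R by rewrite -natr1 addrK ltr0n.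
have c0 : 0 < k.+1%:R :> R by rewrite ltr0n.
have c01 : 0 < k.+1%:R * (k.+1%:R - 1) :> R by rewrite mulr_gt0.
have rhoE : normalized_scalar_curvature (induced_metric G f') u E =
    K / (k.+1%:R * (k.+1%:R - 1)) - (k.+1%:R + 9) / (2 * k.+1%:R).
  rewrite /normalized_scalar_curvature.
  rewrite (double_scalar_curvature oD sG symG unitG oU' fD'' sf' posG' freeJ' Nk
    (fun z x y Dz => sectional_gr_sym Dz x y) (fun z x Dz => sectional_gr_diag Dz x) E Uu ne).
  have EJ : (E *m jac f' u) *m G (f' u) *m (E *m jac f' u)^T = 1%:M.
    by move: EE; rewrite /Defs.orthonormal /induced_metric trmx_mul !mulmxA.
  have eJ : e *m G (f' u) *m (E *m jac f' u)^T = 0.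
    by have /normal_atP ne0 := ne.1; rewrite trmx_mul !mulmxA ne0 mul0mx.
  have := sum_sectional_tangent (fD'' u Uu) Nk EJ eJ ne.2.
  under eq_bigr => i _ do under eq_bigr => j _ do rewrite !row_mul.
  move=> ->; rewrite /K.
  (* The ambient dimension [4 m = n + 1] turns [2 m + 4] into [(n + 9) / 2]. *)
  have mE : 4 * m%:R = k.+1%:R + 1 :> R.
    by rewrite natr1 -Nk /gr_dim natrD natrM; ring.
  have -> : - (2 * m%:R + 4) = - (k.+1%:R + 9) / 2 :> R.
    by rewrite (_ : m%:R = (k.+1%:R + 1) / 4); [field|rewrite -mE; field].
  move: (k.+1%:R : R) c0 c1 => c c0 c1.
  by field; rewrite (gt_eqF c1) (gt_eqF c0).
(* Dividing by [n (n - 1) > 0] and shifting is increasing and injective, so it carries over both the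
   inequality and its equality case. *)
have key (delta : R) (P : Prop) : K <= delta /\ (K = delta <-> P) ->
    (normalized_scalar_curvature (induced_metric G f') u E <=
       delta / (k.+1%:R * (k.+1%:R - 1)) - (k.+1%:R + 9) / (2 * k.+1%:R)) /\
    (normalized_scalar_curvature (induced_metric G f') u E =
       delta / (k.+1%:R * (k.+1%:R - 1)) - (k.+1%:R + 9) / (2 * k.+1%:R) <-> P).
  move=> [Kd KP]; rewrite rhoE lerD2r ler_pM2r ?invr_gt0//; split => //.
  rewrite -KP; split=> [/addIr/mulIf|->//]; apply.
  by rewrite invr_eq0 gt_eqF.
split=> [r0 rn|rn]; apply: key.
  exact: (pointwise_delta k0 oD symG oU' fD'' sf' posG' freeJ' Nk Uu EE ne r0 rn).
exact: (pointwise_delta_hat k0 oD symG oU' fD'' sf' posG' freeJ' Nk Uu EE ne rn).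
Qed.

Lemma gr_flat_normal_connection : flat_normal_connection G f U.
Proof.
case: n n_gt1 N_n U f oU sf fD freeJ fD' posG => [//|k] k1 Nk U' f' oU' sf' fD1 freeJ' fD'' posG'.
exact: (hypersurface_flat_normal (@open_regular_set R m) (@smooth_gr_metric R m)
  (fun z _ => sym_gr_metric z) (@unit_gr_metric R m) oU' fD'' sf' posG' freeJ' Nk).
Qed.

Lemma gr_special_quasi_umbilical (r : R) :
  (forall u, U u -> special_shape G f r u) -> invariantly_quasi_umbilical G f U.
Proof.
case: n n_gt1 N_n U f oU sf fD freeJ fD' posG => [//|k] k1 Nk U' f' oU' sf' fD1 freeJ' fD'' posG'.
exact: (special_quasi_umbilical (@open_regular_set R m) (@smooth_gr_metric R m)
  (fun z _ => sym_gr_metric z) oU' fD'' sf' posG' freeJ' Nk).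
Qed.

Lemma gr_exists_frame u : U u ->
  exists (E : 'M[R]_n) (e : 'rV[R]_(gr_dim m)),
    Defs.orthonormal g u E /\ unit_normal G f u e.
Proof.
case: n n_gt1 N_n U f oU sf fD freeJ fD' posG u => [//|k] k1 Nk U' f' oU' sf' fD1 freeJ' fD'' posG' u Uu.
have symG (z : 'rV[R]_(gr_dim m)) (_ : regular_set z) := sym_gr_metric z.
have [E EE] := exists_tangent_frame symG fD'' posG' freeJ' Uu.
have [e ne] := exists_unit_normal posG' Nk Uu.
by exists E, e.
Qed.

End GrassmannianHypersurface.

Theorem theorem3p2 (R : realType) (m : nat) (hm : (2 <= m)%N)
    (M : real_hypersurface R m) :
  let n : R := (hyp_dim m)%:R in
  let G := @gr_metric R m in
  [/\ (* (a) *)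
      forall r : R, 0 < r -> r < n * (n - 1) ->
        forall f u E e, frame_at M f u E e ->
          rho f u E <=
            delta_casorati G f r u E e / (n * (n - 1)) - (n + 9) / (2 * n),
      (* (b) *)
      forall r : R, n * (n - 1) < r ->
        forall f u E e, frame_at M f u E e ->
          rho f u E <=
            delta_casorati_hat G f r u E e / (n * (n - 1)) - (n + 9) / (2 * n),
      (* equality in (a) *)
      forall r : R, 0 < r -> r < n * (n - 1) ->
        ((forall f u E e, frame_at M f u E e ->
            rho f u E =
              delta_casorati G f r u E e / (n * (n - 1)) - (n + 9) / (2 * n))
         <-> [/\ hs_invariantly_quasi_umbilical M,
                 hs_flat_normal_connection M & hs_special_shape M r])
    & (* equality in (b) *)
      forall r : R, n * (n - 1) < r ->
        ((forall f u E e, frame_at M f u E e ->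
            rho f u E =
              delta_casorati_hat G f r u E e / (n * (n - 1)) - (n + 9) / (2 * n))
         <-> [/\ hs_invariantly_quasi_umbilical M,
                 hs_flat_normal_connection M & hs_special_shape M r])].
Proof.
have n_gt1 : (1 < hyp_dim m)%N by rewrite /hyp_dim; lia.
have N_n : gr_dim m = (hyp_dim m).+1 by rewrite /hyp_dim /gr_dim; lia.
move=> n G.
have oU x (Mx : sm_atlas M x) := (sm_homeo Mx).1.
have sf x (Mx : sm_atlas M x) := sm_imm_smooth Mx.
have fD (x : local_param R (hyp_dim m) M) u (_ : lp_dom x u) : gr_domain ((sm_imm M \o x) u) := sm_imm_dom (x u).
have freeJ x (Mx : sm_atlas M x) u (xu : lp_dom x u) := sm_imm_immersion Mx xu.
have bound x (Mx : sm_atlas M x) r u E e := @rho_bound R m _ _ _ n_gt1 N_n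
  (oU x Mx) (sf x Mx) (fD x) (freeJ x Mx) r u E e.
(* Both equality clauses at once, with the Casorati curvature abstracted as [delta]: equality in one
   frame is already equivalent to [special_shape] at the point, a condition in which no frame is
   fixed. *)
have equality r (delta : forall f u (E : 'M[R]_(hyp_dim m)) (e : 'rV[R]_(gr_dim m)), R) :
    (forall x, sm_atlas M x -> forall u E e, lp_dom x u ->
       Defs.orthonormal (induced_metric G (sm_imm M \o x)) u E ->
       unit_normal G (sm_imm M \o x) u e ->
       (rho (sm_imm M \o x) u E =
          delta (sm_imm M \o x) u E e / (n * (n - 1)) - (n + 9) / (2 * n)
        <-> special_shape G (sm_imm M \o x) r u)) ->
    (forall f u E e, frame_at M f u E e ->
       rho f u E = delta f u E e / (n * (n - 1)) - (n + 9) / (2 * n))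
    <-> [/\ hs_invariantly_quasi_umbilical M,
            hs_flat_normal_connection M & hs_special_shape M r].
  move=> eqP; split=> [eqD|[_ _ sp] f u E e [[x [Mx [xu ->]]] [EE ne]]]; last first.
    by apply/(eqP x Mx u E e xu EE ne); exact: sp.
  have sp : hs_special_shape M r.
    (* Every point carries a frame, so the hypothesis on all frames says something there. *)
    move=> x u Mx xu; have [E [e [EE ne]]] := gr_exists_frame n_gt1 N_n (oU x Mx) (sf x Mx) (fD x) (freeJ x Mx) xu.
    apply/(eqP x Mx u E e xu EE ne); apply: eqD; split; last by [].
    by exists x.
  split; [|move=> x Mx|exact: sp].
    move=> x Mx; apply: (gr_special_quasi_umbilical n_gt1 N_n (oU x Mx) (sf x Mx) (fD x)
      (freeJ x Mx) (r := r)) => u xu; exact: sp.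
  exact: (gr_flat_normal_connection n_gt1 N_n (oU x Mx) (sf x Mx) (fD x) (freeJ x Mx)).
split=> [r r0 rn f u E e [[x [Mx [xu ->]]] [EE ne]]|r rn f u E e [[x [Mx [xu ->]]] [EE ne]]
        |r r0 rn|r rn].
- exact: ((bound x Mx r u E e xu EE ne).1 r0 rn).1.
- exact: ((bound x Mx r u E e xu EE ne).2 rn).1.
- apply: (equality r (fun f => delta_casorati G f r)) => x Mx u E e xu EE ne.
  exact: ((bound x Mx r u E e xu EE ne).1 r0 rn).2.
- apply: (equality r (fun f => delta_casorati_hat G f r)) => x Mx u E e xu EE ne.
  exact: ((bound x Mx r u E e xu EE ne).2 rn).2.
Qed.
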